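(* Let $\Omega\subset\mathbb{C}$ be a domain, $V\subset\Omega$ an open subset and $F\subset\{0,1,2,\dots\}$. Let $X(\Omega,V,F)$ be the set of functions $f\in H(\Omega)$ such that $f^{(l)}|_V$ is bounded for every $l\in F$. If for every point $\zeta\in\overline{V}\cap\partial\Omega$ there exist points of $\mathbb{C}\setminus\overline{\Omega}$ arbitrarily close to $\zeta$, then $\Omega$ is an $X(\Omega,V,F)$-domain of holomorphy and the set $\{f\in X(\Omega,V,F): f\text{ is non-extendable}\}$ is $G_\delta$ and dense in $X(\Omega,V,F)$.
   Context: A domain is a nonempty open connected set; $H(\Omega)$ is the set of holomorphic functions $\Omega\to\mathbb{C}$; closures and boundaries are taken in $\mathbb{C}$. The space $X(\Omega,V,F)$ carries the topology induced by the seminorms $\|f|_{K_m}\|_\infty$, $m=1,2,\dots$, and $\|f^{(l)}|_V\|_\infty$, $l\in F$, where $\{K_m\}_{m\ge1}$ is an exhaustive sequence of compact subsets of $\Omega$ (increasing, and every compact subset of $\Omega$ is contained in some $K_m$). A holomorphic function $f:\Omega\to\mathbb{C}$ is extendable if there exist an open connected set $U\subset\mathbb{C}$ with $U\cap\Omega\neq\emptyset$ and $U\cap\Omega^{\mathrm c}\neq\emptyset$, a holomorphic function $G:U\to\mathbb{C}$ and a connected component $W$ of $U\cap\Omega$ such that $G|_W=f|_W$. Otherwise $f$ is non-extendable. For $X\subset H(\Omega)$, $\Omega$ is called an $X$-domain of holomorphy if there exists $f\in X$ which is non-extendable. *)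

(* Defs.v *)
From HB Require Import structures.
From mathcomp Require Import all_boot all_order all_algebra.
From mathcomp Require Import complex.
From mathcomp Require Import all_classical all_reals.
From mathcomp Require Import topology normedtype derive borel_hierarchy.
Set Implicit Arguments.
Unset Strict Implicit.
Unset Printing Implicit Defensive.
Import Order.TTheory GRing.Theory Num.Theory.
Import numFieldNormedType.Exports.
Local Open Scope classical_set_scope.
Local Open Scope ring_scope.

(* Packing R[i] as a numFieldType gives it the canonical topology and norm of *)
(* a numFieldType, with C as its own field of scalars: the derivatives below  *)
(* are therefore complex derivatives.                                         *)
Definition C (R : realType) : numFieldType := (R[i])%C.

Section Holomorphy.
Context {R : realType}.
Implicit Types (A Omega U V : set (C R)) (f G : C R -> C R).

Definition domain Omega := [/\ Omega !=set0, open Omega & connected Omega].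

Definition boundary A : set (C R) := closure A `\` A^°.

(* Only meant for open A. *)
Definition holomorphic A f := forall z, A z -> derivable f z 1.

(* A function on Omega is encoded as a total function which is 0 outside      *)
(* Omega, so that equality is equality of functions on Omega.                 *)
Definition holo Omega : set (C R -> C R) :=
  [set f | holomorphic Omega f /\ forall z, ~ Omega z -> f z = 0].

(* The connected components of U `&` Omega are the sets                       *)
(* connected_component (U `&` Omega) x for x in U `&` Omega.                  *)
Definition extendable Omega f :=
  exists U G x,
    [/\ open U, connected U, U `&` Omega !=set0 & U `&` ~` Omega !=set0] /\
    [/\ holomorphic U G, (U `&` Omega) x &
        forall z, connected_component (U `&` Omega) x z -> G z = f z].

Definition non_extendable Omega f := ~ extendable Omega f.

Definition domain_of_holomorphy (X : set (C R -> C R)) Omega :=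
  exists2 f, X f & non_extendable Omega f.

Definition exhaustive (K : nat -> set (C R)) Omega :=
  [/\ forall m, compact (K m), forall m, K m `<=` Omega,
      forall m, K m `<=` K m.+1 &
      forall A, compact A -> A `<=` Omega -> exists m, A `<=` K m].

Definition bounded_derivatives Omega V (F : set nat) : set (C R -> C R) :=
  [set f | holo Omega f /\
           forall l, F l -> [bounded derive1n l f z | z in V]].

(* `|f z| has type C R and is real: complex.Re only casts it to R. The        *)
(* supremum over the empty set is 0.                                          *)
Definition sup_norm A f : R := sup [set complex.Re `|f z| | z in A].

Definition seminorms V (F : set nat) (K : nat -> set (C R)) :
    set ((C R -> C R) -> R) :=
  [set sup_norm (K m) | m in setT] `|`
  [set (fun f => sup_norm V (derive1n l f)) | l in F].

End Holomorphy.

Section Space.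
Context {R : realType}.
Variables (Omega V : set (C R)) (F : set nat).

(* The exhaustive sequence K only determines the topology. *)
Definition Xspace (K : nat -> set (C R)) : Type :=
  set_type (bounded_derivatives Omega V F).

Variable K : nat -> set (C R).
Local Notation X := (Xspace K).

HB.instance Definition _ := Choice.copy X
  (set_type (bounded_derivatives Omega V F)).

Definition Xfun (f : X) : C R -> C R := set_val f.

Definition Xball (p : (C R -> C R) -> R) (f : X) (r : R) : set X :=
  [set g | p (Xfun g \- Xfun f) < r].

Definition Xsubbase : set (set X) :=
  [set B | exists p f r, seminorms V F K p /\ B = Xball p f r].

HB.instance Definition _ := isSubBaseTopological.Build X Xsubbase id.

End Space.

(* Main.v *)
Require Import Defs.
From HB Require Import structures.
From mathcomp Require Import all_boot all_order all_algebra.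
From mathcomp Require Import complex.
From mathcomp Require Import all_classical all_reals.
From mathcomp Require Import topology normedtype sequences derive borel_hierarchy.
From mathcomp Require Import ring lra.
Set Implicit Arguments.
Unset Strict Implicit.
Unset Printing Implicit Defensive.
Import Order.TTheory GRing.Theory Num.Theory.
Import numFieldNormedType.Exports.
Local Open Scope classical_set_scope.
Local Open Scope ring_scope.

(** The theorem compares a function f with its Taylor series. Suppose that f extends
beyond Omega. Then, at some point c of Omega as close to the boundary as
necessary, the Taylor coefficients of f satisfy the Cauchy estimates
|a_n| rho^n <= M on a disc of radius rho which meets the complement of Omega.
Conversely, such estimates make the Taylor series converge on this disc and give
an extension of f, by the identity theorem. One may take c rational, rho a power
of 1/2 and M a natural number ([extendable_tame]). So the extendable functions
are a countable union of sets E_t, and each E_t is closed because the coefficient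
a_n depends continuously on the values of f on a compact contour ([open_coef]).
This gives the G-delta property.

For density it suffices to find, in each neighbourhood of each f0, a function
outside all E_t. The hypothesis on Omega provides, in the disc coded by t, a point
p_t which is neither in Omega nor in the closure of V ([pole_exists]). The
function 1/(z - p_t) has all its derivatives bounded on V, and its Taylor
coefficients at the centre of the disc satisfy no estimate |a_n| rho^n <= M,
because p_t lies in the disc ([taylor_coef_pole_unbounded]). A series
f0 + sum of e_t / (z - p_t), with positive e_t chosen one after the other, is then
outside all E_t at once ([gliding_hump], [condensation]). This is the proof of
Baire's theorem, carried out on the coefficients e_t.

Everything rests on complex analysis for functions that are merely differentiable
at every point. Contours are boundaries of squares, and integrals are limits of
dyadic Riemann sums, for which bisection of squares is exact ([contourS]).
Goursat's theorem with one exceptional point ([goursat]) gives Cauchy's formula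
([cauchy_formula]). From it come Taylor expansions ([taylor_cvg]), the theorem of
Weierstrass on limits of holomorphic functions ([weierstrass]), the holomorphy of
derivatives ([holomorphic_derive1]) and the identity theorem
([identity_theorem]). *)

(** * The real-valued modulus, limits and derivatives in epsilon-delta form *)

Section Norm.
Context {R : realType}.
Implicit Types (z w : C R) (x y : R).

(** The modulus with values in R: the norm of [C R] takes its values in [C R],
where only part of the arithmetic of real inequalities is available. *)
Definition nrm z : R := complex.Re `|z|.
Definition toC x : C R := real_complex R x.

Lemma nrmE z : `|z| = toC (nrm z).
Proof. by rewrite /nrm /toC normc_def. Qed.

Lemma nrm_sqrt z : nrm z = Num.sqrt (complex.Re z ^+ 2 + complex.Im z ^+ 2).
Proof. by rewrite /nrm normc_def. Qed.

Lemma nrm_ge0 z : 0 <= nrm z.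
Proof. by rewrite nrm_sqrt sqrtr_ge0. Qed.

Lemma nrmD z w : nrm (z + w) <= nrm z + nrm w.
Proof. by rewrite -lecR rmorphD /= -![_%:C%C]/(toC _) -!nrmE ler_normD. Qed.

Lemma nrmM z w : nrm (z * w) = nrm z * nrm w.
Proof. by apply: complexI; rewrite rmorphM /= -![_%:C%C]/(toC _) -!nrmE normrM. Qed.

Lemma nrmN z : nrm (- z) = nrm z.
Proof. by rewrite /nrm normrN. Qed.

Lemma nrm_toC x : nrm (toC x) = `|x|.
Proof. by rewrite nrm_sqrt /= expr0n addr0 sqrtr_sqr. Qed.

Lemma nrm0 : nrm 0 = 0.
Proof. by rewrite /nrm normr0. Qed.

Lemma nrm1 : nrm 1 = 1.
Proof. by rewrite /nrm normr1. Qed.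

Lemma nrm_eq0 z : (nrm z == 0) = (z == 0).
Proof. by rewrite -(normr_eq0 z) nrmE -(inj_eq (@complexI R)). Qed.

Lemma nrm_gt0 z : (0 < nrm z) = (z != 0).
Proof. by rewrite lt_neqAle nrm_ge0 andbT eq_sym nrm_eq0. Qed.

Lemma nrmV z : nrm z^-1 = (nrm z)^-1.
Proof.
have [->|z0] := eqVneq z 0; first by rewrite invr0 nrm0 invr0.
have n0 : nrm z != 0 by rewrite nrm_eq0.
by apply: (mulfI n0); rewrite -nrmM !mulfV ?nrm1.
Qed.

Lemma nrmX z n : nrm (z ^+ n) = nrm z ^+ n.
Proof. by elim: n => [|n IH]; rewrite ?nrm1 // !exprS nrmM IH. Qed.

Lemma nrm_i : nrm 'i%C = 1.
Proof. by rewrite nrm_sqrt /= expr0n add0r expr1n sqrtr1. Qed.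

Lemma nrmB z w : nrm (z - w) <= nrm z + nrm w.
Proof. by rewrite -(nrmN w) nrmD. Qed.

Lemma nrmBC z w : nrm (z - w) = nrm (w - z).
Proof. by rewrite -nrmN opprB. Qed.

Lemma nrm_le_dist z w : nrm z <= nrm w + nrm (z - w).
Proof. by have := nrmD w (z - w); rewrite addrC subrK. Qed.

Lemma Re_le_nrm z : `|complex.Re z| <= nrm z.
Proof. by rewrite nrm_sqrt -sqrtr_sqr ler_wsqrtr// lerDl sqr_ge0. Qed.

Lemma Im_le_nrm z : `|complex.Im z| <= nrm z.
Proof. by rewrite nrm_sqrt -sqrtr_sqr ler_wsqrtr// lerDr sqr_ge0. Qed.

Lemma ReImE z : z = toC (complex.Re z) + 'i%C * toC (complex.Im z).
Proof. by rewrite [LHS]complexE. Qed.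

Lemma nrm_le_ReIm z : nrm z <= `|complex.Re z| + `|complex.Im z|.
Proof.
rewrite {1}(ReImE z); apply: le_trans (nrmD _ _) _.
by rewrite nrmM nrm_i mul1r !nrm_toC.
Qed.

Lemma ReD z w : complex.Re (z + w) = complex.Re z + complex.Re w.
Proof. by case: z w => [a b] [c d]. Qed.
Lemma ImD z w : complex.Im (z + w) = complex.Im z + complex.Im w.
Proof. by case: z w => [a b] [c d]. Qed.
Lemma ReN z : complex.Re (- z) = - complex.Re z.
Proof. by case: z. Qed.
Lemma ImN z : complex.Im (- z) = - complex.Im z.
Proof. by case: z. Qed.
Lemma Re_toCM x z : complex.Re (toC x * z) = x * complex.Re z.
Proof. by case: z => a b; rewrite /toC /=; simpc. Qed.
Lemma Im_toCM x z : complex.Im (toC x * z) = x * complex.Im z.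
Proof. by case: z => a b; rewrite /toC /=; simpc. Qed.

Lemma toC_gt0 x : (0 < toC x) = (0 < x).
Proof. exact: ltcR. Qed.

Lemma gt0_toC z : 0 < z -> exists2 x, 0 < x & z = toC x.
Proof.
rewrite ltcE => /andP[/eqP i0 r0]; exists (complex.Re z) => //.
by rewrite [LHS]ReImE i0 /toC rmorph0 mulr0 addr0.
Qed.

Lemma nbhs_nrm z (A : set (C R)) :
  nbhs z A <-> exists2 e, 0 < e & forall w, nrm (w - z) < e -> A w.
Proof.
split=> [/nbhs_ballP[e /gt0_toC[x x0 ->] sA]|[e e0 sA]].
  exists x => // w wz; apply: sA; rewrite -ball_normE /=.
  by rewrite distrC nrmE ltcR.
apply/nbhs_ballP; exists (toC e); rewrite /= ?toC_gt0// => w.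
by rewrite -ball_normE /= distrC nrmE ltcR => /sA.
Qed.

Lemma open_nrm (A : set (C R)) :
  open A <-> forall z, A z -> exists2 e, 0 < e & forall w, nrm (w - z) < e -> A w.
Proof.
rewrite openE; split=> oA z Az; first exact/nbhs_nrm/oA.
exact/nbhs_nrm/oA.
Qed.

Lemma closure_nrm (A : set (C R)) z :
  closure A z <-> forall e, 0 < e -> exists2 w, A w & nrm (w - z) < e.
Proof.
split=> [cA e e0|cA B /nbhs_nrm[e e0 sB]].
  have [w [Aw wz]] : A `&` [set w | nrm (w - z) < e] !=set0.
    by apply: cA; apply/nbhs_nrm; exists e.
  by exists w.
by have [w Aw wz] := cA e e0; exists w; split => //; apply: sB.
Qed.

Lemma cvgn_nrm (u : nat -> C R) (l : C R) :
  u @ \oo --> l <->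
  forall e, 0 < e -> exists N, forall n, (N <= n)%N -> nrm (u n - l) < e.
Proof.
split=> [ul e e0|H].
  have : nbhs (l : C R) [set w : C R | nrm (w - l) < e] by apply/nbhs_nrm; exists e.
  by move=> /ul[N _ HN]; exists N => n Nn; exact: HN.
move=> A /nbhs_nrm[e e0 sA]; have [N HN] := H e e0.
by exists N => // n /= Nn; apply/sA/HN.
Qed.

Lemma cvgn_unique (u : nat -> C R) (l l' : C R) :
  u @ \oo --> l -> u @ \oo --> l' -> l = l'.
Proof. by move=> ul ul'; apply: (cvg_unique _ ul ul'); exact: norm_hausdorff. Qed.

Lemma cvgn_cst (k : C R) : (fun=> k) @ \oo --> k.
Proof. by apply/cvgn_nrm => e e0; exists 0%N => n _; rewrite subrr nrm0. Qed.

Lemma cvgn_add (u v : nat -> C R) (l m : C R) :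
  u @ \oo --> l -> v @ \oo --> m -> (fun n => u n + v n) @ \oo --> l + m.
Proof.
move=> /cvgn_nrm ul /cvgn_nrm vm; apply/cvgn_nrm => e e0.
have e20 : 0 < e / 2 by rewrite divr_gt0.
have [N HN] := ul _ e20; have [M HM] := vm _ e20.
exists (maxn N M) => n; rewrite geq_max => /andP[Nn Mn].
rewrite opprD addrACA [e]splitr; apply: le_lt_trans (nrmD _ _) _.
by rewrite ltrD ?HN ?HM.
Qed.

Lemma cvgn_scale (k : C R) (u : nat -> C R) (l : C R) :
  u @ \oo --> l -> (fun n => k * u n) @ \oo --> k * l.
Proof.
move=> /cvgn_nrm ul; apply/cvgn_nrm => e e0.
have k0 : 0 < 1 + nrm k by rewrite ltr_pwDl// nrm_ge0.
have [N HN] := ul _ (divr_gt0 e0 k0).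
exists N => n /HN; rewrite -mulrBr nrmM ltr_pdivlMr// mulrDr mulr1 mulrC => h.
by apply: le_lt_trans h; rewrite lerDr nrm_ge0.
Qed.

Lemma cvgn_opp (u : nat -> C R) (l : C R) :
  u @ \oo --> l -> (fun n => - u n) @ \oo --> - l.
Proof.
move=> /(@cvgn_scale (-1) u l); rewrite mulN1r.
by under eq_fun do rewrite mulN1r.
Qed.

Lemma cvgn_eq (u v : nat -> C R) (l : C R) :
  u =1 v -> u @ \oo --> l -> v @ \oo --> l.
Proof. by move=> /funext ->. Qed.

Lemma cvgn_shiftS (u : nat -> C R) (l : C R) :
  u @ \oo --> l -> (fun n => u n.+1) @ \oo --> l.
Proof.
move=> /cvgn_nrm ul; apply/cvgn_nrm => e /ul[N HN].
by exists N => n Nn; apply: HN; exact: leqW.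
Qed.

Lemma cvgn_nrm_le (u : nat -> C R) (l : C R) m N :
  u @ \oo --> l -> (forall n, (N <= n)%N -> nrm (u n) <= m) -> nrm l <= m.
Proof.
move=> /cvgn_nrm ul um; apply/ler_addgt0Pr => e e0.
have [M HM] := ul e e0.
have := HM (maxn M N) (leq_maxl _ _); have := um (maxn M N) (leq_maxr _ _).
move=> h1 h2; apply: le_trans (nrm_le_dist l (u (maxn M N))) _.
by rewrite lerD// nrmBC ltW.
Qed.

End Norm.

Section Complete.
Context {R : realType}.

Lemma cvgn_real (x : nat -> R) (l : R) :
  x @ \oo --> l -> forall e, 0 < e -> exists N, forall n, (N <= n)%N -> `|x n - l| < e.
Proof.
move=> /cvgrPdist_lt xl e e0; have [N _ HN] := xl e e0.
by exists N => n Nn; rewrite distrC; exact: HN.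
Qed.

Lemma cauchyn_real (x : nat -> R) :
  (forall e, 0 < e -> exists N, forall n m, (N <= n)%N -> (N <= m)%N ->
      `|x n - x m| <= e) ->
  cvgn x.
Proof.
move=> H; apply/cauchy_cvgP/cauchy_exP => e e0.
have [N HN] := H (e / 2) (divr_gt0 e0 (ltr0n _ 2)).
exists (x N); exists N => // n /= Nn; rewrite -ball_normE /=.
by apply: le_lt_trans (HN N n _ _) _; rewrite // ltr_pdivrMr// ltr_pMr// ltr1n.
Qed.

(** Completeness of the complex numbers, one real coordinate at a time. *)
Lemma cauchyn_cvgn (u : nat -> C R) :
  (forall e, 0 < e -> exists N, forall n m, (N <= n)%N -> (N <= m)%N ->
      nrm (u n - u m) <= e) ->
  exists l : C R, u @ \oo --> l.
Proof.
move=> H.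
have cr : cvgn (fun n => complex.Re (u n)).
  apply: cauchyn_real => e /H[N HN]; exists N => n m Nn Nm.
  by apply: le_trans (HN n m Nn Nm); apply: le_trans (Re_le_nrm _); rewrite ReD ReN.
have ci : cvgn (fun n => complex.Im (u n)).
  apply: cauchyn_real => e /H[N HN]; exists N => n m Nn Nm.
  by apply: le_trans (HN n m Nn Nm); apply: le_trans (Im_le_nrm _); rewrite ImD ImN.
move: cr ci => /cvg_ex[/= a /cvgn_real ca] /cvg_ex[/= b /cvgn_real cb].
exists (toC a + 'i%C * toC b); apply/cvgn_nrm => e e0.
have e20 : 0 < e / 2 by rewrite divr_gt0.
have [N HN] := ca _ e20; have [M HM] := cb _ e20.
exists (maxn N M) => n; rewrite geq_max => /andP[Nn Mn].
apply: le_lt_trans (nrm_le_ReIm _) _; rewrite [e]splitr.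
have -> : complex.Re (u n - (toC a + 'i%C * toC b)) = complex.Re (u n) - a.
  by case: (u n) => p q; rewrite /toC /=; simpc; rewrite ?(mul0r, mul1r, mulr0); lra.
have -> : complex.Im (u n - (toC a + 'i%C * toC b)) = complex.Im (u n) - b.
  by case: (u n) => p q; rewrite /toC /=; simpc; rewrite ?(mul0r, mul1r, mulr0); lra.
by rewrite ltrD ?HN ?HM.
Qed.
End Complete.

Section Derive.
Context {R : realType}.
Implicit Types (f : C R -> C R) (z : C R).

(** The Frechet form of complex differentiability. Unlike the limit of difference
quotients it excludes no point, so that it enters estimates directly. *)
Lemma is_derive_nrm f z (d : C R) :
  is_derive z 1 f d <->
  forall e, 0 < e -> exists2 r, 0 < r & forall w, nrm (w - z) < r ->
     nrm (f w - f z - d * (w - z)) <= e * nrm (w - z).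
Proof.
have key : is_derive z 1 f d <->
  (fun h => h^-1 *: ((f \o shift z) (h *: 1) - f z)) @ 0^' --> d.
  split=> [[df <-]//|df]; apply: DeriveDef; first exact: (@cvgP (C R) _ d).
  exact: cvg_lim.
have alg (h : C R) : h != 0 -> nrm (h^-1 *: (f (h *: 1 + z) - f z) - d) =
    (nrm h)^-1 * nrm (f (h + z) - f z - d * h).
  move=> h0; rewrite -nrmV -nrmM; congr nrm; rewrite [h *: 1]mulr1.
  by rewrite [_ *: _]/(_ * _) mulrBr (mulrCA h^-1) mulVf// mulr1.
rewrite key; split=> [df e e0|H].
  have : nbhs (d : C R) [set w : C R | nrm (w - d) < e] by apply/nbhs_nrm; exists e.
  move=> /df; rewrite /nbhs /= /dnbhs /within /= => /nbhs_nrm[r r0 Hr].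
  exists r => // w wz; have [->|wnz] := eqVneq w z.
    by rewrite !subrr mulr0 subr0 nrm0 mulr0.
  have h0 : w - z != 0 by rewrite subr_eq0.
  have := Hr (w - z); rewrite subr0 => /(_ wz h0).
  by rewrite alg// subrK ltr_pdivrMl ?nrm_gt0// [e * _]mulrC => /ltW.
move=> A /nbhs_nrm[e e0 sA]; have e20 : 0 < e / 2 by rewrite divr_gt0.
have [r r0 Hr] := H _ e20.
rewrite /nbhs /= /dnbhs /within /=; apply/nbhs_nrm; exists r => // h.
rewrite subr0 => hr h0; apply: sA; rewrite alg//.
have := Hr (h + z); rewrite addrK => /(_ hr) le1.
rewrite ltr_pdivrMl ?nrm_gt0//; apply: le_lt_trans le1 _.
by rewrite mulrC ltr_pM2l ?nrm_gt0// ltr_pdivrMr// ltr_pMr// ltr1n.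
Qed.

Lemma derivable_is_derive f z : derivable f z 1 -> is_derive z 1 f (derive1 f z).
Proof. by rewrite derive1E => df; exact: derivableP. Qed.

Lemma is_derive_derive1 f z (d : C R) : is_derive z 1 f d -> derive1 f z = d.
Proof. by rewrite derive1E => -[]. Qed.

Lemma is_derive_derivable f z (d : C R) : is_derive z 1 f d -> derivable f z 1.
Proof. by case. Qed.

Lemma derivable_nrm_cont f z : derivable f z 1 ->
  forall e, 0 < e -> exists2 r, 0 < r & forall w, nrm (w - z) < r -> nrm (f w - f z) <= e.
Proof.
move=> /derivable_is_derive/is_derive_nrm H e e0.
have [r r0 Hr] := H 1 ltr01.
set d := derive1 f z in Hr.
have k0 : 0 < 1 + nrm d by rewrite ltr_pwDl// nrm_ge0.
exists (Num.min r (e / (1 + nrm d))); first by rewrite lt_min r0 divr_gt0.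
move=> w; rewrite lt_min => /andP[wr]; rewrite ltr_pdivlMr// => we.
rewrite -[f w - f z](subrK (d * (w - z))); apply: le_trans (nrmD _ _) _.
apply: le_trans (ltW we); rewrite [X in _ <= X]mulrDr [X in _ <= X + _]mulr1; apply: lerD.
  by apply: le_trans (Hr _ wr) _; rewrite mul1r.
by rewrite nrmM mulrC.
Qed.

Lemma near_eq_is_derive_nrm f g z (d : C R) r : 0 < r ->
  (forall w, nrm (w - z) < r -> f w = g w) ->
  is_derive z 1 f d -> is_derive z 1 g d.
Proof.
move=> r0 fg; apply: near_eq_is_derive.
by apply/nbhs_nrm; exists r.
Qed.

Lemma near_eq_derivable_nrm f g z r : 0 < r ->
  (forall w, nrm (w - z) < r -> f w = g w) ->
  derivable f z 1 -> derivable g z 1.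
Proof.
move=> r0 fg /derivable_is_derive /(near_eq_is_derive_nrm r0 fg).
exact: is_derive_derivable.
Qed.

Lemma near_eq_derive1_nrm f g z r : 0 < r ->
  (forall w, nrm (w - z) < r -> f w = g w) -> derive1 f z = derive1 g z.
Proof.
move=> r0 fg; rewrite !derive1E; apply: near_eq_derive.
by apply/nbhs_nrm; exists r.
Qed.

End Derive.

(** * Dyadic Riemann sums along the sides of squares *)

Section Dyadic.
Context {R : realType}.
Implicit Types (f g : C R -> C R) (z w p d : C R) (t L : R).

(** The left Riemann sum of g for the 2^m dyadic subintervals of [0, 1]. With this
recursion, additivity under halving of the interval is exact at every finite
level. *)
Fixpoint dsum (m : nat) (g : R -> C R) : C R :=
  if m is m'.+1 then
    (dsum m' (fun t => g (t / 2)) + dsum m' (fun t => g ((1 + t) / 2))) / 2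
  else g 0.

Lemma half_in t : 0 <= t <= 1 -> 0 <= t / 2 <= 1.
Proof. lra. Qed.

Lemma half_in' t : 0 <= t <= 1 -> 0 <= (1 + t) / 2 <= 1.
Proof. lra. Qed.

Lemma nrm_half z : nrm (z / 2) = nrm z / 2.
Proof.
rewrite nrmM nrmV; congr (_ / _).
have -> : (2 : C R) = toC 2 by rewrite /toC rmorphD.
by rewrite nrm_toC ger0_norm.
Qed.

Lemma nrm_dsum m (g : R -> C R) M : (forall t, 0 <= t <= 1 -> nrm (g t) <= M) ->
  nrm (dsum m g) <= M.
Proof.
elim: m g => [|m IH] g gM /=; first by apply: gM; rewrite lexx ler01.
rewrite nrm_half ler_pdivrMr// mulr_natr mulr2n.
apply: le_trans (nrmD _ _) _; apply: lerD; apply: IH => t t01; apply: gM.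
  exact: half_in.
exact: half_in'.
Qed.

Lemma eq_dsum m (g h : R -> C R) : (forall t, 0 <= t <= 1 -> g t = h t) ->
  dsum m g = dsum m h.
Proof.
elim: m g h => [|m IH] g h gh /=; first by apply: gh; rewrite lexx ler01.
by congr ((_ + _) / _); apply: IH => t t01; apply: gh; [exact: half_in|exact: half_in'].
Qed.

Lemma dsumD m (g h : R -> C R) : dsum m (fun t => g t + h t) = dsum m g + dsum m h.
Proof. by elim: m g h => [|m IH] g h //=; rewrite !IH; ring. Qed.

Lemma dsumZ m k (g : R -> C R) : dsum m (fun t => k * g t) = k * dsum m g.
Proof. by elim: m g => [|m IH] g //=; rewrite !IH; ring. Qed.

Lemma dsum_cst m k : dsum m (fun=> k) = k.
Proof. by elim: m => [|m IH] //=; rewrite !IH; field. Qed.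

Definition edge m f z d := d * dsum m (fun t => f (z + toC t * d)).

Lemma toC_half t : toC (t / 2) = toC t / 2.
Proof. by rewrite /toC; field. Qed.

Lemma edgeS m f z d : edge m.+1 f z d = edge m f z (d / 2) + edge m f (z + d / 2) (d / 2).
Proof.
rewrite /edge /=.
rewrite (@eq_dsum m _ (fun t => f (z + toC t * (d / 2)))); last first.
  by move=> t _; congr f; rewrite toC_half; ring.
rewrite (@eq_dsum m (fun t => f (z + toC ((1 + t) / 2) * d))
  (fun t => f (z + d / 2 + toC t * (d / 2)))); last first.
  by move=> t _; congr f; rewrite toC_half /toC; field.
by field.
Qed.

(** The level-m Riemann sum of the integral of f along the boundary of the square
with lower left vertex z and side L. Opposite sides are run through in the same
direction and counted with opposite signs, so that the common side of two
adjacent squares cancels. *)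
Definition contour m f z L :=
  edge m f z (toC L) + edge m f (z + toC L) ('i%C * toC L)
  - edge m f (z + 'i%C * toC L) (toC L) - edge m f z ('i%C * toC L).

(** The displacement from the lower left vertex to the other vertices; with half
the side it leads to the lower left vertices of the four quarters. *)
Definition corner (a b : bool) L : C R :=
  (if a then toC L else 0) + 'i%C * (if b then toC L else 0).

(** Sides interior to the large square cancel. *)
Lemma contourS m f z L : contour m.+1 f z L =
  contour m f (z + corner false false (L / 2)) (L / 2) +
  contour m f (z + corner true false (L / 2)) (L / 2) +
  contour m f (z + corner false true (L / 2)) (L / 2) +
  contour m f (z + corner true true (L / 2)) (L / 2).
Proof.
rewrite /contour !edgeS /corner !(mulr0, addr0, add0r).
rewrite toC_half -!(mulrA 'i%C).
set h := toC L / 2; have -> : toC L = h + h by rewrite /h; field.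
have e1 : z + h + 'i%C * h = z + 'i%C * h + h by ring.
rewrite !(mulrDr 'i%C) !addrA e1.
have -> : z + 'i%C * h + h + 'i%C * h = z + 'i%C * h + 'i%C * h + h by ring.
have -> : z + h + h + 'i%C * h = z + 'i%C * h + h + h by ring.
by ring.
Qed.

Definition on_side z L w := exists2 t, 0 <= t <= 1 &
  w = z + toC t * toC L \/ w = z + toC L + toC t * ('i%C * toC L) \/
  w = z + 'i%C * toC L + toC t * toC L \/ w = z + toC t * ('i%C * toC L).

Lemma nrm_contour m f z L M : 0 <= L ->
  (forall w, on_side z L w -> nrm (f w) <= M) -> nrm (contour m f z L) <= 4 * L * M.
Proof.
move=> L0 fM.
have eb v d : nrm d = L -> (forall t, 0 <= t <= 1 -> on_side z L (v + toC t * d)) ->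
    nrm (edge m f v d) <= L * M.
  move=> dL vd; rewrite nrmM dL ler_wpM2l//; apply: nrm_dsum => t t01.
  by apply: fM; apply: vd.
have nL : nrm (toC L) = L by rewrite nrm_toC ger0_norm.
have niL : nrm ('i%C * toC L) = L by rewrite nrmM nrm_i mul1r.
have h1 := eb z (toC L) nL; have h2 := eb (z + toC L) _ niL.
have h3 := eb (z + 'i%C * toC L) _ nL; have h4 := eb z _ niL.
apply: le_trans (nrmB _ _) _; apply: le_trans (lerD (nrmB _ _) (lexx _)) _.
apply: le_trans (lerD (lerD (nrmD _ _) (lexx _)) (lexx _)) _.
have -> : 4 * L * M = L * M + L * M + L * M + L * M by ring.
apply: lerD; last by apply: h4 => t t01; exists t => //; auto.
apply: lerD; last by apply: h3 => t t01; exists t => //; auto.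
by apply: lerD; [apply: h1|apply: h2] => t t01; exists t => //; auto.
Qed.

Lemma eq_contour m f g z L : (forall w, on_side z L w -> f w = g w) ->
  contour m f z L = contour m g z L.
Proof.
move=> fg; rewrite /contour /edge.
by congr (_ * _ + _ * _ - _ * _ - _ * _); apply: eq_dsum => t t01;
  apply: fg; exists t => //; auto.
Qed.

Lemma contourD m f g z L :
  contour m (fun w => f w + g w) z L = contour m f z L + contour m g z L.
Proof. by rewrite /contour /edge !dsumD; ring. Qed.

Lemma contourZ m k f z L :
  contour m (fun w => k * f w) z L = k * contour m f z L.
Proof. by rewrite /contour /edge !dsumZ; ring. Qed.

(** On opposite sides of a square an affine function differs by a constant. Hence
its contour sums vanish at every finite level, and the local step of Goursat's
argument needs no limit. *)
Lemma contour_affine m a b p z L : contour m (fun w => a + b * (w - p)) z L = 0.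
Proof.
have aff k : (fun t : R => a + b * (k + toC t * toC L - p)) =
    (fun t : R => (a + b * (k - p)) + b * (toC t * toC L)).
  by apply/funext => t; ring.
have affi k : (fun t : R => a + b * (k + toC t * ('i%C * toC L) - p)) =
    (fun t : R => (a + b * (k - p)) + b * (toC t * ('i%C * toC L))).
  by apply/funext => t; ring.
rewrite /contour /edge !aff !affi !(dsumD, dsum_cst).
by ring.
Qed.

Definition sq z L w :=
  complex.Re z <= complex.Re w <= complex.Re z + L /\
  complex.Im z <= complex.Im w <= complex.Im z + L.

Lemma Re_toC t : complex.Re (toC t) = t. Proof. by []. Qed.
Lemma Im_toC t : complex.Im (toC t) = 0. Proof. by []. Qed.
Lemma Re_iM z : complex.Re ('i%C * z) = - complex.Im z.
Proof. by rewrite mulrC ReiNIm. Qed.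
Lemma Im_iM z : complex.Im ('i%C * z) = complex.Re z.
Proof. by rewrite mulrC ImiRe. Qed.
Definition ReIm_simp := (@ReD R, @ImD R, @ReN R, @ImN R, @Re_toCM R, @Im_toCM R,
    Re_iM, Im_iM, Re_toC, Im_toC).

Lemma Re_corner z (a b : bool) L : complex.Re (z + corner a b L) = complex.Re z +
    a%:R * L.
Proof. by case: a b => [] [];
    rewrite /corner !ReIm_simp /= ?(oppr0, mul1r, mul0r, addr0, subr0). Qed.

Lemma Im_corner z (a b : bool) L : complex.Im (z + corner a b L) = complex.Im z +
    b%:R * L.
Proof. by case: a b => [] [];
    rewrite /corner !ReIm_simp /= ?(oppr0, mul1r, mul0r, addr0, add0r). Qed.

Lemma sq_corner z L a b w : 0 <= L -> sq (z + corner a b (L / 2)) (L / 2) w -> sq z L w.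
Proof.
move=> L0; rewrite /sq Re_corner Im_corner; case: a b => [] [] /= [h1 h2]; split; lra.
Qed.

Lemma on_side_sq z L w : 0 <= L -> on_side z L w -> sq z L w.
Proof.
move=> L0 [t t01].
have tL : 0 <= t * L <= L by nra.
by case=> [->|[->|[->|->]]]; rewrite /sq !ReIm_simp; split; lra.
Qed.

End Dyadic.

(** * Bisection of squares and Goursat's theorem *)

Section Bisection.
Context {R : realType}.
Implicit Types (z w p : C R) (L : R).

(** Cousin's principle: if P failed, a nested sequence of squares on which P fails
would shrink to a point, around which all small squares satisfy P. The local
hypothesis only concerns subsquares of the initial square, so that P may speak
of functions that are controlled there. *)
Lemma bisection (P : C R -> R -> Prop) z0 L0 : 0 < L0 ->
  (forall z L, 0 < L ->
     (forall a b, P (z + corner a b (L / 2)) (L / 2)) -> P z L) ->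
  (forall w, sq z0 L0 w -> exists2 r, 0 < r & forall z L, 0 < L -> L < r ->
     sq z L w -> (forall v, sq z L v -> sq z0 L0 v) -> P z L) ->
  P z0 L0.
Proof.
move=> L00 merge local; apply: contrapT => nP0.
pose good (s s' : C R * R) := s'.2 = s.2 / 2 /\
  exists a b, s'.1 = s.1 + corner a b (s.2 / 2) /\
    (0 < s.2 -> ~ P s.1 s.2 -> ~ P s'.1 s'.2).
have step s : exists s', good s s'.
  have [[a [b nP]]|allP] := pselect (exists a b,
      ~ P (s.1 + corner a b (s.2 / 2)) (s.2 / 2)).
    by exists (s.1 + corner a b (s.2 / 2), s.2 / 2); split => //; exists a, b.
  exists (s.1 + corner false false (s.2 / 2), s.2 / 2); split => //.
  exists false, false; split => // s0 []; apply: merge => // a b.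
  by apply: contrapT => nP; apply: allP; exists a, b.
pose nxt s := projT1 (cid (step s)).
have nxtP s : good s (nxt s) := projT2 (cid (step s)).
pose u n := iter n nxt (z0, L0).
have uS n : good (u n) (u n.+1) := nxtP _.
have uL n : (u n).2 = L0 / 2 ^+ n.
  elim: n => [|n IH]; first by rewrite expr0 divr1.
  by have [-> _] := uS n; rewrite IH exprS invfM; ring.
have uL0 n : 0 < (u n).2 by rewrite uL divr_gt0 ?exprn_gt0.
have unP n : ~ P (u n).1 (u n).2.
  by elim: n => // n IH; have [_ [a [b [_]]]] := uS n; apply.
have usub n m v : sq (u (n + m)%N).1 (u (n + m)%N).2 v -> sq (u n).1 (u n).2 v.
  elim: m => [|m IH]; rewrite ?addn0 ?addnS // => h; apply: IH; move: h.
  have [-> [a [b [-> _]]]] := uS (n + m)%N.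
  exact/sq_corner/ltW.
have self n : sq (u n).1 (u n).2 (u n).1.
  by have := uL0 n; split; lra.
have self' n : sq (u n).1 (u n).2 ((u n).1 + corner true true (u n).2).
  by have := uL0 n; split; rewrite ?Re_corner ?Im_corner /= mul1r; lra.
(* lower edges form a bounded nondecreasing sequence below all upper edges *)
have mix n m : complex.Re (u n).1 <= complex.Re (u m).1 + (u m).2 /\
               complex.Im (u n).1 <= complex.Im (u m).1 + (u m).2.
  have [nm|/ltnW nm] := leqP n m.
    have := self' m; rewrite -{1 2}(subnKC nm) => /usub [].
    by rewrite Re_corner Im_corner /= mul1r => /andP[? _] /andP[].
  by have := self n; rewrite -{1 2}(subnKC nm) => /usub [] /andP[_ ?] /andP[].
pose X := [set complex.Re (u n).1 | n in setT].
pose Y := [set complex.Im (u n).1 | n in setT].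
pose p := toC (sup X) + 'i%C * toC (sup Y).
have supX n : complex.Re (u n).1 <= sup X <= complex.Re (u n).1 + (u n).2.
  apply/andP; split.
    apply: ub_le_sup; last by exists n.
    by exists (complex.Re (u 0%N).1 + (u 0%N).2) => _ [k _ <-]; case: (mix k 0%N).
  apply: ge_sup; first by exists (complex.Re (u 0%N).1); exists 0%N.
  by move=> _ [k _ <-]; case: (mix k n).
have supY n : complex.Im (u n).1 <= sup Y <= complex.Im (u n).1 + (u n).2.
  apply/andP; split.
    apply: ub_le_sup; last by exists n.
    by exists (complex.Im (u 0%N).1 + (u 0%N).2) => _ [k _ <-]; case: (mix k 0%N).
  apply: ge_sup; first by exists (complex.Im (u 0%N).1); exists 0%N.
  by move=> _ [k _ <-]; case: (mix k n).
have pin n : sq (u n).1 (u n).2 p.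
  by rewrite /sq /p !ReIm_simp oppr0 addr0 add0r; split; [exact: supX|exact: supY].
have [r r0 Hr] := local p (pin 0%N).
have [n Hn] : exists n, (u n).2 < r.
  have [n Hn] : exists n : nat, L0 / r < n%:R.
    exists (Num.bound (L0 / r)); apply: archi_boundP.
    by rewrite divr_ge0 ?ltW.
  exists n; rewrite uL ltr_pdivrMr ?exprn_gt0// mulrC -ltr_pdivrMr//.
  apply: lt_trans Hn _; rewrite -natrX ltr_nat; exact: ltn_expl.
apply: (unP n); apply: Hr => // v; exact: (usub 0%N n).
Qed.

End Bisection.

Section Goursat.
Context {R : realType}.
Implicit Types (f g : C R -> C R) (z w p : C R) (x L : R).

Definition jump x : R := (0 <= x)%R%:R + (0 < x)%R%:R.
(** The mass that an interval of origin u and length L receives from a point mass 2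
at x, half of which is counted at an end point. This convention makes it additive
under cutting the interval, wherever x lies. *)
Definition weight1 x u L : R := jump (x - u) - jump (x - (u + L)).
Definition weight p z L := weight1 (complex.Re p) (complex.Re z) L *
  weight1 (complex.Im p) (complex.Im z) L.

Lemma jump_le x y : x <= y -> jump x <= jump y.
Proof.
move=> xy; rewrite /jump; apply: lerD; rewrite ler_nat.
  by case: (leP 0 x) => // x0; rewrite (le_trans x0 xy).
by case: (ltP 0 x) => // x0; rewrite (lt_le_trans x0 xy).
Qed.

Lemma weight1_ge0 x u L : 0 <= L -> 0 <= weight1 x u L.
Proof. by move=> L0; rewrite subr_ge0 jump_le//; lra. Qed.

Lemma weight1_le2 x u L : weight1 x u L <= 2.
Proof.
rewrite /weight1 /jump.
by case: (leP 0 (x - u)) (ltP 0 (x - u)) (leP 0 (x - (u + L))) (ltP 0 (x - (u + L)))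
  => _ [] _ [] _ [] _ /=; lra.
Qed.

Lemma weight1_ge1 x u L : 0 < L -> u <= x <= u + L -> 1 <= weight1 x u L.
Proof.
move=> L0 /andP[h1 h2]; rewrite /weight1 /jump.
case: (leP 0 (x - u)) => h3; last by lra.
case: (ltP 0 (x - (u + L))) => h4; first by lra.
case: (leP 0 (x - (u + L))) => h5; last by case: ltP => _ /=; lra.
case: ltP => h6 /=; lra.
Qed.

Lemma weight_ge0 p z L : 0 <= L -> 0 <= weight p z L.
Proof. by move=> L0; rewrite mulr_ge0// weight1_ge0. Qed.

Lemma weight_le4 p z L : 0 <= L -> weight p z L <= 4.
Proof.
move=> L0; rewrite /weight.
have := weight1_le2 (complex.Re p) (complex.Re z) L.
have := weight1_le2 (complex.Im p) (complex.Im z) L.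
have := weight1_ge0 (complex.Re p) (complex.Re z) L0.
have := weight1_ge0 (complex.Im p) (complex.Im z) L0.
nra.
Qed.

Lemma weight_ge1 p z L : 0 < L -> sq z L p -> 1 <= weight p z L.
Proof.
move=> L0 [h1 h2]; rewrite /weight.
have := weight1_ge1 L0 h1; have := weight1_ge1 L0 h2; nra.
Qed.

Lemma weight_corner p z L : weight p z L =
  weight p (z + corner false false (L / 2)) (L / 2) +
  weight p (z + corner true false (L / 2)) (L / 2) +
  weight p (z + corner false true (L / 2)) (L / 2) +
  weight p (z + corner true true (L / 2)) (L / 2).
Proof.
rewrite /weight !(Re_corner, Im_corner) /weight1 /= !(mul0r, addr0, mul1r).
have e u : u + L / 2 + L / 2 = u + L by field.
by rewrite !e; ring.
Qed.

Lemma sq_nrm z L v w : 0 <= L -> sq z L v -> sq z L w -> nrm (v - w) <= 2 * L.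
Proof.
move=> L0 [v1 v2] [w1 w2]; apply: le_trans (nrm_le_ReIm _) _.
rewrite !ReIm_simp mulr_natl mulr2n; apply: lerD; rewrite ler_norml; lra.
Qed.

(** Goursat's bisection argument with one exceptional point p, near which f is only
bounded. The bound [eps * L ^+ 2 + eta * weight p z L] on the contour sums is
additive over quarters. Away from p it holds because f is affine up to a small
error; a small square containing p has weight at least 1 and a contour sum of the
order of its side. *)
Theorem goursat f p z L : 0 < L ->
  (forall w, sq z L w -> w != p -> derivable f w 1) ->
  (sq z L p -> exists M r, 0 < r /\ forall w, nrm (w - p) < r -> nrm (f w) <= M) ->
  (fun m => contour m f z L) @ \oo --> (0 : C R).
Proof.
move=> L0 fd fp.
have main eps eta : 0 < eps -> 0 < eta -> exists N, forall m, (N <= m)%N ->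
    nrm (contour m f z L) <= eps * L ^+ 2 + eta * weight p z L.
  move=> eps0 eta0.
  pose P z' L' := exists N, forall m, (N <= m)%N ->
    nrm (contour m f z' L') <= eps * L' ^+ 2 + eta * weight p z' L'.
  apply: (@bisection R P) => //.
    move=> z' L' L'0 H.
    have [N1 H1] := H false false; have [N2 H2] := H true false.
    have [N3 H3] := H false true; have [N4 H4] := H true true.
    exists (maxn (maxn N1 N2) (maxn N3 N4)).+1 => -[//|m].
    rewrite ltnS !geq_max => /andP[/andP[n1 n2] /andP[n3 n4]].
    rewrite contourS weight_corner.
    have := H1 m n1; have := H2 m n2; have := H3 m n3; have := H4 m n4.
    set W1 := weight _ _ _; set W2 := weight _ _ _; set W3 := weight _ _ _;
        set W4 := weight _ _ _.
    set c1 := contour _ _ _ _; set c2 := contour _ _ _ _;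
        set c3 := contour _ _ _ _; set c4 := contour _ _ _ _.
    have := nrmD (c4 + c3 + c2) c1; have := nrmD (c4 + c3) c2; have := nrmD c4 c3.
    lra.
  move=> w wS; have [wp|wp] := eqVneq w p.
    have [M [r [r0 HM]]] := fp (eq_ind _ (sq z L) wS _ wp).
    have M0 : 0 <= M by apply: le_trans (nrm_ge0 _) (HM p _); rewrite subrr nrm0.
    exists (Num.min (r / 2) (eta / (4 * (M + 1)))).
      by rewrite lt_min !divr_gt0 ?mulr_gt0 ?ltr_wpDl.
    move=> z' L' L'0; rewrite lt_min => /andP[Lr Le] wz' sub; exists 0%N => m _.
    apply: (@le_trans _ _ eta).
      apply: le_trans (nrm_contour (M := M) _ (ltW L'0) _) _.
        move=> v /(on_side_sq (ltW L'0)) vz'; apply: HM; rewrite -wp.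
        by apply: le_lt_trans (sq_nrm (ltW L'0) vz' wz') _; lra.
      by move: Le; rewrite ltr_pdivlMr ?mulr_gt0 ?ltr_wpDl//; nra.
    have W1 : 1 <= weight p z' L' by apply: weight_ge1; rewrite -?wp.
    by apply: ler_wpDl; [rewrite mulr_ge0 ?sqr_ge0 ?ltW | rewrite ler_peMr// ltW].
  have /derivable_is_derive/is_derive_nrm H := fd w wS wp.
  (* The perimeter is 4 L' and points of the square are at distance at most 2 L'. *)
  have e80 : 0 < eps / 8 by rewrite divr_gt0.
  have [r r0 Hr] := H _ e80; exists (r / 2); first by rewrite divr_gt0.
  move=> z' L' L'0 Lr wz' sub; exists 0%N => m _.
  apply: (@le_trans _ _ (eps * L' ^+ 2)); last by rewrite lerDl mulr_ge0 ?weight_ge0 ?ltW.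
  set d := derive1 f w in Hr.
  have -> : contour m f z' L' = contour m (fun v => f v - f w - d * (v - w)) z' L'.
    rewrite -[RHS]addr0 -(contour_affine m (f w) d w z' L') -contourD.
    by apply: eq_contour => v _; ring.
  have -> : eps * L' ^+ 2 = 4 * L' * (eps / 8 * (2 * L')) by field.
  apply: nrm_contour (ltW L'0) _ => v /(on_side_sq (ltW L'0)) vz'.
  have vw := sq_nrm (ltW L'0) vz' wz'.
  apply: le_trans (Hr v _) _; first by apply: le_lt_trans vw _; lra.
  by rewrite ler_wpM2l // ltW.
apply/cvgn_nrm => e e0.
have [||N HN] := main (e / (4 * L ^+ 2)) (e / 16);
    rewrite ?divr_gt0 ?mulr_gt0 ?exprn_gt0//.
exists N => m /HN; rewrite subr0 => h; apply: le_lt_trans h _.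
have -> : e / (4 * L ^+ 2) * L ^+ 2 = e / 4 by field; rewrite lt0r_neq0.
have := weight_le4 p z (ltW L0); nra.
Qed.

End Goursat.

(** * Convergence and deformation of contour sums *)

Section CauchyFormula.
Context {R : realType}.
Implicit Types (f g : C R -> C R) (z w p d : C R) (t s L : R).

(** By bisection the Cauchy property reduces to short intervals, on which g is
nearly constant. *)
Lemma dsum_cvg (g : R -> C R) :
  (forall t, 0 <= t <= 1 -> forall e, 0 < e -> exists2 r, 0 < r &
     forall t', 0 <= t' <= 1 -> `|t' - t| < r -> nrm (g t' - g t) <= e) ->
  exists l : C R, (fun m => dsum m g) @ \oo --> l.
Proof.
move=> gc; apply: cauchyn_cvgn => e e0.
pose P (z : C R) (L : R) := exists N, forall n m, (N <= n)%N -> (N <= m)%N ->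
  nrm (dsum n (fun t => g (complex.Re z + t * L)) -
       dsum m (fun t => g (complex.Re z + t * L))) <= e.
have : P 0 1.
  apply: bisection => // [z L L0 H|w [w1 _]].
    have [N1 H1] := H false false; have [N2 H2] := H true false.
    exists (maxn N1 N2).+1 => -[//|n] [//|m]; rewrite !ltnS !geq_max.
    move=> /andP[n1 n2] /andP[m1 m2]; have := H1 n m n1 m1; have := H2 n m n2 m2.
    rewrite !Re_corner /= mul0r mul1r addr0.
    have e1 k : dsum k (fun t : R => g (complex.Re z + L / 2 + t * (L / 2))) =
                dsum k (fun t : R => g (complex.Re z + (1 + t) / 2 * L)).
      by apply: eq_dsum => t _; congr g; field.
    have e2 k : dsum k (fun t : R => g (complex.Re z + t * (L / 2))) =
                dsum k (fun t : R => g (complex.Re z + t / 2 * L)).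
      by apply: eq_dsum => t _; congr g; field.
    rewrite !e1 !e2.
    set a := dsum n _; set b := dsum m _; set c := dsum n _; set d := dsum m _.
    move=> h1 h2.
    have -> : (c + a) / 2 - (d + b) / 2 = ((c - d) + (a - b)) / 2 by field.
    by rewrite nrm_half; have := nrmD (c - d) (a - b); lra.
  have e20 : 0 < e / 2 by rewrite divr_gt0.
  have w01 : 0 <= complex.Re w <= 1 by move: w1; rewrite /= add0r.
  have [r r0 Hr] := gc _ w01 _ e20.
  exists r => // z L L0 Lr [wz _] sub; exists 0%N => n m _ _.
  have close k : nrm (dsum k (fun t =>
      g (complex.Re z + t * L)) - g (complex.Re w)) <= e / 2.
    rewrite -(dsum_cst k (g (complex.Re w))) -mulN1r -dsumZ -dsumD.
    apply: nrm_dsum => t t01; rewrite mulN1r; apply: Hr.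
      have sv : sq z L (toC (complex.Re z + t * L) + 'i%C * toC (complex.Im z)).
        by rewrite /sq !ReIm_simp oppr0 addr0 add0r; split; nra.
      by have [] := sub _ sv; rewrite !ReIm_simp /= oppr0 addr0 add0r.
    by rewrite ltr_norml; nra.
  rewrite -[X in X - _](subrK (g (complex.Re w))) -addrA; apply: le_trans (nrmD _ _) _.
  by rewrite [e]splitr lerD// nrmBC.
case=> N HN; exists N => n m Nn Nm; have := HN n m Nn Nm.
have E k : dsum k (fun t => g (complex.Re 0 + t * 1)) = dsum k g.
  by apply: eq_dsum => t _; rewrite /= add0r mulr1.
by rewrite !E.
Qed.

Lemma edge_cvg f z d : 
  (forall t, 0 <= t <= 1 -> derivable f (z + toC t * d) 1) ->
  exists l : C R, (fun m => edge m f z d) @ \oo --> l.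
Proof.
move=> fd; have [|l ul] := @dsum_cvg (fun t => f (z + toC t * d)); last first.
  by exists (d * l); exact: cvgn_scale.
move=> t t01 e e0; have [r r0 Hr] := derivable_nrm_cont (fd t t01) e0.
have d0 : 0 < 1 + nrm d by rewrite ltr_pwDl// nrm_ge0.
exists (r / (1 + nrm d)); first by rewrite divr_gt0.
move=> t' _; rewrite ltr_pdivlMr// => tt'; apply: Hr.
rewrite opprD addrACA subrr add0r -mulrBl nrmM.
have -> : toC t' - toC t = toC (t' - t) by rewrite /toC rmorphB.
rewrite nrm_toC; apply: le_lt_trans tt'; rewrite ler_wpM2l// lerDr//.
Qed.

Lemma contour_cvg f z L : (forall w, on_side z L w -> derivable f w 1) ->
  exists l : C R, (fun m => contour m f z L) @ \oo --> l.
Proof.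
move=> fd.
have [|l1 h1] := @edge_cvg f z (toC L); first by move=> t ?; apply: fd; exists t; auto.
have [|l2 h2] := @edge_cvg f (z + toC L) ('i%C * toC L).
  by move=> t ?; apply: fd; exists t; auto.
have [|l3 h3] := @edge_cvg f (z + 'i%C * toC L) (toC L).
  by move=> t ?; apply: fd; exists t; auto.
have [|l4 h4] := @edge_cvg f z ('i%C * toC L).
  by move=> t ?; apply: fd; exists t; auto 6.
exists (l1 + l2 - l3 - l4).
exact: (cvgn_add (cvgn_add (cvgn_add h1 h2) (cvgn_opp h3)) (cvgn_opp h4)).
Qed.

Lemma contour_scale m f c s z L :
  contour m f (c + toC s * z) (s * L) = toC s * contour m (fun w =>
      f (c + toC s * w)) z L.
Proof.
have e d v : edge m f (c + toC s * v) (toC s * d) = toC s * edge m (fun w =>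
    f (c + toC s * w)) v d.
  rewrite /edge mulrA; congr (_ * _); apply: eq_dsum => t _; congr f; ring.
have sL : toC (s * L) = toC s * toC L by rewrite /toC rmorphM.
rewrite /contour sL -!(mulrCA (toC s) 'i%C) -!addrA -!mulrDr !e.
by ring.
Qed.

(** By Goursat's theorem the quarters on which f is differentiable do not count. *)
Lemma contour_corner f z L (c d : bool) : 0 < L ->
  (forall c' d' : bool, (c' != c) || (d' != d) -> forall w,
     sq (z + corner c' d' (L / 2)) (L / 2) w -> derivable f w 1) ->
  (fun m => contour m.+1 f z L - contour m f (z +
      corner c d (L / 2)) (L / 2)) @ \oo --> (0 : C R).
Proof.
move=> L0 H; have L20 : 0 < L / 2 by rewrite divr_gt0.
have G (c' d' : bool) : (c' != c) || (d' != d) ->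
    (fun m => contour m f (z + corner c' d' (L / 2)) (L / 2)) @ \oo --> (0 : C R).
  move=> cd; apply: (@goursat R f (z - toC 1)) => // [w /(H _ _ cd)//|[]].
  rewrite !Re_corner !ReIm_simp => h _; exfalso; case: c' h {cd} => /=; lra.
have D (u v w : nat -> C R) : u @ \oo --> (0 : C R) -> v @ \oo --> (0 : C R) ->
    w @ \oo --> (0 : C R) -> (fun m => u m + v m + w m) @ \oo --> (0 : C R).
  move=> u0 v0 w0; have := cvgn_add (cvgn_add u0 v0) w0.
  by rewrite !addr0.
case: c d H G => [] [] _ G.
- apply: cvgn_eq (D _ _ _ (G false false isT) (G true false isT) (G false true isT)) => m.
  by rewrite contourS; ring.
- apply: cvgn_eq (D _ _ _ (G false false isT) (G true true isT) (G false true isT)) => m.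
  by rewrite contourS; ring.
- apply: cvgn_eq (D _ _ _ (G false false isT) (G true true isT) (G true false isT)) => m.
  by rewrite contourS; ring.
apply: cvgn_eq (D _ _ _ (G true false isT) (G true true isT) (G false true isT)) => m.
by rewrite contourS; ring.
Qed.

End CauchyFormula.

(** * Cauchy's formula on the square with vertices 1+i, -1+i, -1-i, 1-i *)

Section DerivableRules.
Context {R : realType}.
Implicit Types (f g : C R -> C R) (z w k : C R).

Lemma is_derive_add f g z (a b : C R) : is_derive z 1 f a -> is_derive z 1 g b ->
  is_derive z 1 (fun w => f w + g w) (a + b).
Proof. by move=> fa gb; exact: is_deriveD. Qed.

Lemma is_derive_scale k f z (a : C R) : is_derive z 1 f a ->
  is_derive z 1 (fun w => k * f w) (k * a).
Proof. by move=> fa; exact: (@is_deriveZ _ _ _ f k z 1 a). Qed.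

Lemma derivable_const k z : derivable (fun _ : C R => k) z 1.
Proof. exact: derivable_cst. Qed.

Lemma derivable_idfun z : derivable (fun w : C R => w) z 1.
Proof. exact: derivable_id. Qed.

Lemma derivable_add f g z : derivable f z 1 -> derivable g z 1 ->
  derivable (fun w => f w + g w) z 1.
Proof. exact: derivableD. Qed.

Lemma derivable_opp f z : derivable f z 1 -> derivable (fun w => - f w) z 1.
Proof. exact: derivableN. Qed.

Lemma derivable_sub f g z : derivable f z 1 -> derivable g z 1 ->
  derivable (fun w => f w - g w) z 1.
Proof. by move=> fz gz; exact: derivable_add fz (derivable_opp gz). Qed.

Lemma derivable_mul f g z : derivable f z 1 -> derivable g z 1 ->
  derivable (fun w => f w * g w) z 1.
Proof. exact: derivableM. Qed.

Lemma derivable_inv f z : f z != 0 -> derivable f z 1 ->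
  derivable (fun w => (f w)^-1) z 1.
Proof. exact: derivableV. Qed.

Lemma derivable_exp f n z : derivable f z 1 -> derivable (fun w => f w ^+ n) z 1.
Proof.
move=> fz; elim: n => [|n IH]; first exact: derivable_const.
by under eq_fun do rewrite exprS; exact: (derivable_mul fz IH).
Qed.

Lemma is_derive_scale_arg f c k z (d : C R) : is_derive (c + k * z) 1 f d ->
  is_derive z 1 (fun w => f (c + k * w)) (k * d).
Proof.
move=> /is_derive_nrm H; apply/is_derive_nrm => e e0.
have k0 : 0 < 1 + nrm k by rewrite ltr_pwDl// nrm_ge0.
have [r r0 Hr] := H _ (divr_gt0 e0 k0).
exists (r / (1 + nrm k)); first by rewrite divr_gt0.
move=> w; rewrite ltr_pdivlMr// => wz.
have E : c + k * w - (c + k * z) = k * (w - z) by ring.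
have := Hr (c + k * w); rewrite E nrmM => /(_ _) h.
have -> : k * d * (w - z) = d * (k * (w - z)) by ring.
apply: le_trans (h _) _.
  by apply: le_lt_trans wz; rewrite mulrC ler_wpM2l ?nrm_ge0// lerDr.
rewrite mulrA ler_wpM2r ?nrm_ge0//.
by rewrite mulrAC ler_pdivrMr// mulrDr mulr1 lerDr ltW.
Qed.

Lemma derivable_scale_arg f c k z : derivable f (c + k * z) 1 ->
  derivable (fun w => f (c + k * w)) z 1.
Proof. by move=> /derivable_is_derive/is_derive_scale_arg/is_derive_derivable. Qed.

End DerivableRules.

Arguments derivable_const {R} k z.
Arguments derivable_idfun {R} z.
Arguments derivable_exp {R} f n z _.


Section UnitSquare.
Context {R : realType}.
Implicit Types (f g F : C R -> C R) (z w p d : C R) (t s L : R).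

Lemma toC2 : toC 2 = 2 :> C R.
Proof. by rewrite /toC rmorphD. Qed.

(** Lower left vertex of the square [-1, 1] x [-1, 1]. *)
Definition sw_corner : C R := toC (-1) + 'i%C * toC (-1).

Lemma on_side_sw_corner w : on_side sw_corner 2 w ->
  (1 <= `|complex.Re w| \/ 1 <= `|complex.Im w|) /\ sq sw_corner 2 w.
Proof.
move=> sw; split; last exact: on_side_sq.
have h1 : (1 : R) <= `|-1| by rewrite normrN normr1.
have h2 : (1 : R) <= `|1| by rewrite normr1.
case: sw => t t01 [->|[->|[->|->]]]; rewrite /sw_corner !ReIm_simp.
- by right; rewrite (_ : 0 + -1 + t * 0 = -1)//; lra.
- by left; rewrite (_ : -1 + - 0 + 2 + t * - 0 = 1)//; lra.
- by right; rewrite (_ : 0 + -1 + 2 + t * 0 = 1)//; lra.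
- by left; rewrite (_ : -1 + - 0 + t * - 0 = -1)//; lra.
Qed.

Lemma sq_sw_corner w : sq sw_corner 2 w <-> `|complex.Re w| <= 1 /\ `|complex.Im w| <= 1.
Proof. by rewrite /sq /sw_corner !ReIm_simp !ler_norml; split=> -[h1 h2]; split; lra. Qed.

Lemma nrm_on_side w : on_side sw_corner 2 w -> 1 <= nrm w.
Proof.
case/on_side_sw_corner=> [[h|h] _]; apply: le_trans h _; first exact: Re_le_nrm.
exact: Im_le_nrm.
Qed.

Lemma nrm_sq w : sq sw_corner 2 w -> nrm w <= 2.
Proof. by move=> /sq_sw_corner[h1 h2]; apply: le_trans (nrm_le_ReIm _) _; lra. Qed.

(** The integral along the boundary of the square [-1, 1] x [-1, 1]. *)
Definition cint F : C R := xget 0 [set l : C R | (fun m =>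
    contour m F sw_corner 2) @ \oo --> l].

Lemma cintE F (l : C R) : (fun m => contour m F sw_corner 2) @ \oo --> l -> cint F = l.
Proof. by move=> Fl; apply: xget_unique => // l' Fl'; exact: cvgn_unique Fl' Fl. Qed.

Definition side_derivable F := forall w, on_side sw_corner 2 w -> derivable F w 1.

Lemma cintP F : side_derivable F -> (fun m => contour m F sw_corner 2) @ \oo --> cint F.
Proof. by move=> /contour_cvg[l Fl]; rewrite (cintE Fl). Qed.

Lemma nrm_cint F M : side_derivable F -> (forall w, on_side sw_corner 2 w ->
    nrm (F w) <= M) ->
  nrm (cint F) <= 8 * M.
Proof.
move=> dF FM; apply: (@cvgn_nrm_le _ _ _ _ 0%N (cintP dF)) => m _.
by apply: le_trans (nrm_contour (M := M) _ _ _) _ => //; lra.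
Qed.

Lemma cintD F g : side_derivable F -> side_derivable g ->
    cint (fun w => F w + g w) = cint F + cint g.
Proof.
move=> dF dg; apply: cintE; apply: cvgn_eq (cvgn_add (cintP dF) (cintP dg)) => m.
by rewrite contourD.
Qed.

Lemma cintZ k F : side_derivable F -> cint (fun w => k * F w) = k * cint F.
Proof.
move=> dF; apply: cintE; apply: cvgn_eq (@cvgn_scale _ k _ _ (cintP dF)) => m.
by rewrite contourZ.
Qed.

Lemma eq_cint F g : (forall w, on_side sw_corner 2 w -> F w = g w) -> cint F = cint g.
Proof.
move=> Fg; rewrite /cint (_ : (fun m => contour m F sw_corner 2) = (fun m =>
    contour m g sw_corner 2))//.
by apply/funext => m; exact: eq_contour.
Qed.

Lemma side_derivableD F g : side_derivable F -> side_derivable g ->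
    side_derivable (fun w => F w + g w).
Proof. by move=> dF dg w sw; exact: derivable_add (dF w sw) (dg w sw). Qed.

Lemma side_derivableZ k F : side_derivable F -> side_derivable (fun w => k * F w).
Proof.
by move=> dF w sw; exact: derivable_mul (derivable_const k w) (dF w sw).
Qed.

Lemma side_derivableM F g : side_derivable F -> side_derivable g ->
    side_derivable (fun w => F w * g w).
Proof. by move=> dF dg w sw; exact: derivable_mul (dF w sw) (dg w sw). Qed.

Lemma side_derivable_kernel z n : nrm z < 1 -> side_derivable (fun w => (w - z) ^- n).
Proof.
move=> z1 w sw.
have nz : (w - z) ^+ n != 0.
  rewrite expf_eq0 subr_eq0 negb_and; apply/orP; right; apply/eqP => wz.
  by have := nrm_on_side sw; rewrite wz; lra.
exact: (derivable_inv (f := fun w => (w - z) ^+ n) nz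
  (derivable_exp _ _ _ (derivable_sub (derivable_idfun w) (derivable_const z w)))).
Qed.

(** Cut the square of half side 2 in 16 subsquares: only the four central ones, which
form the square of half side 1, may contain singularities of f. *)
Lemma contour_deform f :
  (forall w, (1 <= `|complex.Re w| <= 2) || (1 <= `|complex.Im w| <= 2) ->
     `|complex.Re w| <= 2 -> `|complex.Im w| <= 2 -> derivable f w 1) ->
  (fun m => contour m.+2 f (toC 2 * sw_corner) 4 - contour m.+1 f sw_corner 2) @
      \oo --> (0 : C R).
Proof.
move=> fd.
have h21 : 2 / 2 = 1 :> R by field.
have h42 : 4 / 2 = 2 :> R by field.
have G (a b : bool) : (fun m => contour m.+1 f (toC 2 * sw_corner + corner a b 2) 2 -
    contour m f (sw_corner + corner a b 1) 1) @ \oo --> (0 : C R).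
  have := @contour_corner R f (toC 2 * sw_corner + corner a b 2) 2 (~~ a) (~~ b).
  rewrite h21.
  have -> : toC 2 * sw_corner + corner a b 2 +
      corner (~~ a) (~~ b) 1 = sw_corner + corner a b 1.
    by rewrite [LHS]ReImE [RHS]ReImE !(Re_corner, Im_corner) /sw_corner !ReIm_simp;
       case: a b => [] [] /=; congr (toC _ + _ * toC _); lra.
  apply=> // c' d' cd w [];
      rewrite !(Re_corner, Im_corner) /sw_corner !ReIm_simp => h1 h2.
  apply: fd; last 2 first.
  - by rewrite ler_norml; case: a c' {cd} h1 => [] [] /=; lra.
  - by rewrite ler_norml; case: b d' {cd} h2 => [] [] /=; lra.
  have rr x : 1 <= x <= 2 \/ -2 <= x <= -1 -> (1 : R) <= `|x| <= 2.
    move=> [] h; first by rewrite ger0_norm; lra.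
    by rewrite ler0_norm; lra.
  move: h1 h2 cd; case: a b c' d' => [] [] [] [] //= h1 h2 _; apply/orP;
    solve [left; apply: rr; lra | right; apply: rr; lra].
have := cvgn_add (cvgn_add (cvgn_add (G false false) (G true false)) (G false
    true)) (G true true).
rewrite !addr0; apply: cvgn_eq => m.
by rewrite [contour m.+2 _ _ _]contourS [contour m.+1 f sw_corner _]contourS h21
    h42; ring.
Qed.

(** The deformation from half side 2 to half side 1, followed by the homothety of
ratio 2. *)
Lemma cint_deform F :
  (forall w, (1 <= `|complex.Re w| <= 2) || (1 <= `|complex.Im w| <= 2) ->
     `|complex.Re w| <= 2 -> `|complex.Im w| <= 2 -> derivable F w 1) ->
  cint F = cint (fun w => 2 * F (2 * w)).
Proof.
move=> Fd; have h2 : toC 2 = 2 :> C R by rewrite /toC rmorphD.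
have := contour_deform Fd.
have E m : contour m F (toC 2 * sw_corner) 4 = contour m (fun w =>
    2 * F (2 * w)) sw_corner 2.
  have := contour_scale m F 0 2 sw_corner 2; rewrite add0r (_ : 2 * 2 = 4); last by lra.
  move=> ->; rewrite contourZ h2; congr (_ * contour _ _ _ _).
  by apply/funext => w; rewrite add0r.
have rr x : (1 : R) <= x -> x <= 1 -> 1 <= x <= 2 by lra.
have d1 : side_derivable F.
  move=> w /on_side_sw_corner[h1 /sq_sw_corner[h2' h3]]; apply: Fd; last 2 first;
      [lra|lra|].
  by case: h1 => h; rewrite (rr _ h) // orbT.
have d2 : side_derivable (fun w => 2 * F (2 * w)).
  apply: side_derivableZ => w /on_side_sw_corner[h1 /sq_sw_corner[h2' h3]].
  have : derivable F (0 + 2 * w) 1.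
    have nR : `|complex.Re (toC 2 * w)| = 2 * `|complex.Re w|.
      by rewrite Re_toCM normrM ger0_norm.
    have nI : `|complex.Im (toC 2 * w)| = 2 * `|complex.Im w|.
      by rewrite Im_toCM normrM ger0_norm.
    rewrite add0r -h2; apply: Fd; rewrite ?nR ?nI; last 2 first; [lra|lra|].
    by case: h1 => h; apply/orP; [left|right]; lra.
  move/derivable_scale_arg.
  by under eq_fun do rewrite add0r.
have c1 := cintP d1; have c2 := cintP d2 => c.
apply/esym/eqP; rewrite -subr_eq0; apply/eqP; apply: cvgn_unique c.
apply: cvgn_eq (cvgn_add (cvgn_shiftS (cvgn_shiftS c2)) (cvgn_opp (cvgn_shiftS c1))) => m.
by rewrite E.
Qed.

(** Doubling the contour does not change the integral, while each doubling halves
the bound that the quadratic decay of F gives. *)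
Lemma cint_decay F A :
  (forall w, 1 <= `|complex.Re w| \/ 1 <= `|complex.Im w| -> derivable F w 1) ->
  (forall w, 1 <= nrm w -> nrm (F w) <= A / nrm w ^+ 2) -> cint F = 0.
Proof.
move=> Fd FA.
have n2 (w : C R) : nrm (2 * w) = 2 * nrm w.
  by rewrite -toC2 nrmM nrm_toC ger0_norm.
have n2' : nrm (2 : C R) = 2 by rewrite -[2 in LHS]mulr1 n2 nrm1 mulr1.
have key n : forall F A, (forall w,
    1 <= `|complex.Re w| \/ 1 <= `|complex.Im w| -> derivable F w 1) ->
    (forall w, 1 <= nrm w -> nrm (F w) <= A / nrm w ^+ 2) ->
        nrm (cint F) <= 8 * A / 2 ^+ n.
  elim: n => [|n IH] {Fd FA}F {}A Fd FA.
    rewrite expr0 divr1; apply: nrm_cint => [w /on_side_sw_corner[/Fd]//|w sw].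
    have w1 := nrm_on_side sw; apply: le_trans (FA _ w1) _.
    have A0 : 0 <= A.
      by have := le_trans (nrm_ge0 _) (FA _ w1);
          rewrite pmulr_lge0// invr_gt0 exprn_gt0//; lra.
    rewrite ler_pdivrMr; last by rewrite exprn_gt0//; lra.
    by rewrite ler_peMr// exprn_ege1.
  rewrite cint_deform => [|w h _ _]; last by apply: Fd; case/orP: h => /andP[]; auto.
  have -> : 8 * A / 2 ^+ n.+1 = 8 * (A / 2) / 2 ^+ n.
    by rewrite exprS invfM; ring.
  apply: IH => w hw.
    have : derivable F (0 + 2 * w) 1.
      rewrite add0r -toC2; apply: Fd.
      by rewrite Re_toCM Im_toCM !normrM !(@ger0_norm _ 2)//; case: hw => h;
          [left|right]; lra.
    move/derivable_scale_arg; under eq_fun do rewrite add0r.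
    exact: derivable_mul (derivable_const 2 w).
  have -> : A / 2 / nrm w ^+ 2 = 2 * (A / nrm (2 * w) ^+ 2).
    by rewrite n2; field; rewrite lt0r_neq0//; lra.
  by rewrite nrmM n2' ler_pM2l//; apply: FA; rewrite n2; lra.
apply/eqP; rewrite -nrm_eq0 eq_le nrm_ge0 andbT; apply/ler_addgt0Pr => e e0.
rewrite add0r.
have A0 : 0 <= 8 * A / 2 ^+ 0 by apply: le_trans (nrm_ge0 _) (key 0%N _ _ Fd FA).
have {}A0 : 0 <= 8 * A by move: A0; rewrite expr0 divr1.
have [n Hn] : exists n : nat, 8 * A / e < n%:R.
  by exists (Num.bound (8 * A / e)); apply: archi_boundP; apply: divr_ge0 => //;
      exact: ltW.
apply: le_trans (key n _ _ Fd FA) _.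
rewrite ler_pdivrMr ?exprn_gt0// [e * _]mulrC -ler_pdivrMr//; apply/ltW.
by apply: lt_trans Hn _; rewrite -natrX ltr_nat; exact: ltn_expl.
Qed.

(** The number 2 i pi, as an integral. *)
Definition c0 : C R := cint (fun w => w^-1).

Lemma side_derivable_inv n : side_derivable (fun w : C R => w ^- n).
Proof.
have := @side_derivable_kernel 0 n; rewrite nrm0 => /(_ ltr01).
by under eq_fun do rewrite subr0.
Qed.

Lemma Im_dsum_ge m (g : R -> C R) k : (forall t, 0 <= t <= 1 -> k <= complex.Im (g t)) ->
  k <= complex.Im (dsum m g).
Proof.
elim: m g => [|m IH] g gk /=; first by apply: gk; rewrite lexx ler01.
have h1 := IH (fun t => g (t / 2)) (fun t t01 => gk _ (half_in t01)).
have h2 := IH (fun t => g ((1 + t) / 2)) (fun t t01 => gk _ (half_in' t01)).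
rewrite mulrC (_ : 2^-1 = toC 2^-1); last by rewrite /toC fmorphV rmorphD.
by rewrite Im_toCM ImD; lra.
Qed.

Lemma Re_inv z : complex.Re z^-1 = complex.Re z / (complex.Re z ^+ 2 + complex.Im z ^+ 2).
Proof. by case: z. Qed.

Lemma Im_inv z : complex.Im z^-1 = - complex.Im z / (complex.Re z ^+ 2 +
    complex.Im z ^+ 2).
Proof. by case: z => x y /=; rewrite mulNr. Qed.

(** On each of the four sides the imaginary part of dz / z is dt / (1 + t ^ 2), which
is at least dt / 2 on an interval of length 2. *)
Lemma Im_c0 : 4 <= complex.Im c0.
Proof.
have ub (x y : R) : -1 <= x -> x <= 1 -> y = 2 * (1 / (1 + x ^+ 2)) -> 1 <= y.
  by move=> h1 h2 ->; rewrite mulrA ler_pdivlMr; nra.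
have key m : 4 <= complex.Im (contour m (fun w : C R => w^-1) sw_corner 2).
  have S z d : complex.Im (edge m (fun w : C R => w^-1) z d) =
      complex.Im (dsum m (fun t => d * (z + toC t * d)^-1)).
    by rewrite dsumZ.
  have S' z d : complex.Im (- edge m (fun w : C R => w^-1) z d) =
      complex.Im (dsum m (fun t => - d * (z + toC t * d)^-1)).
    by rewrite dsumZ mulNr.
  rewrite /contour !ImD !S !S'.
  set A := complex.Im _; set B := complex.Im _; set D := complex.Im _;
      set E := complex.Im _.
  suff [h1 h2 h3 h4] : [/\ 1 <= A, 1 <= B, 1 <= D & 1 <= E] by lra.
  rewrite /A /B /D /E; split; apply: Im_dsum_ge => t t01.
  - rewrite Im_toCM Im_inv /sw_corner !ReIm_simp.
    by apply: (ub (-1 + t * 2)); [lra|lra|congr (2 * (_ / _)); ring].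
  - rewrite -mulrA Im_iM Re_toCM Re_inv /sw_corner !ReIm_simp.
    by apply: (ub (-1 + t * 2)); [lra|lra|congr (2 * (_ / _)); ring].
  - rewrite mulNr ImN Im_toCM Im_inv /sw_corner !ReIm_simp -mulrN -mulNr.
    by apply: (ub (-1 + t * 2)); [lra|lra|congr (2 * (_ / _)); ring].
  - rewrite mulNr ImN -mulrA Im_iM Re_toCM Re_inv /sw_corner !ReIm_simp -mulrN -mulNr.
    by apply: (ub (-1 + t * 2)); [lra|lra|congr (2 * (_ / _)); ring].
have d1 : side_derivable (fun w : C R => w^-1) by exact: (@side_derivable_inv 1).
apply/ler_addgt0Pr => e e0.
have /cvgn_nrm/(_ e e0)[N /(_ N (leqnn N)) HN] := cintP d1.
have := key N; have := Im_le_nrm (contour N (fun w : C R => w^-1) sw_corner 2 - c0).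
rewrite ImD ImN ler_norml; lra.
Qed.

Lemma nrm_c0 : 4 <= nrm c0.
Proof.
by apply: le_trans Im_c0 _; apply: le_trans (ler_norm _) (Im_le_nrm _).
Qed.

Lemma c0_neq0 : c0 != 0.
Proof. by rewrite -nrm_gt0; have := nrm_c0; lra. Qed.

(** The difference of the two kernels decays quadratically at infinity. *)
Lemma cint_kernel z : nrm z < 1 -> cint (fun w => (w - z)^-1) = c0.
Proof.
move=> z1.
have d1 : side_derivable (fun w => (w - z)^-1) by exact: (@side_derivable_kernel z 1 z1).
have d2 : side_derivable (fun w : C R => w^-1) by exact: (@side_derivable_inv 1).
apply/eqP; rewrite -subr_eq0 -[- c0]mulN1r /c0 -(cintZ _ d2) -(cintD d1);
    last exact: side_derivableZ.
apply/eqP; apply: (@cint_decay _ (nrm z / (1 - nrm z))) => w hw; last first.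
  have wz : nrm w * (1 - nrm z) <= nrm (w - z).
    by have := nrm_le_dist w z; have := nrm_ge0 z; nra.
  have wz0 : 0 < nrm (w - z) by apply: lt_le_trans wz; rewrite mulr_gt0; lra.
  have nw : w != 0 by rewrite -nrm_gt0; lra.
  have nwz : w - z != 0 by rewrite -nrm_gt0.
  have -> : (w - z)^-1 + -1 * w^-1 = z * (w^-1 * (w - z)^-1) by field; rewrite nw nwz.
  rewrite !nrmM !nrmV -mulrA ler_wpM2l ?nrm_ge0// -!invfM lef_pV2.
  - by have := nrm_ge0 w; nra.
  - by rewrite posrE mulr_gt0// nrm_gt0.
  - by rewrite posrE !mulr_gt0 ?exprn_gt0 ?nrm_gt0//; lra.
have w1 : 1 <= nrm w.
  by case: hw => h; [exact: le_trans h (Re_le_nrm _)|exact: le_trans h (Im_le_nrm _)].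
have nw : w != 0 by rewrite -nrm_gt0; lra.
have nwz : w - z != 0.
  by rewrite subr_eq0; apply/eqP => wz; move: w1; rewrite wz; lra.
apply: derivable_add (derivable_mul (derivable_const _ _) (derivable_inv nw
    (derivable_idfun _))).
exact: (derivable_inv (f := fun w => w - z) nwz
  (derivable_sub (derivable_idfun w) (derivable_const z w))).
Qed.

Definition square_derivable F := forall w, sq sw_corner 2 w -> derivable F w 1.

Lemma square_derivable_sides F : square_derivable F -> side_derivable F.
Proof. by move=> dF w /on_side_sw_corner[_]; exact: dF. Qed.

Lemma sq_disc z : nrm z <= 1 -> sq sw_corner 2 z.
Proof.
by move=> z1; apply/sq_sw_corner; split; apply: le_trans z1;
    [exact: Re_le_nrm|exact: Im_le_nrm].
Qed.

(** Goursat's theorem applies to the difference quotient of F at z, which is bounded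
near z and differentiable elsewhere. *)
Lemma cauchy_formula F z : square_derivable F -> nrm z < 1 ->
  cint (fun w => F w * (w - z)^-1) = F z * c0.
Proof.
move=> dF z1; have dK : side_derivable (fun w =>
    (w - z)^-1) by exact: (@side_derivable_kernel z 1 z1).
have dFK : side_derivable (fun w =>
    F w * (w - z)^-1) := side_derivableM (square_derivable_sides dF) dK.
rewrite -(cint_kernel z1) -(cintZ _ dK).
apply/eqP; rewrite -subr_eq0 -[- cint _]mulN1r -cintZ; last exact: side_derivableZ.
rewrite -(cintD dFK); last exact: (side_derivableZ (side_derivableZ dK)).
have zs : sq sw_corner 2 z by apply: sq_disc; exact: ltW.
apply/eqP; apply: cintE.
apply: (@goursat R (fun w =>
    F w * (w - z)^-1 + -1 * (F z * (w - z)^-1)) z sw_corner 2 (ltr0n _ 2)) =>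
    [w sw wz|_].
  have nwz : w - z != 0 by rewrite subr_eq0.
  have dw : derivable (fun w => (w - z)^-1) w 1 :=
    derivable_inv (f := fun w =>
        w - z) nwz (derivable_sub (derivable_idfun w) (derivable_const z w)).
  exact: (derivable_add (derivable_mul (dF w sw) dw)
    (derivable_mul (derivable_const _ w) (derivable_mul (derivable_const _ w) dw))).
have /derivable_is_derive/is_derive_nrm/(_ 1 ltr01)[r r0 Hr] := dF z zs.
exists (1 + nrm (derive1 F z)), r; split => // w wr.
have -> : F w * (w - z)^-1 + -1 * (F z * (w - z)^-1) = (F w - F z) * (w - z)^-1 by ring.
have [->|wz] := eqVneq w z.
  by rewrite subrr mul0r nrm0 addr_ge0// nrm_ge0.
rewrite nrmM nrmV ler_pdivrMr ?nrm_gt0 ?subr_eq0// mulrDl mul1r -nrmM.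
have := Hr w wr; rewrite mul1r => h.
have := nrmD (F w - F z - derive1 F z * (w - z)) (derive1 F z * (w - z)).
by rewrite subrK; lra.
Qed.

End UnitSquare.

(** * First order estimate and Taylor expansion on that square *)

Section UnitTaylor.
Context {R : realType}.
Implicit Types (f g F : C R -> C R) (z w p d : C R) (M : R).

Lemma side_derivable_mul_kernel F z n : nrm z < 1 -> square_derivable F ->
  side_derivable (fun w => F w * (w - z) ^- n).
Proof. by move=> z1 dF;
    exact: side_derivableM (square_derivable_sides dF) (side_derivable_kernel z1).
    Qed.

Lemma nrm_side_sub w z : on_side sw_corner 2 w -> nrm z <= 1 / 2 -> 1 / 2 <= nrm (w - z).
Proof. by move=> /nrm_on_side h1 h2; have := nrm_le_dist w z; lra. Qed.

(** Cauchy's formula for the three kernels in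
1/(v-w) - 1/(v-z) - (w-z)/(v-z)^2 = (w-z)^2 / ((v-z)^2 (v-w)). The constant only
depends on the bound of F on the contour; this uniformity is what makes limits
of holomorphic functions differentiable. *)
Lemma order1_unit F M z w : square_derivable F ->
    (forall v, on_side sw_corner 2 v -> nrm (F v) <= M) ->
  nrm z <= 1 / 2 -> nrm w <= 1 / 2 ->
  let d := cint (fun v => F v * (v - z) ^- 2) / c0 in
  nrm (F w - F z - d * (w - z)) <= 16 * M * nrm (w - z) ^+ 2 /\ nrm d <= 8 * M.
Proof.
move=> dF FM z2 w2 d.
have z1 : nrm z < 1 by lra.
have w1 : nrm w < 1 by lra.
have cn0 : (c0 : C R) != 0 := c0_neq0.
have n4 : 4 <= nrm (c0 : C R) := nrm_c0.
have kz : side_derivable (fun v =>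
    F v * (v - z)^-1) by exact: (side_derivable_mul_kernel (n := 1) z1 dF).
have kw : side_derivable (fun v =>
    F v * (v - w)^-1) by exact: (side_derivable_mul_kernel (n := 1) w1 dF).
have kz2 : side_derivable (fun v =>
    F v * (v - z) ^- 2) := side_derivable_mul_kernel z1 dF.
have vn (v u : C R) : on_side sw_corner 2 v -> nrm u <= 1 / 2 ->
    (v - u != 0) /\ nrm (v - u)^-1 <= 2.
  move=> sv u2; have h := nrm_side_sub sv u2; have p0 : 0 < nrm (v - u) by lra.
  split; first by rewrite -nrm_gt0.
  by rewrite nrmV invf_ple ?posrE//; lra.
have M0 : 0 <= M.
  apply: le_trans (nrm_ge0 _) (FM (sw_corner + toC 0 * toC 2) _).
  by exists 0; [rewrite lexx ler01|left].
split; last first.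
  rewrite nrmM nrmV ler_pdivrMr; last by lra.
  apply: (@le_trans _ _ (8 * (M * 4))); last by nra.
  apply: nrm_cint => // v sv; rewrite nrmM.
  apply: ler_pM; rewrite ?nrm_ge0 ?FM//.
  have [_ h] := vn v z sv z2; rewrite -exprVn nrmX.
  by have := nrm_ge0 (v - z)^-1; nra.
have E : (F w - F z - d * (w - z)) * c0 =
    cint (fun v => (w - z) ^+ 2 * (F v * ((v - z) ^- 2 * (v - w)^-1))).
  have -> : (F w - F z - d * (w - z)) * c0 = F w * c0 + (-1) * (F z * c0) +
      (- (w - z)) * cint (fun v => F v * (v - z) ^- 2).
    by rewrite /d; field.
  rewrite -(cauchy_formula dF w1) -(cauchy_formula dF z1) -(cintZ _ kz) -(cintZ _ kz2).
  rewrite -(cintD kw (side_derivableZ kz)) -(cintD (side_derivableD kw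
      (side_derivableZ kz)) (side_derivableZ kz2)).
  apply: eq_cint => v sv; have [vz _] := vn v z sv z2; have [vw _] := vn v w sv w2.
  by field; rewrite vz vw.
have : nrm ((F w - F z - d * (w - z)) * c0) <= 8 * (nrm (w - z) ^+ 2 * (M * 8)).
  rewrite E; apply: nrm_cint.
    apply: side_derivableZ; apply: side_derivableM (square_derivable_sides dF) _.
    by apply: side_derivableM (side_derivable_kernel z1) _;
        exact: (@side_derivable_kernel _ w 1 w1).
  move=> v sv; have [_ hz] := vn v z sv z2; have [_ hw] := vn v w sv w2.
  rewrite nrmM nrmX ler_wpM2l ?sqr_ge0// nrmM; apply: ler_pM; rewrite ?nrm_ge0 ?FM//.
  rewrite nrmM -exprVn nrmX.
  have a0 := nrm_ge0 (v - z)^-1; have b0 := nrm_ge0 (v - w)^-1.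
  have a4 : nrm (v - z)^-1 ^+ 2 <= 4 by nra.
  by have := sqr_ge0 (nrm (v - z)^-1); nra.
rewrite nrmM => h.
have := nrm_ge0 (F w - F z - d * (w - z)); have := sqr_ge0 (nrm (w - z)); nra.
Qed.

Definition ucoef F n := cint (fun v => F v * v ^- n.+1) / c0.

Lemma side_derivable_ucoef F n : square_derivable F ->
    side_derivable (fun v => F v * v ^- n).
Proof. by move=> dF; exact: side_derivableM (square_derivable_sides dF)
    (@side_derivable_inv _ n). Qed.

Lemma nrm_ucoef F M n : square_derivable F ->
    (forall v, on_side sw_corner 2 v -> nrm (F v) <= M) ->
  nrm (ucoef F n) <= 2 * M.
Proof.
move=> dF FM; have n4 : 4 <= nrm (c0 : C R) := nrm_c0.
have M0 : 0 <= M.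
  apply: le_trans (nrm_ge0 _) (FM (sw_corner + toC 0 * toC 2) _).
  by exists 0; [rewrite lexx ler01|left].
rewrite nrmM nrmV ler_pdivrMr; last by lra.
apply: (@le_trans _ _ (8 * M)); last by nra.
apply: nrm_cint => [|v sv]; first exact: side_derivable_ucoef.
have v1 := nrm_on_side sv.
rewrite nrmM nrmV nrmX ler_pdivrMr; last by rewrite exprn_gt0//; lra.
by have := FM v sv; have := exprn_ege1 n.+1 v1; have := nrm_ge0 (F v); nra.
Qed.

(** Expansion of Cauchy's kernel in a geometric series with remainder. *)
Lemma taylor_unit F M z N : square_derivable F ->
    (forall v, on_side sw_corner 2 v -> nrm (F v) <= M) ->
  nrm z < 1 ->
  nrm (F z - \sum_(i < N) ucoef F i * z ^+ i) <= 2 * M * nrm z ^+ N / (1 - nrm z).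
Proof.
move=> dF FM z1; have cn0 : (c0 : C R) != 0 := c0_neq0.
have n4 : 4 <= nrm (c0 : C R) := nrm_c0.
have M0 : 0 <= M.
  apply: le_trans (nrm_ge0 _) (FM (sw_corner + toC 0 * toC 2) _).
  by exists 0; [rewrite lexx ler01|left].
have kr n : side_derivable (fun v => F v * (v ^- n * (v - z)^-1)).
  apply: side_derivableM (square_derivable_sides dF) _;
      apply: side_derivableM (@side_derivable_inv _ n) _.
  exact: (@side_derivable_kernel _ z 1 z1).
have E : F z - \sum_(i < N) ucoef F i * z ^+ i =
    z ^+ N * cint (fun v => F v * (v ^- N * (v - z)^-1)) / c0.
  elim: N => [|n IH].
    rewrite big_ord0 subr0 expr0 mul1r (@eq_cint _ _ (fun v => F v * (v - z)^-1)).
      by rewrite (cauchy_formula dF z1) mulfK.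
    by move=> v _; rewrite expr0 invr1 mul1r.
  rewrite big_ord_recr /= opprD addrA IH /ucoef.
  have -> : cint (fun v => F v * (v ^- n * (v - z)^-1)) =
      cint (fun v => F v * v ^- n.+1) + z * cint (fun v =>
          F v * (v ^- n.+1 * (v - z)^-1)).
    rewrite -(cintZ _ (kr n.+1)) -cintD;
        [|exact: side_derivable_ucoef|exact: side_derivableZ].
    apply: eq_cint => v sv; have v1 := nrm_on_side sv.
    have v0 : v != 0 by rewrite -nrm_gt0; lra.
    have vz : v - z != 0.
      by rewrite subr_eq0; apply/eqP => vz; move: v1; rewrite vz; lra.
    by rewrite exprS; field; rewrite v0 vz expf_neq0.
  by rewrite exprS; field.
rewrite E !nrmM nrmV nrmX.
have : nrm (cint (fun v => F v * (v ^- N * (v - z)^-1))) <= 8 * (M / (1 - nrm z)).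
  apply: nrm_cint => // v sv; have v1 := nrm_on_side sv.
  rewrite nrmM; apply: ler_pM; rewrite ?nrm_ge0 ?FM// nrmM !nrmV nrmX -invfM.
  have vz : 1 - nrm z <= nrm (v - z) by have := nrm_le_dist v z; lra.
  rewrite lef_pV2 ?posrE ?mulr_gt0 ?exprn_gt0//; try lra.
  by have := exprn_ege1 N v1; nra.
set A := nrm (cint _); move=> h.
rewrite ler_pdivrMr; last by lra.
rewrite mulrC; apply: (@le_trans _ _ (8 * (M / (1 - nrm z)) * nrm z ^+ N)).
  by rewrite ler_wpM2r// exprn_ge0// nrm_ge0.
have : 0 <= M / (1 - nrm z) * nrm z ^+ N.
  by rewrite mulr_ge0 ?exprn_ge0 ?nrm_ge0// divr_ge0//; lra.
set B := M / _ * _.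
have -> : 8 * (M / (1 - nrm z)) * nrm z ^+ N = 8 * B by rewrite /B; ring.
have -> : 2 * M * nrm z ^+ N / (1 - nrm z) = 2 * B by rewrite /B; ring.
nra.
Qed.

(** Boundedness on a square follows from local boundedness by bisection. *)
Lemma bounded_square f z L : 0 < L -> (forall w, sq z L w -> derivable f w 1) ->
  exists M, forall w, sq z L w -> nrm (f w) <= M.
Proof.
move=> L0 fd.
apply: (@bisection R (fun z L => exists M, forall w, sq z L w -> nrm (f w) <= M)) => //.
  move=> z' L' L'0 H.
  have [M1 H1] := H false false; have [M2 H2] := H true false.
  have [M3 H3] := H false true; have [M4 H4] := H true true.
  exists (Num.max (Num.max M1 M2) (Num.max M3 M4)) => w [w1 w2].
  rewrite !le_max.
  have [hx|hx] := leP (complex.Re w) (complex.Re z' + L' / 2);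
  have [hy|hy] := leP (complex.Im w) (complex.Im z' + L' / 2).
  - by rewrite H1// /sq Re_corner Im_corner /=; split; lra.
  - by rewrite H3 ?orbT// /sq Re_corner Im_corner /=; split; lra.
  - by rewrite H2 ?orbT// /sq Re_corner Im_corner /=; split; lra.
  - by rewrite H4 ?orbT// /sq Re_corner Im_corner /=; split; lra.
move=> w /fd /derivable_nrm_cont/(_ 1 ltr01)[r r0 Hr].
exists (r / 2); first by rewrite divr_gt0.
move=> z' L' L'0 L'r wz' _; exists (1 + nrm (f w)) => v vz'.
have := Hr v; have := sq_nrm (ltW L'0) vz' wz' => h1 /(_ _) h2.
have {}h2 : nrm (f v - f w) <= 1 by apply: h2; lra.
by have := nrmD (f v - f w) (f w); rewrite subrK; lra.
Qed.

End UnitTaylor.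

(** * Weierstrass' theorem and holomorphy of the derivative *)

Section Scaled.
Context {R : realType}.
Implicit Types (f g F : C R -> C R) (z w p c d : C R) (s r M A : R) (Omega : set (C R)).

Lemma is_derive_quadratic f z d r A : 0 < r -> 
  (forall w, nrm (w - z) < r -> nrm (f w - f z - d * (w - z)) <= A * nrm (w - z) ^+ 2) ->
  is_derive z 1 f d.
Proof.
move=> r0 H; apply/is_derive_nrm => e e0.
have A0 : 0 < `|A| + 1 by rewrite ltr_wpDl.
exists (Num.min r (e / (`|A| + 1))); first by rewrite lt_min r0 divr_gt0.
move=> w; rewrite lt_min => /andP[wr]; rewrite ltr_pdivlMr// => we.
apply: le_trans (H w wr) _; rewrite expr2 mulrA ler_wpM2r ?nrm_ge0//.
by have := ler_norm A; have := nrm_ge0 (w - z); nra.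
Qed.

Definition disc c r : set (C R) := [set w | nrm (w - c) < r].

(** The disc of centre c and radius 3 s contains the square of centre c and half side
s, which this affine change of variable turns into the square [-1, 1] x [-1, 1]. *)
Definition scaled f c s := fun u => f (c + toC s * u).

Lemma square_derivable_scaled f c s : 0 < s -> holomorphic (disc c (3 * s)) f ->
    square_derivable (scaled f c s).
Proof.
move=> s0 fd w /nrm_sq w2; apply: derivable_scale_arg; apply: fd.
rewrite /disc /= addrC addKr nrmM nrm_toC gtr0_norm//; nra.
Qed.

Lemma scaled_bound f c s M : 0 < s -> (forall w, disc c (3 * s) w -> nrm (f w) <= M) ->
  forall v, on_side sw_corner 2 v -> nrm (scaled f c s v) <= M.
Proof.
move=> s0 fM v /on_side_sw_corner[_ /nrm_sq v2]; apply: fM.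
rewrite /disc /= addrC addKr nrmM nrm_toC gtr0_norm//; nra.
Qed.

Lemma scaledE f c s z : 0 < s -> scaled f c s ((z - c) / toC s) = f z.
Proof.
move=> s0; rewrite /scaled; congr f.
have s0' : toC s != 0 by rewrite -nrm_gt0 nrm_toC gtr0_norm.
by field.
Qed.

Lemma nrm_div_toC z s : 0 < s -> nrm (z / toC s) = nrm z / s.
Proof. by move=> s0; rewrite nrmM nrmV nrm_toC gtr0_norm. Qed.

Lemma order1 f c s M z w : 0 < s -> holomorphic (disc c (3 * s)) f ->
  (forall w, disc c (3 * s) w -> nrm (f w) <= M) ->
  disc c (s / 2) z -> disc c (s / 2) w ->
  nrm (f w - f z - derive1 f z * (w - z)) <= 16 * M / s ^+ 2 * nrm (w - z) ^+ 2 /\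
  nrm (derive1 f z) <= 8 * M / s.
Proof.
move=> s0 fd fM zs ws.
have dF := square_derivable_scaled s0 fd; have bF := scaled_bound s0 fM.
have s0' : toC s != 0 by rewrite -nrm_gt0 nrm_toC gtr0_norm.
have half v : disc c (s / 2) v -> nrm ((v - c) / toC s) <= 1 / 2.
  by move=> /ltW vs; rewrite nrm_div_toC// ler_pdivrMr//; move: vs; rewrite /=; lra.
pose d := cint (fun v => scaled f c s v * (v - (z - c) / toC s) ^- 2) / c0 / toC s.
have est v : disc c (s / 2) v ->
    nrm (f v - f z - d * (v - z)) <= 16 * M / s ^+ 2 * nrm (v - z) ^+ 2 /\ nrm d <=
        8 * M / s.
  move=> vs; have [h1 h2] := order1_unit dF bF (half _ zs) (half _ vs).
  split; last by rewrite /d nrm_div_toC// ler_wpM2r// invr_ge0 ltW.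
  move: h1; rewrite !scaledE//.
  have -> : (v - c) / toC s - (z - c) / toC s = (v - z) / toC s by field.
  rewrite nrm_div_toC// expr_div_n => h.
  have -> : d * (v - z) = cint (fun v =>
      scaled f c s v * (v - (z - c) / toC s) ^- 2) / c0 * ((v - z) / toC s).
    by rewrite /d; field; rewrite s0' c0_neq0.
  apply: le_trans h _; rewrite le_eqVlt; apply/orP; left; apply/eqP; field.
  by rewrite gt_eqF.
have -> : derive1 f z = d.
  apply: is_derive_derive1;
      apply: (@is_derive_quadratic _ _ _ (s / 2 - nrm (z - c)) (16 * M / s ^+ 2)).
    by rewrite subr_gt0.
  move=> v vz; apply: (est v _).1.
  rewrite /disc /=; have := nrmD (v - z) (z - c); rewrite addrA subrK; lra.
exact: est.
Qed.

Lemma derive1_sub f g z : derivable f z 1 -> derivable g z 1 ->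
  derive1 (fun w => f w - g w) z = derive1 f z - derive1 g z.
Proof.
move=> /derivable_is_derive df /derivable_is_derive dg.
apply: is_derive_derive1; exact: is_deriveB.
Qed.

Lemma disc_sub c r r' : r <= r' -> disc c r `<=` disc c r'.
Proof. by move=> rr w /lt_le_trans; apply. Qed.

Definition ucvg (fN : nat -> C R -> C R) f (A : set (C R)) :=
  forall e, 0 < e -> exists N0, forall N, (N0 <= N)%N -> forall w, A w ->
      nrm (fN N w - f w) <= e.

Lemma ucvg_pt fN f (A : set (C R)) z : ucvg fN f A -> A z ->
    (fun N => fN N z) @ \oo --> f z.
Proof.
move=> H Az; apply/cvgn_nrm => e e0; have [N HN] := H (e / 2) (divr_gt0 e0 (ltr0n _ 2)).
exists N => n Nn; apply: le_lt_trans (HN n Nn z Az) _; lra.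
Qed.

(** The first order estimate for fN - fK makes the derivatives uniformly Cauchy.
Applied to f - fN through the limit in K, it shows that f - fN is differentiable,
and so is f, by adding a single fN. *)
Lemma weierstrass_disc (fN : nat -> C R -> C R) f c s : 0 < s ->
  (forall N, holomorphic (disc c (3 * s)) (fN N)) -> ucvg fN f (disc c (3 * s)) ->
  holomorphic (disc c (s / 2)) f /\
  ucvg (fun N => derive1 (fN N)) (derive1 f) (disc c (s / 2)).
Proof.
move=> s0 fd fc.
have s2 : disc c (s / 2) `<=` disc c (3 * s) by apply: disc_sub; lra.
have dd N K : holomorphic (disc c (3 * s)) (fun w => fN N w - fN K w).
  by move=> w ws; exact: derivable_sub (fd N w ws) (fd K w ws).
have bd e : 0 < e -> exists N0, forall N K, (N0 <= N)%N -> (N0 <= K)%N ->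
    forall w, disc c (3 * s) w -> nrm (fN N w - fN K w) <= e.
  move=> e0; have [N0 H] := fc _ (divr_gt0 e0 (ltr0n _ 2)).
  exists N0 => N K NN KK w ws; have := H N NN w ws; have := H K KK w ws.
  have := nrmB (fN N w - f w) (fN K w - f w); rewrite opprB addrA subrK; lra.
have cau e : 0 < e -> exists N0, forall N K, (N0 <= N)%N -> (N0 <= K)%N ->
    forall z, disc c (s / 2) z -> nrm (derive1 (fN N) z - derive1 (fN K) z) <= e.
  move=> e0; have [|N0 H] := bd (e * s / 8); first by rewrite !mulr_gt0// invr_gt0.
  exists N0 => N K NN KK z zs.
  rewrite -(derive1_sub (fd N z (s2 _ zs)) (fd K z (s2 _ zs))).
  have [_ h2] := order1 s0 (dd N K) (H N K NN KK) zs zs.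
  apply: le_trans h2 _; rewrite le_eqVlt; apply/orP; left; apply/eqP; field.
  by rewrite gt_eqF.
have lim z : disc c (s / 2) z -> exists l : C R, (fun N => derive1 (fN N) z) @ \oo --> l.
  move=> zs; apply: cauchyn_cvgn => e /cau[N0 H].
  by exists N0 => n m hn hm; exact: H.
have der z (l : C R) : disc c (s / 2) z ->
    (fun N => derive1 (fN N) z) @ \oo --> l -> is_derive z 1 f l.
  (* For a quadratic estimate any uniform bound of fK - fN is good enough. *)
  move=> zs zl; have [N H] := bd 1 ltr01.
  have q : is_derive z 1 (fun w => f w - fN N w) (l - derive1 (fN N) z).
    apply: (@is_derive_quadratic _ _ _ (s / 2 - nrm (z - c)) (16 * 1 / s ^+ 2)).
      by rewrite subr_gt0.
    move=> w wz; have ws : disc c (s / 2) w.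
      by rewrite /disc /=; have := nrmD (w - z) (z - c); rewrite addrA subrK; lra.
    apply: (@cvgn_nrm_le _ (fun K => (fN K w - fN N w) - (fN K z - fN N z) -
        (derive1 (fN K) z - derive1 (fN N) z) * (w - z)) _ _ N).
      have cw := ucvg_pt fc (s2 _ ws); have cz := ucvg_pt fc (s2 _ zs).
      have c1 := cvgn_add cw (@cvgn_cst _ (- fN N w)).
      have c2 := cvgn_opp (cvgn_add cz (@cvgn_cst _ (- fN N z))).
      have c3 := cvgn_opp (@cvgn_scale _ (w - z) _ _ (cvgn_add zl (@cvgn_cst _ (-
          derive1 (fN N) z)))).
      have := cvgn_add (cvgn_add c1 c2) c3.
      rewrite (mulrC (w - z)); apply: cvgn_eq => K; by rewrite (mulrC (w - z)).
    move=> K NK; have [h _] := order1 s0 (dd K N) (H K N NK (leqnn N)) zs ws.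
    by rewrite (derive1_sub (fd K z (s2 _ zs)) (fd N z (s2 _ zs))) in h.
  have := is_derive_add q (derivable_is_derive (fd N z (s2 _ zs))).
  by rewrite subrK; under eq_fun do rewrite subrK.
split=> [z zs|e e0].
  by have [l /(der z l zs)/is_derive_derivable] := lim z zs.
have [N0 H] := cau e e0; exists N0 => N NN z zs.
have [l zl] := lim z zs; rewrite (is_derive_derive1 (der z l zs zl)).
have c1 := cvgn_add zl (@cvgn_cst _ (- derive1 (fN N) z)).
rewrite nrmBC; apply: (@cvgn_nrm_le _ _ _ _ N0 c1) => K KK; exact: H.
Qed.

Definition locally_ucvg (fN : nat -> C R -> C R) f Omega :=
  forall z, Omega z -> exists2 r, 0 < r & ucvg fN f (disc z r).

Lemma open_disc_sub Omega z : open Omega -> Omega z ->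
  exists2 s, 0 < s & disc z (3 * s) `<=` Omega.
Proof.
move=> /open_nrm oO /oO[r r0 Hr]; exists (r / 3); first by rewrite divr_gt0.
by move=> w ws; apply: Hr; rewrite /disc /= in ws; lra.
Qed.

Lemma disc_center c r : 0 < r -> disc c r c.
Proof. by move=> r0; rewrite /disc /= subrr nrm0. Qed.

Lemma open_disc c r : open (disc c r).
Proof.
apply/open_nrm => z zr; exists (r - nrm (z - c)); first by rewrite subr_gt0.
by move=> w wz; rewrite /disc /=; have := nrmD (w - z) (z - c); rewrite addrA subrK; lra.
Qed.

Theorem weierstrass (fN : nat -> C R -> C R) f Omega : open Omega ->
  (forall N, holomorphic Omega (fN N)) -> locally_ucvg fN f Omega ->
  holomorphic Omega f /\ locally_ucvg (fun N => derive1 (fN N)) (derive1 f) Omega.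
Proof.
move=> oO fd fc.
have loc z : Omega z -> exists2 s, 0 < s & holomorphic (disc z (s / 2)) f /\
    ucvg (fun N => derive1 (fN N)) (derive1 f) (disc z (s / 2)).
  move=> Oz; have [s s0 sO] := open_disc_sub oO Oz; have [r r0 fr] := fc z Oz.
  have m0 : 0 < Num.min s (r / 3) by rewrite lt_min s0 divr_gt0.
  exists (Num.min s (r / 3)) => //; apply: weierstrass_disc => // [N w wm|e /fr[N0 H]].
    by apply/fd/sO; apply: disc_sub wm; rewrite ler_pM2l// ge_min lexx.
  exists N0 => N NN w wm; apply: H => //; apply: disc_sub wm.
  by rewrite -ler_pdivlMl// mulrC ge_min lexx orbT.
split=> z /loc[s s0 [h1 h2]]; last by exists (s / 2) => //; rewrite divr_gt0.
by apply: h1; apply: disc_center; rewrite divr_gt0.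
Qed.

(** By the first order estimate the difference quotients of f, which are holomorphic,
converge uniformly near every point to the derivative. *)
Theorem holomorphic_derive1 Omega f : open Omega -> holomorphic Omega f ->
  holomorphic Omega (derive1 f).
Proof.
move=> oO fd z Oz; have [s s0 sO] := open_disc_sub oO Oz.
have fds : holomorphic (disc z (3 * s)) f by move=> w /sO; exact: fd.
have [M HM] : exists M, forall w, sq (z + toC s * sw_corner) (2 * s) w -> nrm (f w) <= M.
  apply: bounded_square; first by rewrite mulr_gt0.
  move=> w [w1 w2]; apply: fds; rewrite /disc /=; apply: le_lt_trans (nrm_le_ReIm _) _.
  move: w1 w2; rewrite /sw_corner !ReIm_simp => w1 w2.
  have h1 : `|complex.Re w - complex.Re z| <= s by rewrite ler_norml; lra.
  have h2 : `|complex.Im w - complex.Im z| <= s by rewrite ler_norml; lra.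
  lra.
have M1 w : disc z (3 * (s / 3)) w -> nrm (f w) <= M.
  rewrite (_ : 3 * (s / 3) = s); last by field.
  move=> ws; apply: HM; rewrite /sq /sw_corner !ReIm_simp.
  have := le_lt_trans (Re_le_nrm _) ws; have := le_lt_trans (Im_le_nrm _) ws.
  by rewrite !ReIm_simp !ltr_norml; split; lra.
pose t := s / 3; have t0 : 0 < t by rewrite divr_gt0.
(* A disc of radius 3 u, moved by at most u, stays in a disc of radius t / 2. *)
pose u := t / 12; have u0 : 0 < u by rewrite divr_gt0.
pose h N : R := u / N.+1%:R.
have h0 N : 0 < h N by rewrite divr_gt0.
have hu N : h N <= u.
  have n1 : (1 : R) <= N.+1%:R by rewrite ler1n.
  by rewrite ler_pdivrMr//; nra.
have fdt : holomorphic (disc z (3 * t)) f.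
  by move=> w wt; apply: fds; apply: disc_sub wt; rewrite /t; lra.
pose fN N w := (toC (h N))^-1 * (f (toC (h N) + 1 * w) - f w).
have fNd N : holomorphic (disc z (3 * u)) (fN N).
  move=> w wu; have wt : disc z (3 * t) w by apply: disc_sub wu; rewrite /u; lra.
  apply: derivable_mul (derivable_const _ w) (derivable_sub _ (fdt w wt)).
  apply: derivable_scale_arg; apply: fdt; rewrite /disc /= mul1r -addrA.
  apply: le_lt_trans (nrmD _ _) _; rewrite nrm_toC gtr0_norm//.
  by have := hu N; rewrite /disc /= in wu; rewrite /u in wu *; lra.
have fNc : ucvg fN (derive1 f) (disc z (3 * u)).
  move=> e e0.
  have M0 : 0 <= M by apply: le_trans (nrm_ge0 _) (M1 z (disc_center _ _));
      rewrite mulr_gt0.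
  have K0 : 0 <= 16 * M / t ^+ 2 by apply: divr_ge0; [exact: mulr_ge0|exact: sqr_ge0].
  have [n Hn] : exists n : nat, 16 * M / t ^+ 2 * u / e < n%:R.
    by exists (Num.bound (16 * M / t ^+ 2 * u / e)); apply: archi_boundP;
      apply: divr_ge0; [apply: mulr_ge0 => //; exact: ltW|exact: ltW].
  exists n => N nN w wu.
  have wt : disc z (t / 2) w by apply: disc_sub wu; rewrite /u; lra.
  have wht : disc z (t / 2) (toC (h N) + 1 * w).
    rewrite /disc /= mul1r -addrA.
    apply: le_lt_trans (nrmD _ _) _; rewrite nrm_toC gtr0_norm//.
    by have := hu N; rewrite /disc /= in wu; rewrite /u in wu *; lra.
  have [est _] := order1 t0 fdt M1 wt wht.
  have hn0 : toC (h N) != 0 by rewrite -nrm_gt0 nrm_toC gtr0_norm.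
  have E : toC (h N) + 1 * w - w = toC (h N) by ring.
  have -> : fN N w - derive1 f w = (f (toC (h N) +
      1 * w) - f w - derive1 f w * toC (h N)) / toC (h N).
    by rewrite /fN; field.
  rewrite nrm_div_toC// ler_pdivrMr//; rewrite E in est; apply: le_trans est _.
  rewrite nrm_toC gtr0_norm// expr2 mulrA ler_wpM2r ?ltW//.
  have -> : 16 * M / t ^+ 2 * h N = 16 * M / t ^+ 2 * u / N.+1%:R by rewrite /h; ring.
  rewrite ltr_pdivrMr// [e * _]mulrC -ltr_pdivrMr//.
  by apply: lt_le_trans Hn _; rewrite ler_nat leqW.
have [hd _] := weierstrass_disc u0 fNd fNc.
by apply: hd; apply: disc_center; rewrite divr_gt0.
Qed.

End Scaled.

(** * Taylor coefficients, identity theorem and power series *)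

Lemma div_div_cancel (F : fieldType) (t a b s : F) : t != 0 ->
    t^-1 * a / b / (s / t) = a / b / s.
Proof.
move=> t0; rewrite invf_div;
    have -> : t^-1 * a / b * (t / s) = t^-1 * t * (a / b / s) by ring.
by rewrite mulVf// mul1r.
Qed.

Section Taylor.
Context {R : realType}.
Implicit Types (f g h F G : C R ->
    C R) (z w p c d : C R) (s r M A : R) (Omega U W : set (C R)).

(** The n-th Taylor coefficient of f at c, computed on the square of centre c and half
side s. *)
Definition taylor_coef f c s n := ucoef (scaled f c s) n / toC s ^+ n.

Lemma scaled_bounded f c s : 0 < s -> holomorphic (disc c (3 * s)) f ->
  exists M, forall v, on_side sw_corner 2 v -> nrm (scaled f c s v) <= M.
Proof.
move=> s0 fd; have [M HM] := bounded_square (ltr0n R 2) (square_derivable_scaled s0 fd).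
by exists M => v /on_side_sw_corner[_ /HM].
Qed.

Lemma nrm_taylor_coef f c s M n : 0 < s -> holomorphic (disc c (3 * s)) f ->
  (forall v, on_side sw_corner 2 v -> nrm (scaled f c s v) <= M) ->
  nrm (taylor_coef f c s n) * s ^+ n <= 2 * M.
Proof.
move=> s0 fd fM; rewrite /taylor_coef nrmM nrmV nrmX nrm_toC gtr0_norm// mulfVK.
  exact: nrm_ucoef (square_derivable_scaled s0 fd) fM.
by rewrite expf_neq0// gt_eqF.
Qed.

Lemma expr_small q A e : 0 <= q -> q < 1 -> 0 < e ->
    exists N, forall n, (N <= n)%N -> A * q ^+ n < e.
Proof.
move=> q0 q1 e0; have q1' : `|q| < 1 by rewrite ger0_norm.
have A0 : 0 < `|A| + 1 by rewrite ltr_wpDl.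
have [N HN] := cvgn_real (cvg_expr q1') (divr_gt0 e0 A0).
exists N => n /HN; rewrite subr0 ger0_norm ?exprn_ge0// ltr_pdivlMr// => h.
by have := ler_norm A; have := exprn_ge0 n q0; nra.
Qed.

Lemma taylor_cvg f c s z : 0 < s -> holomorphic (disc c (3 * s)) f -> disc c s z ->
  (fun N => \sum_(i < N) taylor_coef f c s i * (z - c) ^+ i) @ \oo --> f z.
Proof.
move=> s0 fd zs; have [M HM] := scaled_bounded s0 fd.
have s0' : toC s != 0 by rewrite -nrm_gt0 nrm_toC gtr0_norm.
have u1 : nrm ((z - c) / toC s) < 1 by rewrite nrm_div_toC// ltr_pdivrMr// mul1r.
apply/cvgn_nrm => e e0.
have [N HN] := expr_small (2 * M / (1 - nrm ((z - c) / toC s))) (nrm_ge0 _) u1 e0.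
exists N => n /HN; apply: le_lt_trans; rewrite nrmBC.
have := taylor_unit n (square_derivable_scaled s0 fd) HM u1; rewrite scaledE// => h.
have -> : \sum_(i < n) taylor_coef f c s i * (z - c) ^+ i =
    \sum_(i < n) ucoef (scaled f c s) i * ((z - c) / toC s) ^+ i.
  by apply: eq_bigr => i _; rewrite /taylor_coef expr_div_n; ring.
by apply: le_trans h _; rewrite mulrAC.
Qed.

(** By deformation of the contour. *)
Lemma taylor_coef_half f c s n : 0 < s -> holomorphic (disc c (3 * s)) f ->
  taylor_coef f c (s / 2) n = taylor_coef f c s n.
Proof.
move=> s0 fd; rewrite /taylor_coef /ucoef.
have s20 : 0 < s / 2 by rewrite divr_gt0.
have s0' : toC s != 0 by rewrite -nrm_gt0 nrm_toC gtr0_norm.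
have t0 : (2 : C R) != 0 by rewrite -toC2 -nrm_gt0 nrm_toC gtr0_norm.
have cn0 : (c0 : C R) != 0 := c0_neq0.
rewrite cint_deform.
  have -> : cint (fun w => 2 * (scaled f c (s / 2) (2 * w) * (2 * w) ^- n.+1)) =
      2 ^- n * cint (fun w => scaled f c s w * w ^- n.+1).
    rewrite -cintZ; last exact: side_derivable_ucoef (square_derivable_scaled s0 fd).
    apply: eq_cint => v sv; have v1 := nrm_on_side sv.
    have v0 : v != 0 by rewrite -nrm_gt0; lra.
    have -> : scaled f c (s / 2) (2 * v) = scaled f c s v.
      by rewrite /scaled toC_half; congr f; field.
    by rewrite exprMn (exprS 2); field; rewrite ?expf_neq0 ?v0 ?t0.
  have tn : (2 : C R) ^+ n != 0 by rewrite expf_neq0.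
  by rewrite toC_half expr_div_n; exact: div_div_cancel.
move=> w hw h1 h2.
have w1 : 1 <= nrm w.
  case/orP: hw => /andP[h _]; first exact: le_trans h (Re_le_nrm _).
  exact: le_trans h (Im_le_nrm _).
have w0 : w != 0 by rewrite -nrm_gt0; lra.
have w4 : nrm w <= 4 by apply: le_trans (nrm_le_ReIm _) _; lra.
have dw : derivable (fun v : C R => v ^- n.+1) w 1.
  apply: (derivable_inv (f := fun v => v ^+ n.+1)); first by rewrite expf_neq0.
  exact: derivable_exp (derivable_idfun w).
apply: derivable_mul dw; apply: derivable_scale_arg; apply: fd.
rewrite /disc /= addrC addKr nrmM nrm_toC gtr0_norm//; nra.
Qed.

Lemma half_pow_gt0 s k : 0 < s -> 0 < s / 2 ^+ k.
Proof. by move=> s0; rewrite divr_gt0 ?exprn_gt0. Qed.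

Lemma half_pow_le s k : 0 < s -> s / 2 ^+ k <= s.
Proof.
move=> s0; rewrite ler_pdivrMr ?exprn_gt0//.
have h : (1 : R) <= 2 ^+ k by rewrite -natrX ler1n expn_gt0.
by nra.
Qed.

Lemma half_pow_small s r : 0 < s -> 0 < r -> exists k, forall n, (k <= n)%N ->
    s / 2 ^+ n <= r.
Proof.
move=> s0 r0; have sr : 0 <= s / r by rewrite divr_ge0 ?ltW.
exists (Num.bound (s / r)) => n kn.
rewrite ler_pdivrMr ?exprn_gt0// [r * _]mulrC -ler_pdivrMr//.
apply: le_trans (ltW (archi_boundP sr)) _.
by rewrite -natrX ler_nat (leq_trans kn)// ltnW// ltn_expl.
Qed.

Lemma taylor_coef_dyadic f c s n k : 0 < s -> holomorphic (disc c (3 * s)) f ->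
  taylor_coef f c (s / 2 ^+ k) n = taylor_coef f c s n.
Proof.
move=> s0 fd; elim: k => [|k IH]; first by rewrite expr0 divr1.
have sk := half_pow_gt0 k s0.
have h : 3 * (s / 2 ^+ k) <= 3 * s by have := half_pow_le k s0; lra.
have E : s / 2 ^+ k.+1 = s / 2 ^+ k / 2 by rewrite exprSr invfM mulrA.
have fk : holomorphic (disc c (3 * (s / 2 ^+ k))) f.
  by move=> w /(disc_sub h) ws; exact: fd w ws.
by rewrite E -IH; exact: taylor_coef_half.
Qed.

Lemma eq_taylor_coef f g c s n : 0 < s -> (forall w, disc c (3 * s) w -> f w = g w) ->
  taylor_coef f c s n = taylor_coef g c s n.
Proof.
move=> s0 fg; congr (_ / _ / _); apply: eq_cint => v /on_side_sw_corner[_ /nrm_sq v2].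
congr (_ * _); apply: fg; rewrite /disc /= addrC addKr nrmM nrm_toC gtr0_norm//; nra.
Qed.

Lemma taylor_coef_sub f g c s n : 0 < s -> holomorphic (disc c (3 * s)) f ->
  holomorphic (disc c (3 * s)) g ->
  taylor_coef (fun w => f w - g w) c s n = taylor_coef f c s n - taylor_coef g c s n.
Proof.
move=> s0 fd gd.
have df := side_derivable_ucoef (n := n.+1) (square_derivable_scaled s0 fd).
have dg := side_derivable_ucoef (n := n.+1) (square_derivable_scaled s0 gd).
rewrite /taylor_coef /ucoef -!mulrBl; congr (_ / _ / _).
rewrite -[- cint _]mulN1r -(cintZ _ dg) -(cintD df (side_derivableZ dg)).
by apply: eq_cint => v _; rewrite /scaled; ring.
Qed.

(** The coefficient can be computed on a square so small that h vanishes on it. *)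
Lemma taylor_coef_local_zero h c s r n : 0 < s -> 0 < r ->
    holomorphic (disc c (3 * s)) h ->
  (forall w, disc c r w -> h w = 0) -> taylor_coef h c s n = 0.
Proof.
move=> s0 r0 hd hz.
have [k Hk] := half_pow_small s0 (divr_gt0 r0 (ltr0n _ 3)).
have sk := half_pow_gt0 k s0.
have zd : holomorphic (disc c (3 * (s / 2 ^+ k))) (fun=> 0).
  by move=> w _; exact: derivable_const.
have rk : 3 * (s / 2 ^+ k) <= r by have := Hk k (leqnn k); lra.
rewrite -(taylor_coef_dyadic n k s0 hd) (@eq_taylor_coef _ (fun w =>
    0 - 0) c _ n sk); last first.
  by move=> w /(disc_sub rk)/hz ->; rewrite subr0.
by rewrite (taylor_coef_sub n sk zd zd) subrr.
Qed.

(** The set of points near which h vanishes is open. It is also closed in W: at a point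
close enough to a limit point z all Taylor coefficients of h vanish, and the
Taylor series there represents h around z. *)
Theorem identity_theorem h W c r : open W -> connected W -> holomorphic W h ->
  W c -> 0 < r -> (forall w, disc c r w -> h w = 0) -> forall w, W w -> h w = 0.
Proof.
move=> oW cW hd Wc r0 hz.
pose B : set (C R) := [set z | W z /\ exists2 t, 0 < t & forall w, disc z t w -> h w = 0].
have oB : open B.
  apply/open_nrm => z [Wz [t t0 zt]]; have [s s0 sW] := open_disc_sub oW Wz.
  exists (Num.min s (t / 2)); first by rewrite lt_min s0 divr_gt0.
  move=> w; rewrite lt_min => /andP[ws wt]; split; first by apply: sW;
      rewrite /disc /=; lra.
  exists (t / 2); first by rewrite divr_gt0.
  move=> v vw; apply: zt; rewrite /disc /=.
  by have := nrmD (v - w) (w - z); rewrite addrA subrK; rewrite /disc /= in vw; lra.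
suff BW : B = W by move=> w; rewrite -BW => -[_ [t t0]]; apply; exact: disc_center.
apply: cW; first by exists c; split => //; exists r.
  by exists B => //; apply/seteqP; split => [z [Wz Bz]//|z []].
exists (closure B); first exact: closed_closure.
apply/seteqP; split => [z Bz|z [Wz /closure_nrm Bz]].
  by split; [case: Bz|exact: subset_closure].
split=> //; have [s s0 sW] := open_disc_sub oW Wz.
have s20 : 0 < s / 2 by rewrite divr_gt0.
have [z1 [Wz1 [t t0 z1t]] z1z] := Bz _ s20.
have sub1 : holomorphic (disc z1 (3 * (s / 2))) h.
  move=> w ws; apply: hd; apply: sW; rewrite /disc /= in ws *.
  by have := nrmD (w - z1) (z1 - z); rewrite addrA subrK; lra.
exists (s / 2 - nrm (z1 - z)); first by rewrite subr_gt0.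
move=> w wz; have wz1 : disc z1 (s / 2) w.
  rewrite /disc /= in wz *.
  by have := nrmB (w - z) (z1 - z); rewrite opprB addrA subrK; lra.
apply: cvgn_unique (taylor_cvg s20 sub1 wz1) _.
apply: cvgn_eq (@cvgn_cst R 0) => N; rewrite big1// => i _.
by rewrite (taylor_coef_local_zero _ s20 t0 sub1 z1t) mul0r.
Qed.

Lemma pseries_tail (a : nat ->
    C R) rho M z q N k : (forall n, nrm (a n) * rho ^+ n <= M) ->
  0 < rho -> 0 <= q -> q < 1 -> nrm z <= q * rho ->
  nrm (\sum_(i < N + k) a i * z ^+ i - \sum_(i < N) a i * z ^+ i) <=
    M / (1 - q) * q ^+ N.
Proof.
move=> aM r0 q0 q1 zq.
have M0 : 0 <= M.
  by apply: le_trans (aM 0%N); rewrite mulr_ge0 ?nrm_ge0 ?exprn_ge0// ltW.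
have term n : nrm (a n * z ^+ n) <= M * q ^+ n.
  rewrite nrmM nrmX; apply: (@le_trans _ _ (nrm (a n) * (q * rho) ^+ n)).
    apply: ler_wpM2l; first exact: nrm_ge0.
    apply: lerXn2r => //; rewrite nnegrE ?nrm_ge0//.
    by apply: mulr_ge0 => //; exact: ltW.
  rewrite exprMn mulrCA [X in X <= _]mulrC.
  by apply: ler_wpM2r; [exact: exprn_ge0|exact: aM].
have -> : M / (1 - q) * q ^+ N = M * (q ^+ N / (1 - q)) by ring.
suff : nrm (\sum_(i < N + k) a i * z ^+ i - \sum_(i < N) a i * z ^+ i) <=
    M * (q ^+ N - q ^+ (N + k)) / (1 - q).
  move=> h; apply: le_trans h _; rewrite -mulrA ler_wpM2l// ler_wpM2r ?invr_ge0//;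
      first by lra.
  by rewrite gerBl exprn_ge0.
elim: k => [|k IH]; first by rewrite addn0 !subrr nrm0 mulr0 mul0r.
rewrite addnS big_ord_recr /= addrAC; apply: le_trans (nrmD _ _) _.
apply: le_trans (lerD IH (term _)) _; rewrite exprS.
have q1' : 1 - q != 0 by rewrite subr_eq0 eq_sym lt_eqF.
by rewrite le_eqVlt; apply/orP; left; apply/eqP; field.
Qed.

Lemma holomorphic_psum (a : nat -> C R) c N Omega :
  holomorphic Omega (fun z => \sum_(i < N) a i * (z - c) ^+ i).
Proof.
move=> z _; elim: N => [|N IH].
  by under eq_fun do rewrite big_ord0; exact: derivable_const.
under eq_fun do rewrite big_ord_recr /=.
apply: derivable_add IH _; apply: derivable_mul (derivable_const _ z) _.
exact: derivable_exp (derivable_sub (derivable_idfun z) (derivable_const c z)).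
Qed.

(** The partial sums converge uniformly on smaller discs, so that Weierstrass' theorem
applies. *)
Theorem pseries_holomorphic (a : nat -> C R) c rho M :
  (forall n, nrm (a n) * rho ^+ n <= M) -> 0 < rho ->
  exists G, holomorphic (disc c rho) G /\ forall z, disc c rho z ->
    (fun N => \sum_(i < N) a i * (z - c) ^+ i) @ \oo --> G z.
Proof.
move=> aM r0; pose S N z := \sum_(i < N) a i * (z - c) ^+ i.
have tail q : 0 <= q -> q < 1 -> forall e, 0 < e ->
    exists N0, forall z, nrm (z - c) <= q * rho ->
    forall n m, (N0 <= n)%N -> (N0 <= m)%N -> nrm (S n z - S m z) <= e.
  move=> q0 q1 e e0; have [N0 HN] := expr_small (M / (1 - q)) q0 q1 (divr_gt0 e0
      (ltr0n _ 2)).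
  exists N0 => z zq n m hn hm.
  have t k : (N0 <= k)%N -> nrm (S k z - S N0 z) <= e / 2.
    move=> hk; rewrite -(subnKC hk); apply: le_trans (pseries_tail _ _ aM r0 q0 q1 zq) _.
    exact/ltW/HN.
  by have := nrmB (S n z - S N0 z) (S m z - S N0 z); rewrite opprB addrA subrK;
    have := t n hn; have := t m hm; lra.
have ratio z r : nrm (z - c) <= r -> 0 <= r < rho -> 
    [/\ 0 <= r / rho, r / rho < 1 & nrm (z - c) <= r / rho * rho].
  move=> zr /andP[h1 h2]; split; first by rewrite divr_ge0// ltW.
    by rewrite ltr_pdivrMr// mul1r.
  by rewrite mulfVK// gt_eqF.
pose G z := xget 0 [set l : C R | (fun N => S N z) @ \oo --> l].
have GP z : disc c rho z -> (fun N => S N z) @ \oo --> G z.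
  move=> zr; suff [l Sl] : exists l : C R, (fun N => S N z) @ \oo --> l.
    by rewrite /G (xget_unique 0 Sl)// => l' Sl'; exact: cvgn_unique Sl' Sl.
  have [|q0 q1 zq] := ratio z _ (lexx _); first by rewrite nrm_ge0.
  apply: cauchyn_cvgn => e /(tail _ q0 q1)[N0 H]; exists N0 => n m hn hm.
  exact: H.
exists G; split; last exact: GP.
suff lG : locally_ucvg S G (disc c rho).
  have hS N : holomorphic (disc c rho) (S N) by exact: holomorphic_psum.
  by have [] := weierstrass (open_disc (c := c) (r := rho)) hS lG.
move=> z zr.
have d0 : 0 < rho - nrm (z - c) by rewrite subr_gt0.
exists ((rho - nrm (z - c)) / 2) => [|e e0]; first by rewrite divr_gt0.
pose r := (rho + nrm (z - c)) / 2.
have r1 : 0 <= r < rho.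
  by rewrite /disc /= in zr; have := nrm_ge0 (z - c); rewrite /r; lra.
have wr w : disc z ((rho - nrm (z - c)) / 2) w -> nrm (w - c) <= r.
  move=> wz; rewrite /disc /= in wz; rewrite /r.
  by have := nrmD (w - z) (z - c); rewrite addrA subrK; lra.
have [q0 q1 _] := ratio z r (wr z (disc_center z (divr_gt0 d0 (ltr0n _ 2)))) r1.
have [N0 H] := tail _ q0 q1 e e0; exists N0 => N hN w wz.
have [_ _ wq] := ratio w r (wr w wz) r1.
have wrho : disc c rho w by rewrite /disc /=; apply: le_lt_trans (wr w wz) _;
    case/andP: r1.
rewrite nrmBC; apply: (@cvgn_nrm_le _ _ _ _ N0 (cvgn_add (GP w wrho) (@cvgn_cst _
    (- S N w)))).
by move=> n hn; exact: H.
Qed.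

End Taylor.

(** * Extendability in terms of Taylor coefficients *)

Section Extendable.
Context {R : realType}.
Implicit Types (f g h F G : C R ->
    C R) (z w p c d : C R) (s r M A : R) (Omega U W : set (C R)).

Lemma continuous_line c d : continuous (fun t : R => c + toC t * d).
Proof.
move=> t A /nbhs_nrm[e e0 sA]; rewrite nbhs_simpl; apply/nbhs_ballP.
have d0 : 0 < 1 + nrm d by rewrite ltr_pwDl// nrm_ge0.
exists (e / (1 + nrm d)); first by rewrite /= divr_gt0.
move=> t'; rewrite -ball_normE /= ltr_pdivlMr// distrC => tt'; apply: sA.
have -> : c + toC t' * d - (c + toC t * d) = toC (t' - t) * d.
  by rewrite /toC rmorphB; ring.
rewrite nrmM nrm_toC; apply: le_lt_trans tt'; apply: ler_wpM2l => //; lra.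
Qed.

Lemma connected_disc c r : 0 < r -> connected (disc c r).
Proof.
move=> r0.
pose S z : set (C R) := (fun t : R => c + toC t * (z - c)) @` `[0, 1]%classic.
have -> : disc c r = \bigcup_(z in disc c r) S z.
  apply/seteqP; split=> [z zr|_ [z zr [t /= ] /[!in_itv] /= /andP[t0 t1] <-]].
    exists z => //; exists 1; first by rewrite /= in_itv /= ler01 lexx.
    by rewrite /toC rmorph1 mul1r addrC subrK.
  rewrite /disc /= addrC addKr nrmM nrm_toC ger0_norm//.
  by apply: le_lt_trans zr; rewrite ler_piMl// nrm_ge0.
apply: bigcup_connected.
  exists c => z _; exists 0; first by rewrite /= in_itv /= lexx ler01.
  by rewrite /toC rmorph0 mul0r addr0.
move=> z _; apply: connected_continuous_connected; first exact: segment_connected.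
by apply: continuous_subspaceT; exact: continuous_line.
Qed.

Lemma component_disc (A : set (C R)) x z r : 0 < r -> disc z r `<=` A ->
  (exists2 w, disc z r w & connected_component A x w) ->
  disc z r `<=` connected_component A x.
Proof.
move=> r0 zA [w zw xw] v zv.
apply: connected_component_trans xw _.
exact: (connected_component_max zw zA (@connected_disc z r r0)).
Qed.

Lemma component_open (A : set (C R)) x : open A -> open (connected_component A x).
Proof.
move=> /open_nrm oA; apply/open_nrm => z xz.
have Az : A z := connected_component_sub xz.
have [e e0 zA] := oA z Az; exists e => //.
by apply: component_disc => //; exists z => //; exact: disc_center.
Qed.

(** The bound makes the Taylor series of f at c converge on the disc of radius rho,
which is not contained in Omega; by the identity theorem its sum agrees with f on
the component of c. *)
Lemma coef_bound_extendable Omega f c s rho M : open Omega -> holomorphic Omega f ->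
  0 < s -> disc c (3 * s) `<=` Omega -> 0 < rho -> ~ (disc c rho `<=` Omega) ->
  (forall n, nrm (taylor_coef f c s n) * rho ^+ n <= M) -> extendable Omega f.
Proof.
move=> oO fd s0 sO r0 rO aM.
have [G [Gd Gc]] := pseries_holomorphic c aM r0.
have Oc : Omega c by apply/sO/disc_center; rewrite mulr_gt0.
have cc := disc_center c r0.
exists (disc c rho), G, c; split; first split => //.
- exact: open_disc.
- exact: connected_disc.
- by exists c.
- by apply: contrapT => h; apply: rO => w rw; apply: contrapT => Ow; apply: h; exists w.
split => //.
set W := connected_component _ c.
have Wsub : W `<=` disc c rho `&` Omega by exact: connected_component_sub.
have oW : open W by apply: component_open; apply: openI oO; exact: open_disc.
have hd : holomorphic W (fun z => G z - f z).
  by move=> z /Wsub[z1 z2]; exact: derivable_sub (Gd z z1) (fd z z2).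
have m0 : 0 < Num.min s rho by rewrite lt_min s0.
have fd3 : holomorphic (disc c (3 * s)) f by move=> w /sO; exact: fd.
have near0 w : disc c (Num.min s rho) w -> G w - f w = 0.
  rewrite /disc /= lt_min => /andP[ws wr]; apply/eqP; rewrite subr_eq0; apply/eqP.
  exact: cvgn_unique (Gc w wr) (taylor_cvg s0 fd3 ws).
have Wc : W c by exact: connected_component_refl.
move=> z Wz; apply/eqP; rewrite -subr_eq0; apply/eqP.
exact: (identity_theorem oW (@component_connected _ _ _) hd Wc m0 near0).
Qed.

(** Let G on U extend f from the component W. Some boundary point w of W lies in U
and outside Omega. At the points c of W near w, Cauchy's estimates for G on a disc
of fixed size give the bound. They form an open set, so that c can be chosen in a
countable dense set; the condition relating s and rho allows both squares to be
shrunk to a common one. *)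
Lemma extendable_coef_bound Omega f : open Omega -> holomorphic Omega f ->
  extendable Omega f ->
  exists w r0, [/\ ~ Omega w, 0 < r0 & forall rho, 0 < rho -> rho <= r0 ->
    exists O : set (C R), [/\ open O, O !=set0, O `<=` Omega `&` disc w rho &
      forall c, O c -> forall s m k, 0 < s -> disc c (3 * s) `<=` Omega ->
        s / 2 ^+ m = rho / 2 ^+ k ->
        exists M, forall n, nrm (taylor_coef f c s n) * rho ^+ n <= M]].
Proof.
move=> oO fd [U [G [x [[oU cU _ [y [Uy Oy]]] [Gd Ux fG]]]]].
set W := connected_component (U `&` Omega) x.
have oUO : open (U `&` Omega) by exact: openI.
have oW : open W by exact: component_open.
have Wsub : W `<=` U `&` Omega by exact: connected_component_sub.
have Wx : W x by exact: connected_component_refl.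
(* U is connected and not equal to W, so some boundary point of W lies in U *)
have [w [Uw clw nWw]] : exists w, [/\ U w, closure W w & ~ W w].
  apply: contrapT => H.
  suff WU : W = U by have [] := Wsub y; rewrite ?WU.
  apply: cU; first by exists x.
    by exists W => //; apply/seteqP; split=> [z Wz|z []//]; split => //;
        case: (Wsub z Wz).
  exists (closure W); first exact: closed_closure.
  apply/seteqP; split=> [z Wz|z [Uz clz]].
    by split; [case: (Wsub z Wz)|exact: subset_closure].
  by apply: contrapT => nWz; apply: H; exists z.
have nOw : ~ Omega w.
  move=> Ow; apply: nWw; have [r r0 rUO] := open_disc_sub oUO (conj Uw Ow).
  have r30 : 0 < 3 * r by rewrite mulr_gt0.
  have /closure_nrm/(_ _ r30)[v Wv vw] := clw.
  by apply: (component_disc r30 rUO); [exists v|exact: disc_center].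
have [t t0 tU] := open_disc_sub oU Uw.
exists w, (t / 2); split; [exact: nOw|by rewrite divr_gt0|].
move=> rho rho0 rhot; exists (W `&` disc w rho); split.
- by apply: openI oW _; exact: open_disc.
- by have /closure_nrm/(_ _ rho0)[v Wv vw] := clw; exists v.
- by move=> z [/Wsub[_ Oz] wz].
move=> c [Wc wc] s m k s0 sO smk.
have cU3 : disc c (3 * rho) `<=` U.
  move=> v vc; apply: tU; rewrite /disc /= in vc wc *.
  by have := nrmD (v - c) (c - w); rewrite addrA subrK; lra.
have Gd3 : holomorphic (disc c (3 * rho)) G by move=> v /cU3; exact: Gd.
have fd3 : holomorphic (disc c (3 * s)) f by move=> v /sO; exact: fd.
have [M HM] := scaled_bounded rho0 Gd3.
exists (2 * M) => n.
(* G and f agree on W, and halving leads both squares to the same small square in W. *)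
suff -> : taylor_coef f c s n = taylor_coef G c rho n by exact: nrm_taylor_coef.
have [r r0 rW] := open_disc_sub oW Wc.
have [j Hj] := half_pow_small s0 r0.
rewrite -(taylor_coef_dyadic n (m + j) s0 fd3) -(taylor_coef_dyadic n (k + j) rho0 Gd3).
have E : s / 2 ^+ (m + j) = rho / 2 ^+ (k + j).
  by rewrite !exprD !invfM !mulrA smk.
rewrite -E; apply: eq_taylor_coef; first exact: half_pow_gt0.
move=> v vc; apply/esym/fG/rW; apply: disc_sub vc.
by have := Hj (m + j)%N (leq_addl _ _); lra.
Qed.

End Extendable.

(** * The gliding hump *)

Section GlidingHump.
Context {R : realType}.
Implicit Types (delta : R).

(** Step j makes the j-th sequence exceed T j at some index n: since b j _ j is
unbounded, this works with d or with d / 2 for e j, whatever the terms chosen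
before. All later e i are taken so small, compared with the bound B j n, that
together they change the n-th term by at most 1. *)
Lemma gliding_hump (a : nat -> nat -> C R) (b : nat -> nat -> nat -> C R)
    (B : nat -> nat -> R) (w T : nat -> R) :
  (forall i, 0 < w i) -> (forall j n i, nrm (b j n i) <= B j n) ->
  (forall j M, exists n, M < nrm (b j n j)) ->
  exists e : nat -> R, (forall i, 0 <= e i <= w i) /\
    forall j, exists n, forall N, (j < N)%N ->
      T j < nrm (a j n + \sum_(i < N) toC (e i) * b j n i).
Proof.
move=> w0 bB bu.
pose good j (S : nat -> nat -> C R) delta (x : R * nat) :=
  [/\ 0 < x.1, x.1 <= delta / 2,
      x.1 <= w j & T j + 1 < nrm (S j x.2 + toC x.1 * b j x.2 j)].
have step j S delta : exists x, 0 < delta -> good j S delta x.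
  have [d0|d0] := ltP 0 delta; last by exists (0, 0%N) => d1; lra.
  pose d := Num.min (delta / 2) (w j).
  have d1 : 0 < d by rewrite lt_min w0 divr_gt0.
  have dl : d <= delta / 2 by rewrite ge_min lexx.
  have dw : d <= w j by rewrite ge_min lexx orbT.
  have [n Hn] := bu j (4 * (T j + 1) / d).
  have {}Hn : 4 * (T j + 1) < d * nrm (b j n j).
    by move: Hn; rewrite ltr_pdivrMr// [_ * d]mulrC.
  have [h|h] := ltP (T j + 1) (nrm (S j n + toC d * b j n j)).
    by exists (d, n) => _; split.
  exists (d / 2, n) => _; split => /=; [lra|lra|lra|].
  have := nrmB (S j n + toC d * b j n j) (S j n + toC (d / 2) * b j n j).
  have -> : S j n + toC d * b j n j - (S j n +
      toC (d / 2) * b j n j) = toC (d / 2) * b j n j.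
    by rewrite toC_half; field.
  by rewrite nrmM nrm_toC gtr0_norm; lra.
pose pick j S delta := projT1 (cid (step j S delta)).
have pickP j S delta : 0 < delta -> good j S delta (pick j S delta).
  exact: projT2 (cid (step j S delta)).
(* The second component of the state bounds the sum of all later e i. *)
pose next j (st : (nat -> nat -> C R) * R) :=
  let x := pick j st.1 st.2 in
  ((fun k n => st.1 k n + toC x.1 * b k n j),
   Num.min (st.2 / 2) (1 + `|B j x.2|)^-1).
pose st := fix st j := if j is i.+1 then next i (st i) else (a, 1).
pose x j := pick j (st j).1 (st j).2.
have st0 j : 0 < (st j).2.
  elim: j => [|j IH]; first exact: ltr01.
  by rewrite lt_min divr_gt0//= invr_gt0 ltr_pwDl.
have xP j : good j (st j).1 (st j).2 (x j) by exact: pickP.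
exists (fun j => (x j).1); split=> [i|j].
  by have [h _ h' _] := xP i; rewrite h' ltW.
have stE N k n : (st N).1 k n = a k n + \sum_(i < N) toC (x i).1 * b k n i.
  by elim: N => [|N IH]; rewrite ?big_ord0 ?addr0// big_ord_recr /= addrA -IH.
have sthalf N : (st N.+1).2 <= (st N).2 / 2 by rewrite ge_min lexx.
have stB N : (st N.+1).2 * B N (x N).2 <= 1.
  have h : (st N.+1).2 <= (1 + `|B N (x N).2|)^-1 by rewrite ge_min lexx orbT.
  have p : 0 < 1 + `|B N (x N).2| by rewrite ltr_pwDl.
  have := st0 N.+1; have := ler_norm (B N (x N).2).
  have : (st N.+1).2 * (1 + `|B N (x N).2|) <= 1 by rewrite -ler_pdivlMr// div1r.
  nra.
exists (x j).2 => N jN; rewrite -stE; set n := (x j).2.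
have B0 : 0 <= B j n by apply: le_trans (nrm_ge0 _) (bB j n 0%N).
have tail k : nrm ((st (j.+1 + k)%N).1 j n - (st j.+1).1 j n) <=
    ((st j.+1).2 - (st (j.+1 + k)%N).2) * B j n.
  elim: k => [|k IH]; first by rewrite addn0 !subrr nrm0 mul0r.
  rewrite addnS /= addrAC; apply: le_trans (nrmD _ _) _.
  rewrite nrmM nrm_toC.
  have [h1 h2 _ _] := xP (j.+1 + k)%N; rewrite gtr0_norm//.
  have h3 := sthalf (j.+1 + k)%N; have h4 := bB j n (j.+1 + k)%N.
  have h5 : (x (j.+1 + k)%N).1 * nrm (b j n (j.+1 + k)%N) <= (x (j.+1 + k)%N).1 * B j n.
    by apply: ler_wpM2l => //; exact: ltW.
  rewrite -/(x (j.+1 + k)%N); move: IH h2 h3 h5 => /=; nra.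
have := tail (N - j.+1)%N; rewrite subnKC// => t.
have [_ _ _ hump] := xP j; rewrite -/n in hump.
have := nrm_le_dist ((st j.+1).1 j n) ((st N).1 j n); rewrite nrmBC.
have := stB j; have := st0 N; rewrite -/n.
have e1 : (st j.+1).1 j n = (st j).1 j n + toC (x j).1 * b j n j by [].
by move: t hump; rewrite e1; nra.
Qed.

End GlidingHump.

(** * Simple poles outside the domain *)

Section Poles.
Context {R : realType}.
Implicit Types (f g h F G : C R ->
    C R) (z w p c d k : C R) (s r M A : R) (Omega U W V : set (C R)).

Lemma eq_holomorphic Omega f g : open Omega -> (forall z, Omega z -> f z = g z) ->
  holomorphic Omega f -> holomorphic Omega g.
Proof.
move=> oO fg fd z Oz; have [s s0 sO] := open_disc_sub oO Oz.
apply: (near_eq_derivable_nrm (f := f) (r := 3 * s)) (fd z Oz); first by rewrite mulr_gt0.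
by move=> w /sO; exact: fg.
Qed.

Lemma eq_derive1n Omega f g l : open Omega -> (forall z, Omega z -> f z = g z) ->
  forall z, Omega z -> derive1n l f z = derive1n l g z.
Proof.
move=> oO fg; elim: l => [//|l IH] z Oz; have [s s0 sO] := open_disc_sub oO Oz.
apply: (@near_eq_derive1_nrm _ (derive1n l f) (derive1n l g) z (3 * s));
    first by rewrite mulr_gt0.
by move=> w /sO; exact: IH.
Qed.

Lemma holomorphic_derive1n Omega f l : open Omega -> holomorphic Omega f ->
  holomorphic Omega (derive1n l f).
Proof.
move=> oO fd; elim: l => [//|l IH]; exact: holomorphic_derive1 oO IH.
Qed.

Lemma derive1n_lin Omega f g k l : open Omega -> holomorphic Omega f ->
    holomorphic Omega g ->
  forall z, Omega z ->
  derive1n l (fun w => f w + k * g w) z = derive1n l f z + k * derive1n l g z.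
Proof.
move=> oO fd gd; elim: l => [//|l IH] z Oz.
have -> : derive1n l.+1 (fun w => f w + k * g w) z =
    derive1 (fun w => derive1n l f w + k * derive1n l g w) z.
  exact: (@eq_derive1n Omega _ _ 1 oO IH z Oz).
have df := derivable_is_derive (holomorphic_derive1n (l := l) oO fd Oz).
have dg := derivable_is_derive (holomorphic_derive1n (l := l) oO gd Oz).
exact: is_derive_derive1 (is_derive_add df (is_derive_scale k dg)).
Qed.

Lemma is_derive_inv_pow p z n : z != p ->
  is_derive z 1 (fun w => (w - p) ^- n.+1) (- n.+1%:R * (z - p) ^- n.+2).
Proof.
move=> zp; have zp0 : z - p != 0 by rewrite subr_eq0.
have d1 : is_derive z 1 (fun w : C R => (w - p)^-1) (- (z - p) ^- 2).
  have dd : is_derive z 1 (fun w : C R => w - p) (1 + 0).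
    exact: is_derive_add (is_derive_id z 1) (is_derive_cst (- p) z 1).
  apply: DeriveDef.
    by apply: (derivable_inv (f := fun w => w - p) zp0); exact: is_derive_derivable dd.
  rewrite (deriveV (f := fun w => w - p) zp0 (is_derive_derivable dd)).
  by rewrite (@derive_val _ _ _ _ _ _ _ dd) addr0 [_ *: _]mulr1.
elim: n => [|n IH]; first by rewrite mulN1r; exact: d1.
have E : (fun w => (w - p) ^- n.+2) = (fun w => (w - p) ^- n.+1 * (w - p)^-1).
  by apply/funext => w; rewrite exprSr invfM.
rewrite E; have := @is_deriveM _ _ (fun w => (w - p) ^- n.+1) (fun w : C R =>
    (w - p)^-1) z 1 _ _ IH d1.
have -> // : (z - p) ^- n.+1 *: - (z - p) ^- 2 +
    (z - p)^-1 *: (- n.+1%:R * (z - p) ^- n.+2) =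
    - n.+2%:R * (z - p) ^- n.+3.
have sc (x y : C R) : x *: y = x * y by [].
rewrite !sc (exprS _ n.+2) (exprS _ n.+1) -[n.+2%:R]natr1.
by rewrite expr2 !invfM; ring.
Qed.

(** The function 1/(z - p) on Omega, with the value 0 elsewhere that membership in
[holo Omega] requires. *)
Definition pole Omega p : C R -> C R := fun z => if `[< Omega z >] then (z - p)^-1 else 0.

Lemma poleE Omega p z : Omega z -> pole Omega p z = (z - p)^-1.
Proof. by move=> Oz; rewrite /pole; case: asboolP. Qed.

Lemma pole_out Omega p z : ~ Omega z -> pole Omega p z = 0.
Proof. by move=> Oz; rewrite /pole; case: asboolP. Qed.

Lemma pole_neq Omega p z : ~ Omega p -> Omega z -> z != p.
Proof. by move=> Op Oz; apply/eqP => zp; apply: Op; rewrite -zp. Qed.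

Lemma holomorphic_pole Omega p : open Omega -> ~ Omega p ->
    holomorphic Omega (pole Omega p).
Proof.
move=> oO Op; apply: (eq_holomorphic (f := fun z => (z - p)^-1) oO).
  by move=> z Oz; rewrite poleE.
move=> z Oz; apply: (derivable_inv (f := fun w => w - p)).
  by rewrite subr_eq0; exact: pole_neq Op Oz.
exact: derivable_sub (derivable_idfun z) (derivable_const p z).
Qed.

Lemma nrm_pole Omega p z r : ~ Omega p -> 0 < r -> disc z r `<=` Omega ->
  nrm (pole Omega p z) <= r^-1.
Proof.
move=> Op r0 rO; have Oz := rO _ (disc_center z r0).
have pr : r <= nrm (z - p).
  by rewrite leNgt; apply/negP => zp; apply: Op; apply: rO; rewrite /disc /= nrmBC.
by rewrite poleE// nrmV lef_pV2 ?posrE//; exact: lt_le_trans pr.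
Qed.

Lemma derive1n_pole Omega p l : open Omega -> ~ Omega p ->
  exists k, forall z, Omega z -> derive1n l (pole Omega p) z = k * (z - p) ^- l.+1.
Proof.
move=> oO Op; elim: l => [|l [k IH]].
  by exists 1 => z Oz; rewrite derive1n0 poleE// mul1r expr1.
exists (k * - l.+1%:R) => z Oz.
have -> : derive1n l.+1 (pole Omega p) z = derive1 (fun w => k * (w - p) ^- l.+1) z.
  exact: (@eq_derive1n Omega _ _ 1 oO IH z Oz).
rewrite -mulrA.
exact: is_derive_derive1 (is_derive_scale k (is_derive_inv_pow l (pole_neq Op Oz))).
Qed.

Lemma bounded_derive1n_pole Omega V p l : open Omega -> ~ Omega p -> V `<=` Omega ->
  ~ closure V p ->
  exists2 A, 0 <= A & forall z, V z -> nrm (derive1n l (pole Omega p) z) <= A.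
Proof.
move=> oO Op VO Vp; have [k Hk] := derive1n_pole l oO Op.
have [d d0 Hd] : exists2 d : R, 0 < d & forall z, V z -> d <= nrm (z - p).
  apply: contrapT => H; apply: Vp; apply/closure_nrm => e e0.
  apply: contrapT => H'; apply: H; exists e => // z Vz.
  by rewrite leNgt; apply/negP => zp; apply: H'; exists z.
exists (nrm k / d ^+ l.+1); first by apply: divr_ge0;
    [exact: nrm_ge0|apply: exprn_ge0; exact: ltW].
move=> z Vz; rewrite Hk; last exact: VO.
rewrite nrmM nrmV nrmX; apply: ler_wpM2l; first exact: nrm_ge0.
have zd := Hd z Vz; have z0 : 0 < nrm (z - p) := lt_le_trans d0 zd.
rewrite lef_pV2 ?posrE ?exprn_gt0//.
by apply: lerXn2r; rewrite ?nnegrE ?(ltW d0) ?(ltW z0).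
Qed.

(** Otherwise the Taylor series would define a holomorphic G on the disc of radius rho.
By the identity theorem [G z * (z - p) = 1] on this disc, which is absurd at p. *)
Lemma taylor_coef_pole_unbounded Omega p c s rho M : open Omega -> ~ Omega p -> 0 < s ->
  disc c (3 * s) `<=` Omega -> disc c rho p ->
  exists n, M < nrm (taylor_coef (pole Omega p) c s n) * rho ^+ n.
Proof.
move=> oO Op s0 sO rp; apply: contrapT => H.
have r0 : 0 < rho := le_lt_trans (nrm_ge0 _) rp.
have aM n : nrm (taylor_coef (pole Omega p) c s n) * rho ^+ n <= M.
  by rewrite leNgt; apply/negP => h; apply: H; exists n.
have [G [Gd Gc]] := pseries_holomorphic c aM r0.
have pd : holomorphic (disc c (3 * s)) (pole Omega p).
  by move=> z /sO; exact: holomorphic_pole.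
have hd : holomorphic (disc c rho) (fun z => G z * (z - p) - 1).
  move=> z zr; apply: derivable_sub _ (derivable_const 1 z).
  apply: derivable_mul (Gd z zr) _.
  exact: derivable_sub (derivable_idfun z) (derivable_const p z).
have m0 : 0 < Num.min s rho by rewrite lt_min s0.
have near0 w : disc c (Num.min s rho) w -> G w * (w - p) - 1 = 0.
  rewrite /disc /= lt_min => /andP[ws wr].
  have Ow : Omega w by apply/sO; rewrite /disc /=; lra.
  rewrite (cvgn_unique (Gc w wr) (taylor_cvg s0 pd ws)) poleE// mulVf ?subrr//.
  by rewrite subr_eq0; exact: pole_neq Op Ow.
have := identity_theorem (@open_disc _ c rho) (@connected_disc _ c rho r0) hd
    (disc_center c r0) m0 near0 rp.
by rewrite subrr mulr0 add0r => /eqP; rewrite oppr_eq0 oner_eq0.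
Qed.

Lemma nrm_taylor_coef_pole Omega p c s n : ~ Omega p -> 0 < s -> open Omega ->
    disc c (3 * s) `<=` Omega ->
  nrm (taylor_coef (pole Omega p) c s n) <= 2 / s / s ^+ n.
Proof.
move=> Op s0 oO sO; rewrite ler_pdivlMr ?exprn_gt0//.
apply: (nrm_taylor_coef _ s0) => [z /sO|v /on_side_sw_corner[_ /nrm_sq v2]];
    first exact: holomorphic_pole.
apply: nrm_pole => // w wv; apply: sO; rewrite /disc /= in wv *.
have := nrmD (w - (c + toC s * v)) (toC s * v).
have -> : w - (c + toC s * v) + toC s * v = w - c by ring.
rewrite nrmM nrm_toC gtr0_norm//; nra.
Qed.

Lemma compact_bounded (K : set (C R)) (u : C R -> R) : compact K ->
  (forall z, K z -> exists A r, 0 < r /\ forall w, K w -> nrm (w - z) < r -> u w <= A) ->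
  exists2 A, 0 <= A & forall z, K z -> u z <= A.
Proof.
move=> cK loc; apply: contrapT => H.
pose D (n : nat) : set (C R) := [set z | K z /\ n%:R < u z].
have Dn0 n : D n !=set0.
  apply: contrapT => h; apply: H; exists n%:R => // z Kz.
  by rewrite leNgt; apply/negP => nz; apply: h; exists z.
pose Fl : set_system (C R) := filter_from setT D.
have PF : ProperFilter Fl.
  apply: filter_from_proper => //; apply: filter_from_filter; first by exists 0%N.
  move=> i j _ _; exists (maxn i j) => // z [Kz zi]; split; split => //.
    by apply: le_lt_trans zi; rewrite ler_nat leq_maxl.
  by apply: le_lt_trans zi; rewrite ler_nat leq_maxr.
have FK : Fl K by exists 0%N => // z [].
have [z [Kz cz]] := cK Fl PF FK.
have [A [r [r0 Hr]]] := loc z Kz.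
pose n := Num.bound `|A|.
have nA : A < n%:R := le_lt_trans (ler_norm A) (archi_boundP (normr_ge0 A)).
have [w [[Kw nw] wz]] : D n `&` [set w | nrm (w - z) < r] !=set0.
  by apply: cz; [exists n|apply/nbhs_nrm; exists r].
by have := Hr w Kw wz; lra.
Qed.

Lemma compact_bounded_holomorphic Omega K f : compact K -> K `<=` Omega ->
  holomorphic Omega f -> exists2 A, 0 <= A & forall z, K z -> nrm (f z) <= A.
Proof.
move=> cK KO fd; apply: compact_bounded => // z /KO Oz.
have [r r0 Hr] := derivable_nrm_cont (fd z Oz) ltr01.
exists (1 + nrm (f z)), r; split => // w _ wz.
by have := Hr w wz; have := nrmD (f w - f z) (f z); rewrite subrK; lra.
Qed.

End Poles.

(** * Series of simple poles *)

Section Construction.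
Context {R : realType}.
Implicit Types (f g h F G : C R ->
    C R) (z w p c d k : C R) (s r M A : R) (Omega U W V : set (C R)).

Lemma bounded_nrm V f : [bounded f z | z in V] <-> exists A, forall z, V z ->
    nrm (f z) <= A.
Proof.
split=> [[M [Mr HM]]|[A HA]].
  have M1 : M < toC (complex.Re M + 1).
    by rewrite -{1}(RRe_real Mr) ltcR ltrDl.
  exists (complex.Re M + 1) => z Vz.
  by have := HM _ M1 z Vz; rewrite /= nrmE lecR.
exists (toC A); split; first by apply/complex_realP; exists A.
move=> x Ax z Vz; apply: le_trans (ltW Ax).
by rewrite nrmE lecR; exact: HA.
Qed.

Lemma half_sum N : \sum_(i < N) (1 / 2 ^+ i.+1) = 1 - 1 / 2 ^+ N :> R.
Proof.
elim: N => [|N IH]; first by rewrite big_ord0 expr0 divr1 subrr.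
rewrite big_ord_recr /= IH exprS !div1r invfM.
by set q := (2 ^+ N)^-1; lra.
Qed.

Lemma taylor_coef_add f g c s n : 0 < s -> holomorphic (disc c (3 * s)) f ->
  holomorphic (disc c (3 * s)) g ->
  taylor_coef (fun w => f w + g w) c s n = taylor_coef f c s n + taylor_coef g c s n.
Proof.
move=> s0 fd gd; have fgd : holomorphic (disc c (3 * s)) (fun w => f w + g w).
  by move=> w ws; exact: derivable_add (fd w ws) (gd w ws).
have := taylor_coef_sub n s0 fgd gd; rewrite (@eq_taylor_coef _ _ f c s n s0);
    last by move=> w _; rewrite addrK.
by move=> ->; rewrite subrK.
Qed.

Lemma taylor_coef_scale f k c s n : 0 < s -> holomorphic (disc c (3 * s)) f ->
  taylor_coef (fun w => k * f w) c s n = k * taylor_coef f c s n.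
Proof.
move=> s0 fd; have df := side_derivable_ucoef (n := n.+1) (square_derivable_scaled s0 fd).
rewrite /taylor_coef /ucoef !mulrA -(cintZ _ df); congr (_ / _ / _).
by apply: eq_cint => v _; rewrite mulrA.
Qed.

Lemma cvgn_nrm_ge (u : nat -> C R) (l : C R) m N :
  u @ \oo --> l -> (forall n, (N <= n)%N -> m <= nrm (u n)) -> m <= nrm l.
Proof.
move=> /cvgn_nrm ul um; apply/ler_addgt0Pr => e e0.
have [M HM] := ul e e0.
have := HM (maxn M N) (leq_maxl _ _); have := um (maxn M N) (leq_maxr _ _).
by have := nrm_le_dist (u (maxn M N)) l; lra.
Qed.

Definition pole_sum Omega (p : nat -> C R) f0 (e : nat -> R) N z :=
  f0 z + \sum_(i < N) toC (e i) * pole Omega (p i) z.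

Section PoleSeries.
Variables (Omega : set (C R)) (p : nat -> C R) (f0 : C R -> C R) (e : nat -> R).
Hypotheses (oO : open Omega) (pO : forall i, ~ Omega (p i)) (f0O : holo Omega f0).
Hypothesis e_le : forall i, 0 <= e i <= 1 / 2 ^+ i.+1.
Local Notation S := (pole_sum Omega p f0 e).

Lemma pole_sumS N : S N.+1 = (fun z => S N z + toC (e N) * pole Omega (p N) z).
Proof. by apply/funext => z; rewrite /pole_sum big_ord_recr /= addrA. Qed.

Lemma pole_sum0 : S 0 = f0.
Proof. by apply/funext => z; rewrite /pole_sum big_ord0 addr0. Qed.

Lemma holomorphic_pole_sum N : holomorphic Omega (S N).
Proof.
elim: N => [|N IH]; first by rewrite pole_sum0; exact: f0O.1.
rewrite pole_sumS => z Oz; apply: derivable_add (IH z Oz) _.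
exact: derivable_mul (derivable_const _ z) (holomorphic_pole oO (@pO N) Oz).
Qed.

Lemma derive1n_pole_sum l N z : Omega z -> derive1n l (S N) z =
  derive1n l f0 z + \sum_(i < N) toC (e i) * derive1n l (pole Omega (p i)) z.
Proof.
move=> Oz; elim: N => [|N IH]; first by rewrite pole_sum0 big_ord0 addr0.
rewrite pole_sumS big_ord_recr /= addrA -IH.
exact: derive1n_lin (toC (e N)) l oO (@holomorphic_pole_sum N) (holomorphic_pole oO
    (@pO N)) z Oz.
Qed.

Lemma taylor_coef_pole_sum c s n N : 0 < s -> disc c (3 * s) `<=` Omega ->
  taylor_coef (S N) c s n = taylor_coef f0 c s n +
      \sum_(i < N) toC (e i) * taylor_coef (pole Omega (p i)) c s n.
Proof.
move=> s0 sO; elim: N => [|N IH]; first by rewrite pole_sum0 big_ord0 addr0.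
have pd : holomorphic (disc c (3 * s)) (pole Omega (p N)).
  by move=> w /sO; exact: holomorphic_pole oO (@pO N) w.
have Sd : holomorphic (disc c (3 * s)) (S N).
  by move=> w /sO; exact: holomorphic_pole_sum.
rewrite pole_sumS big_ord_recr /= addrA -IH (taylor_coef_add n s0 Sd).
  by rewrite (taylor_coef_scale _ n s0 pd).
by move=> w ws; exact: derivable_mul (derivable_const _ w) (pd w ws).
Qed.

Lemma pole_sum_tail z r N (k : nat) : 0 < r -> disc z r `<=` Omega ->
  nrm (S (N + k) z - S N z) <= r^-1 * (1 / 2 ^+ N - 1 / 2 ^+ (N + k)).
Proof.
move=> r0 rO; have ri : 0 <= r^-1 by rewrite invr_ge0 ltW.
elim: k => [|k IH]; first by rewrite addn0 !subrr nrm0 mulr0.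
rewrite addnS pole_sumS addrAC; apply: le_trans (nrmD _ _) _.
rewrite nrmM nrm_toC; have /andP[e0 e1] := e_le (N + k)%N; rewrite ger0_norm//.
have h : e (N + k)%N * nrm (pole Omega (p (N + k)%N) z) <= 1 / 2 ^+ (N + k).+1 * r^-1.
  by apply: ler_pM => //; [exact: nrm_ge0|exact: nrm_pole].
have E : 1 / 2 ^+ (N + k) = 1 / 2 ^+ (N + k).+1 + 1 / 2 ^+ (N + k).+1 :> R.
  by rewrite exprS !div1r invfM; set q := (2 ^+ _)^-1; lra.
by move: IH h; rewrite E; lra.
Qed.

(** A pole outside Omega is bounded by 1/r at distance r from the complement of Omega,
whatever the pole. Hence the series converges locally uniformly, and so do all
its derivatives by Weierstrass' theorem. *)
Lemma pole_series : exists f, [/\ holo Omega f,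
  forall z r N, 0 < r -> disc z r `<=` Omega -> nrm (f z - S N z) <= r^-1 / 2 ^+ N &
  forall l z, Omega z -> (fun N => derive1n l (S N) z) @ \oo --> derive1n l f z].
Proof.
pose f z := xget 0 [set l : C R | (fun N => S N z) @ \oo --> l].
have tail z r : 0 < r -> disc z r `<=` Omega -> forall N n, (N <= n)%N ->
    nrm (S n z - S N z) <= r^-1 / 2 ^+ N.
  move=> r0 rO N n Nn; rewrite -(subnKC Nn).
  apply: le_trans (pole_sum_tail _ _ r0 rO) _; apply: ler_wpM2l;
      first by rewrite invr_ge0 ltW.
  by rewrite div1r gerBl div1r invr_ge0 exprn_ge0.
have fP z : Omega z -> (fun N => S N z) @ \oo --> f z.
  move=> Oz; suff [l Sl] : exists l : C R, (fun N => S N z) @ \oo --> l.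
    by rewrite /f (xget_unique 0 Sl)// => l' Sl'; exact: cvgn_unique Sl' Sl.
  have [r r0 rO] := open_disc_sub oO Oz; have r30 : 0 < 3 * r by rewrite mulr_gt0.
  apply: cauchyn_cvgn => d d0.
  have r31 : 0 < (3 * r)^-1 by rewrite invr_gt0.
  have [N HN] := half_pow_small r31 (divr_gt0 d0 (ltr0n _ 2)).
  exists N => n m Nn Nm; have := nrmB (S n z - S N z) (S m z - S N z).
  rewrite opprB addrA subrK; have := tail z _ r30 rO N n Nn;
      have := tail z _ r30 rO N m Nm.
  have := HN N (leqnn N); lra.
have fS z r N : 0 < r -> disc z r `<=` Omega -> nrm (f z - S N z) <= r^-1 / 2 ^+ N.
  move=> r0 rO; have Oz := rO _ (disc_center z r0).
  apply: (@cvgn_nrm_le _ _ _ _ N (cvgn_add (fP z Oz) (@cvgn_cst _ (- S N z)))) => n Nn.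
  exact: tail r0 rO N n Nn.
have fL : locally_ucvg S f Omega.
  move=> z Oz; have [s s0 sO] := open_disc_sub oO Oz; exists s => // d d0.
  have s1 : 0 < s^-1 by rewrite invr_gt0.
  have [N HN] := half_pow_small s1 d0.
  exists N => n Nn w ws; rewrite nrmBC; apply: le_trans (fS w s n s0 _) (HN n Nn).
  move=> v vw; apply: sO; rewrite /disc /= in vw ws *.
  by have := nrmD (v - w) (w - z); rewrite addrA subrK; lra.
have key l : holomorphic Omega (derive1n l f) /\
    locally_ucvg (fun N => derive1n l (S N)) (derive1n l f) Omega.
  elim: l => [|l [IH1 IH2]].
    by have [h _] := weierstrass oO holomorphic_pole_sum fL; split.
  have hS N : holomorphic Omega (derive1n l (S N)).
    exact: holomorphic_derive1n oO (@holomorphic_pole_sum N).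
  have W := weierstrass oO hS IH2.
  split; last exact: W.2.
  exact: holomorphic_derive1 oO IH1.
exists f; split => [|z r N r0 rO|l z Oz]; last 2 first; [exact: fS| |].
  have [r r0 h] := (key l).2 z Oz.
  exact: ucvg_pt h (disc_center z r0).
split; first by have [] := key 0%N.
move=> z Oz; have S0 N : S N z = 0.
  by rewrite /pole_sum (f0O.2 z Oz) add0r big1// => i _; rewrite pole_out ?mulr0.
have Sl : (fun N => S N z) @ \oo --> (0 : C R) by apply: cvgn_eq (@cvgn_cst R 0) => N.
by rewrite /f (xget_unique 0 Sl) // => l' Sl'; exact: cvgn_unique Sl' Sl.
Qed.

End PoleSeries.

End Construction.

(** * Condensation of singularities *)

Section Condensation.
Context {R : realType}.
Implicit Types (z : C R) (Omega V K : set (C R)).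

Lemma sum_weighted (e D : nat -> R) (A : R) N :
  (forall i, 0 <= D i) -> (forall i, e i * (1 + D i) <= A * (1 / 2 ^+ i.+1)) -> 0 <= A ->
  (forall i, 0 <= e i) -> \sum_(i < N) e i * D i <= A.
Proof.
move=> D0 eD A0 e0; apply: (@le_trans _ _ (\sum_(i < N) A * (1 / 2 ^+ i.+1))).
  by apply: ler_sum => i _; apply: le_trans (eD i); have := e0 i; nra.
rewrite -mulr_sumr half_sum; have : 0 <= 1 / 2 ^+ N :> R by rewrite divr_ge0// exprn_ge0.
nra.
Qed.

Lemma nrm_sum_le N (u : nat -> C R) (v : nat -> R) : (forall i, nrm (u i) <= v i) ->
  nrm (\sum_(i < N) u i) <= \sum_(i < N) v i.
Proof.
move=> uv; elim: N => [|N IH]; first by rewrite !big_ord0 nrm0.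
by rewrite !big_ord_recr /=; apply: le_trans (nrmD _ _) _; rewrite lerD.
Qed.

(** The weights of the series of poles 1/(z - p i) are small compared with the bounds
of the i-th pole on K and of its derivatives of order at most i + L on V. So the
first L derivatives stay close to those of f0, and for every l all but finitely
many terms of the l-th derivative are controlled, which keeps it bounded. The
gliding hump makes the Taylor coefficients at each c j too large. *)
Theorem condensation Omega V (F : set nat) K (c p : nat -> C R) (s rho T : nat -> R)
    (f0 : C R -> C R) (delta : R) (L : nat) :
  open Omega -> V `<=` Omega -> compact K -> K `<=` Omega ->
  (forall j, [/\ 0 < s j, disc (c j) (3 * s j) `<=` Omega, disc (c j) (rho j) (p j),
     ~ Omega (p j) & ~ closure V (p j)]) ->
  bounded_derivatives Omega V F f0 -> 0 < delta ->
  exists f, [/\ bounded_derivatives Omega V F f,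
    forall j, exists n, T j < nrm (taylor_coef f (c j) (s j) n) * rho j ^+ n,
    forall z, K z -> nrm (f z - f0 z) <= delta &
    forall l, F l -> (l <= L)%N -> forall z, V z ->
      nrm (derive1n l f z - derive1n l f0 z) <= delta].
Proof.
move=> oO VO cK KO data [f0O f0b] d0.
have pO i : ~ Omega (p i) by case: (data i).
have s0 i : 0 < s i by case: (data i).
have sO i : disc (c i) (3 * s i) `<=` Omega by case: (data i).
have rp i : disc (c i) (rho i) (p i) by case: (data i).
have r0 i : 0 < rho i by apply: le_lt_trans (nrm_ge0 _) (rp i).
have polebd i l : exists A : R, 0 <= A /\ forall z, V z ->
    nrm (derive1n l (pole Omega (p i)) z) <= A.
  have [A A0 HA] := @bounded_derive1n_pole R Omega V (p i) l oO (@pO i) VO (let: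
      And5 _ _ _ _ h := data i in h).
  by exists A.
pose Dv i l := projT1 (cid (polebd i l)).
have Dv0 i l : 0 <= Dv i l := (projT2 (cid (polebd i l))).1.
have DvP i l z : V z ->
    nrm (derive1n l (pole Omega (p i)) z) <= Dv i l := (projT2 (cid (polebd i
    l))).2 z.
have polek i : exists A : R, 0 <= A /\ forall z, K z -> nrm (pole Omega (p i) z) <= A.
  have [A A0 HA] := compact_bounded_holomorphic cK KO (holomorphic_pole oO (@pO i)).
  by exists A.
pose Dk i := projT1 (cid (polek i)).
have Dk0 i : 0 <= Dk i := (projT2 (cid (polek i))).1.
have DkP i z : K z -> nrm (pole Omega (p i) z) <= Dk i := (projT2 (cid (polek i))).2 z.
(* The i-th weight takes the derivatives of order at most i + L into account, so that
every order is taken into account by almost all weights. *)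
pose D i := Dk i + \sum_(l < i + L.+1) Dv i l.
have Dsum0 i : 0 <= \sum_(l < i + L.+1) Dv i l by apply: sumr_ge0.
have D0 i : 0 <= D i by rewrite addr_ge0.
have DvD i l : (l < i + L.+1)%N -> Dv i l <= D i.
  move=> li; rewrite /D (bigD1 (Ordinal li)) //= addrCA lerDl addr_ge0// sumr_ge0//.
(* Here delta bounds the distance to f0, and 1 the sum of all e i. *)
pose A := Num.min delta 1.
have A0 : 0 < A by rewrite lt_min d0 ltr01.
have Ad : A <= delta by rewrite ge_min lexx.
have A1 : A <= 1 by rewrite ge_min lexx orbT.
pose w i := A * (1 / 2 ^+ i.+1) / (1 + D i).
have h0 i : 0 < 1 / 2 ^+ i.+1 :> R by rewrite divr_gt0 ?exprn_gt0.
have D1 i : 0 < 1 + D i by rewrite ltr_pwDl.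
have w0 i : 0 < w i by apply: divr_gt0 => //; exact: mulr_gt0.
pose b j n i := taylor_coef (pole Omega (p i)) (c j) (s j) n * toC (rho j) ^+ n.
have nrho j n : nrm (toC (rho j) ^+ n) = rho j ^+ n by rewrite nrmX nrm_toC gtr0_norm.
have bB j n i : nrm (b j n i) <= 2 / s j / s j ^+ n * rho j ^+ n.
  rewrite nrmM nrho; apply: ler_wpM2r; first by rewrite exprn_ge0// ltW.
  exact: nrm_taylor_coef_pole (@pO i) (s0 j) oO (@sO j).
have bu j M : exists n, M < nrm (b j n j).
  have [n Hn] := taylor_coef_pole_unbounded M oO (@pO j) (s0 j) (@sO j) (rp j).
  by exists n; rewrite nrmM nrho.
pose a j n := taylor_coef f0 (c j) (s j) n * toC (rho j) ^+ n.
(* T j + 1 makes up for the loss of strictness in the limit. *)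
have [e [ew hump]] := gliding_hump a (fun j => T j + 1) w0 bB bu.
have e0 i : 0 <= e i by case/andP: (ew i).
have eD i : e i * (1 + D i) <= A * (1 / 2 ^+ i.+1).
  by rewrite -ler_pdivlMr//; case/andP: (ew i).
have e1 i : 0 <= e i <= 1 / 2 ^+ i.+1.
  by rewrite e0 /=; have := eD i; have := e0 i; have := D0 i; have := h0 i; nra.
have [f [fO fS fl]] := pole_series oO pO f0O e1.
pose S := pole_sum Omega p f0 e.
have diffS l N z : Omega z -> derive1n l (S N) z - derive1n l f0 z =
    \sum_(i < N) toC (e i) * derive1n l (pole Omega (p i)) z.
  by move=> Oz; rewrite (derive1n_pole_sum e oO pO f0O _ _ Oz) addrC addKr.
have term l i z : V z ->
    nrm (toC (e i) * derive1n l (pole Omega (p i)) z) <= e i * Dv i l.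
  move=> Vz; rewrite nrmM nrm_toC ger0_norm//; apply: ler_wpM2l => //; exact: DvP.
have close l z M : V z -> (forall N, \sum_(i < N) e i * Dv i l <= M) ->
    nrm (derive1n l f z - derive1n l f0 z) <= M.
  move=> Vz HM; have Oz := VO z Vz.
  apply: (@cvgn_nrm_le _ _ _ _ 0%N (cvgn_add (fl l z Oz) (@cvgn_cst _ (- derive1n l
      f0 z)))) => N _.
  rewrite diffS//; apply: le_trans (HM N).
  apply: (@nrm_sum_le N (fun i =>
      toC (e i) * derive1n l (pole Omega (p i)) z) (fun i => e i * Dv i l)) => i.
  exact: term.
exists f; split.
- split=> // l Fl; apply/bounded_nrm.
  have [M HM] := (bounded_nrm _ _).1 (f0b l Fl).
  have [M' HM'] : exists M', forall N, \sum_(i < N) e i * Dv i l <= M'.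
    exists (\sum_(i < l) e i * Dv i l + A) => N.
    have part k : \sum_(i < l + k) e i * Dv i l <= \sum_(i < l) e i * Dv i l +
        A * (1 - 1 / 2 ^+ k).
      elim: k => [|k IH]; first by rewrite addn0 expr0 divr1 subrr mulr0 addr0.
      rewrite addnS big_ord_recr /=.
      have h : e (l + k)%N * Dv (l + k)%N l <= A * (1 / 2 ^+ (l + k).+1).
        apply: le_trans (eD _); apply: ler_wpM2l => //.
        have lk : (l < l + k + L.+1)%N by rewrite addnS ltnS -addnA leq_addr.
        have := DvD _ _ lk.
        lra.
      have h2 : 1 / 2 ^+ (l + k).+1 <= 1 / 2 ^+ k.+1 :> R.
        rewrite !div1r lef_pV2 ?posrE ?exprn_gt0//.
        by rewrite ler_weXn2l ?ler1n// ltnS leq_addl.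
      have E : 1 / 2 ^+ k = 1 / 2 ^+ k.+1 + 1 / 2 ^+ k.+1 :> R.
        by rewrite (exprS _ k) !div1r invfM; set q := (2 ^+ _)^-1; lra.
      by move: IH h h2; rewrite E; nra.
    have mono : \sum_(i < N) e i * Dv i l <= \sum_(i < l + N) e i * Dv i l.
      rewrite addnC big_split_ord /= lerDl sumr_ge0// => i _; exact: mulr_ge0.
    apply: le_trans mono (le_trans (part N) _).
    have : 0 <= 1 / 2 ^+ N :> R by rewrite divr_ge0// exprn_ge0.
    nra.
  exists (M + M') => z Vz.
  have := nrm_le_dist (derive1n l f z) (derive1n l f0 z).
  by have := HM z Vz; have := close l z M' Vz HM'; lra.
- move=> j; have [n Hn] := hump j; exists n.
  have fd : holomorphic (disc (c j) (3 * s j)) f by move=> z /sO; exact: fO.1.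
  have Sd N : holomorphic (disc (c j) (3 * s j)) (S N).
    by move=> z /sO; exact: (@holomorphic_pole_sum R Omega p f0 e oO pO f0O N).
  have cv : (fun N => taylor_coef (S N) (c j) (s j) n) @ \oo --> taylor_coef f (c
      j) (s j) n.
    apply/cvgn_nrm => d dd.
    have k0 : 0 < 2 * (s j)^-1 / s j ^+ n by rewrite !mulr_gt0 ?invr_gt0 ?exprn_gt0.
    have [N HN] := half_pow_small k0 (divr_gt0 dd (ltr0n _ 2)).
    exists N => m Nm; rewrite nrmBC -(taylor_coef_sub n (s0 j) fd (Sd m)).
    have B v : on_side sw_corner 2 v ->
        nrm (scaled (fun w => f w - S m w) (c j) (s j) v) <= (s j)^-1 / 2 ^+ m.
      move=> /on_side_sw_corner[_ /nrm_sq v2]; apply: fS => // z zv; apply: sO.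
      rewrite /disc /= in zv *; have := nrmD (z - (c j + toC (s j) * v)) (toC (s j) * v).
      have -> : z - (c j + toC (s j) * v) + toC (s j) * v = z - c j by ring.
      by rewrite nrmM nrm_toC gtr0_norm//; have := s0 j; nra.
    have Dd : holomorphic (disc (c j) (3 * s j)) (fun w => f w - S m w).
      by move=> z zs; exact: derivable_sub (fd z zs) (Sd m z zs).
    have t := nrm_taylor_coef n (s0 j) Dd B.
    rewrite -ler_pdivlMr ?exprn_gt0// in t; apply: le_lt_trans t _.
    have E : 2 * ((s j)^-1 / 2 ^+ m) / s j ^+ n = 2 * (s j)^-1 / s j ^+ n / 2 ^+ m
        by ring.
    by rewrite E; apply: le_lt_trans (HN m Nm) _; lra.
  have cv2 := @cvgn_scale _ (toC (rho j) ^+ n) _ _ cv.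
  have : T j + 1 <= nrm (toC (rho j) ^+ n * taylor_coef f (c j) (s j) n).
    apply: (@cvgn_nrm_ge _ _ _ _ j.+1 cv2) => N jN; apply: ltW; have := Hn N jN.
    rewrite (taylor_coef_pole_sum e oO pO f0O n N (s0 j) (@sO j)) mulrDr mulr_sumr /a /b.
    rewrite (mulrC (taylor_coef f0 _ _ _)).
    have -> : \sum_(i < N) toC (e i) * (taylor_coef (pole Omega (p i)) (c j) (s j)
        n * toC (rho j) ^+ n) =
      \sum_(i < N) toC (rho j) ^+ n * (toC (e i) * taylor_coef (pole Omega (p i))
          (c j) (s j) n).
      by apply: eq_bigr => i _; ring.
    by [].
  by rewrite nrmM nrho mulrC; lra.
- move=> z Kz; have Oz := KO z Kz.
  apply: (@cvgn_nrm_le _ _ _ _ 0%N (cvgn_add (fl 0%N z Oz) (@cvgn_cst _ (- f0 z))))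
      => N _.
  rewrite (diffS 0%N N z Oz); apply: (@le_trans _ _ (\sum_(i < N) e i * D i)).
    apply: (@nrm_sum_le N (fun i => toC (e i) * pole Omega (p i) z) (fun i =>
        e i * D i)) => i.
    rewrite nrmM nrm_toC ger0_norm//; apply: ler_wpM2l => //.
    by apply: le_trans (DkP i z Kz) _; rewrite lerDl.
  exact: le_trans (sum_weighted N D0 eD (ltW A0) e0) Ad.
move=> l Fl lL z Vz; apply: close => // N.
apply: (@le_trans _ _ (\sum_(i < N) e i * D i)).
  apply: ler_sum => i _; apply: ler_wpM2l => //; apply: DvD.
  by rewrite addnS ltnS (leq_trans lL)// leq_addl.
exact: le_trans (sum_weighted N D0 eD (ltW A0) e0) Ad.
Qed.

End Condensation.

(** * A countable family of discs that detects extendability *)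

Section Index.
Context {R : realType}.
Variable Omega : set (C R).
Hypothesis oO : open Omega.

(** Codes of a disc, with rational centre and dyadic radius, and of a bound. *)
Definition disc_code : Type := ((rat * rat) * (nat * nat))%type.
Implicit Types (t : disc_code) (f : C R -> C R).

Definition code_center t : C R := toC (ratr t.1.1) + 'i%C * toC (ratr t.1.2).
Definition code_dist t : R := 1 / 2 ^+ t.2.1.
Definition code_bound t : R := t.2.2%:R.

Lemma code_dist_gt0 t : 0 < code_dist t.
Proof. by rewrite divr_gt0 ?exprn_gt0. Qed.

Lemma inner_radius_exists (c : C R) : exists k, Omega c ->
    disc c (3 * (1 / 2 ^+ k)) `<=` Omega.
Proof.
have [Oc|Oc] := pselect (Omega c); last by exists 0%N.
have [r r0 rO] := open_disc_sub oO Oc; have [k Hk] := half_pow_small ltr01 r0.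
exists k => _; apply: subset_trans rO; apply: disc_sub.
by have := Hk k (leqnn k); lra.
Qed.

Definition inner_radius_exp c := projT1 (cid (inner_radius_exists c)).
(** A radius that only depends on the centre, and is a power of 1/2, as the shrinking of
squares to a common one requires. *)
Definition inner_radius c : R := 1 / 2 ^+ inner_radius_exp c.

Lemma inner_radius_gt0 c : 0 < inner_radius c.
Proof. by rewrite divr_gt0 ?exprn_gt0. Qed.

Lemma inner_radiusP c : Omega c -> disc c (3 * inner_radius c) `<=` Omega.
Proof. exact: (projT2 (cid (inner_radius_exists c))). Qed.

Definition valid t := Omega (code_center t) /\ ~ (disc (code_center t) (code_dist
    t) `<=` Omega).

(** The Cauchy estimates that f would satisfy if it extended to the coded disc with
the coded bound. *)
Definition tame t f := forall n,
    nrm (taylor_coef f (code_center t) (inner_radius (code_center t)) n) *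
    code_dist t ^+ n <= code_bound t.

Lemma rational_dense (O : set (C R)) : open O -> O !=set0 ->
  exists q : rat * rat, O (toC (ratr q.1) + 'i%C * toC (ratr q.2)).
Proof.
move=> /open_nrm oA [z /oA[e e0 He]].
have h (x : R) : exists q : rat, `|ratr q - x| < e / 2.
  have [|q] := @rat_in_itvoo R (x - e / 2) (x + e / 2); first by lra.
  by rewrite in_itv /= => /andP[h1 h2]; exists q; rewrite ltr_norml; lra.
have [q1 h1] := h (complex.Re z); have [q2 h2] := h (complex.Im z).
exists (q1, q2); apply: He; apply: le_lt_trans (nrm_le_ReIm _) _.
by rewrite !ReIm_simp oppr0 addr0 add0r /=; lra.
Qed.

Lemma extendable_tame f : holomorphic Omega f ->
  extendable Omega f <-> exists t, valid t /\ tame t f.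
Proof.
move=> fd; split=> [ext|[t [[Oc nO] tt]]]; last first.
  exact: (coef_bound_extendable oO fd (inner_radius_gt0 (code_center t))
      (inner_radiusP Oc) (code_dist_gt0 t) nO tt).
have [w [r0 [nOw r00 H]]] := extendable_coef_bound oO fd ext.
have [m Hm] := half_pow_small ltr01 r00.
have [O [oA A0 AO HA]] := H (1 / 2 ^+ m) (half_pow_gt0 m ltr01) (Hm m (leqnn m)).
have [q Aq] := rational_dense oA A0.
set c := toC _ + _ in Aq; have [Oc wc] := AO _ Aq.
have [M HM] := HA _ Aq (inner_radius c) m (inner_radius_exp c) (inner_radius_gt0 c)
    (inner_radiusP Oc) (mulrAC _ _ _).
exists (q, (m, Num.bound `|M|)); split.
  by split=> [|sub]; [exact: Oc|apply: nOw; apply: sub; rewrite /disc /= nrmBC].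
move=> n; apply: le_trans (HM n) _; apply: ltW.
exact: le_lt_trans (ler_norm M) (archi_boundP (normr_ge0 M)).
Qed.

(** A point of the disc outside Omega is a possible pole if it is not in the closure of
V. Otherwise it is a boundary point of Omega, and points outside the closure of
Omega accumulate there. *)
Lemma pole_exists V t : valid t -> V `<=` Omega ->
  (forall zeta : C R, closure V zeta -> boundary Omega zeta ->
     forall e : C R, 0 < e -> exists2 z : C R, ~ closure Omega z & `|z - zeta| < e) ->
  exists p, [/\ disc (code_center t) (code_dist t) p, ~ Omega p & ~ closure V p].
Proof.
move=> [Oc nsub] VO H.
have [w [wr Ow]] : exists w, disc (code_center t) (code_dist t) w /\ ~ Omega w.
  apply: contrapT => h; apply: nsub => w wr; apply: contrapT => Ow; apply: h.
  by exists w.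
have [Vw|Vw] := pselect (closure V w); last by exists w.
have VOc : closure V `<=` closure Omega by exact: closure_subset.
have bw : boundary Omega w by split; [exact: VOc|move=> /interior_subset].
have d0 : 0 < code_dist t - nrm (w - code_center t) by rewrite subr_gt0.
have [|z Oz] := H w Vw bw (toC (code_dist t - nrm (w - code_center t)));
    first by rewrite toC_gt0.
rewrite nrmE ltcR => zw; exists z; split.
- by rewrite /disc /=; have := nrmD (z - w) (w - code_center t); rewrite addrA subrK; lra.
- by move=> Oz'; apply: Oz; exact: subset_closure.
- by move=> Vz; apply: Oz; exact: VOc.
Qed.

End Index.

Section SupNorm.
Context {R : realType}.
Implicit Types (A : set (C R)) (u v : C R -> C R).

Lemma sup_norm_ub A u M z : (forall z, A z -> nrm (u z) <= M) -> A z ->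
    nrm (u z) <= sup_norm A u.
Proof.
move=> uM Az; apply: ub_le_sup; last by exists z.
by exists M => _ [w Aw <-]; exact: uM.
Qed.

Lemma sup_norm_le A u M : 0 <= M -> (forall z, A z -> nrm (u z) <= M) ->
    sup_norm A u <= M.
Proof.
move=> M0 uM; have [[z Az]|A0] := pselect (A !=set0).
  by apply: ge_sup; [exists (nrm (u z)); exists z|move=> _ [w Aw <-]; exact: uM].
have -> : A = set0 by apply/seteqP; split => // z Az; apply: A0; exists z.
by rewrite /sup_norm image_set0 sup0.
Qed.

Lemma sup_norm_ge0 A u M : (forall z, A z -> nrm (u z) <= M) -> 0 <= sup_norm A u.
Proof.
move=> uM; have [[z Az]|A0] := pselect (A !=set0).
  exact: le_trans (nrm_ge0 _) (sup_norm_ub uM Az).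
have -> : A = set0 by apply/seteqP; split => // z Az; apply: A0; exists z.
by rewrite /sup_norm image_set0 sup0.
Qed.

Lemma sup_norm_perturb A u v M d : (forall z, A z -> nrm (v z) <= M) -> 0 <= d ->
  (forall z, A z -> nrm (u z - v z) <= d) -> sup_norm A u <= sup_norm A v + d.
Proof.
move=> vM d0 uv; apply: sup_norm_le; first by rewrite addr_ge0// (sup_norm_ge0 vM).
move=> z Az; have := nrm_le_dist (u z) (v z); have := sup_norm_ub vM Az.
have := uv z Az; lra.
Qed.

End SupNorm.

(** * The topology of the function space *)

Section Space.
Context {R : realType}.
Variables (Omega V : set (C R)) (F : set nat) (K : nat -> set (C R)).
Hypotheses (oO : open Omega) (VO : V `<=` Omega) (exK : exhaustive K Omega).
Local Notation X := (Xspace Omega V F K).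
Implicit Types (f g : X) (u v : C R -> C R).

Lemma XfunP f : bounded_derivatives Omega V F (Xfun f).
Proof. exact: set_valP. Qed.

Definition Xof u (Xu : bounded_derivatives Omega V F u) : X := SigSub (mem_set Xu).

Lemma Xhol f : holomorphic Omega (Xfun f).
Proof. by case: (XfunP f) => -[]. Qed.

Lemma open_Xball P f r : seminorms V F K P -> open (Xball P f r : set X).
Proof.
move=> HP; exists [set (Xball P f r : set X)].
  by move=> _ ->; apply: (@finI_from1 _ _ (@Xsubbase R Omega V F K) id); exists P, f, r.
by rewrite bigcup_set1.
Qed.

Lemma open_locally (A : set X) :
  (forall f, A f -> exists2 B : set X, open B & B f /\ B `<=` A) -> open A.
Proof.
move=> H; rewrite openE => f /H[B oB [Bf BA]].
by rewrite /interior nbhsE; exists B.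
Qed.

Lemma K_bounded m u : holomorphic Omega u -> exists M, forall z, K m z -> nrm (u z) <= M.
Proof.
move=> ud; have [cK KO _ _] := exK.
by have [M _ HM] := compact_bounded_holomorphic (cK m) (KO m) ud; exists M.
Qed.

Lemma holomorphic_sub u v : holomorphic Omega u -> holomorphic Omega v ->
  holomorphic Omega (u \- v).
Proof. by move=> ud vd z Oz; exact: derivable_sub (ud z Oz) (vd z Oz). Qed.

Lemma derive1n_sub l u v z : holomorphic Omega u -> holomorphic Omega v -> Omega z ->
  derive1n l (u \- v) z = derive1n l u z - derive1n l v z.
Proof.
move=> ud vd Oz.
have -> : u \- v = (fun w => u w + (-1) * v w) by apply/funext => w; rewrite mulN1r.
by rewrite (derive1n_lin _ _ oO ud vd Oz) mulN1r.
Qed.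

(** The elementary neighbourhoods of v: a single compact set of the exhaustion and
finitely many derivatives. *)
Definition close m L (d : R) u v := (forall z, K m z -> nrm (u z - v z) <= d) /\
  (forall l, F l -> (l <= L)%N -> forall z, V z ->
      nrm (derive1n l u z - derive1n l v z) <= d).

Lemma K_le m m' : (m <= m')%N -> K m `<=` K m'.
Proof.
move=> mm; rewrite -(subnKC mm); elim: (m' - m)%N => [|k IH]; first by rewrite addn0.
by rewrite addnS; case: exK => _ _ KS _; apply: subset_trans (KS _).
Qed.

Lemma close_le m m' L L' d d' u v : (m <= m')%N -> (L <= L')%N -> d' <= d ->
  close m' L' d' u v -> close m L d u v.
Proof.
move=> mm LL dd [h1 h2]; split=> [z Kz|l Fl lL z Vz].
  by apply: le_trans dd; apply: h1; exact: K_le mm _ Kz.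
by apply: le_trans dd; apply: h2 => //; exact: leq_trans LL.
Qed.

Lemma Xball_close P f g r : seminorms V F K P -> Xball P g r f ->
  exists m L d, 0 < d /\ forall h : X, close m L d (Xfun h) (Xfun f) -> Xball P g r h.
Proof.
have dfg := holomorphic_sub (@Xhol f) (@Xhol g).
rewrite /Xball; case=> [[m _ <-]|[l Fl <-]] /= fr.
  pose d := (r - sup_norm (K m) (Xfun f \- Xfun g)) / 2.
  have d0 : 0 < d by rewrite divr_gt0// subr_gt0.
  exists m, 0%N, d; split => // h [h1 _].
  have [M HM] := K_bounded m dfg.
  have := @sup_norm_perturb R (K m) (Xfun h \- Xfun g) (Xfun f \- Xfun g) M d HM (ltW d0).
  have q z : K m z -> nrm ((Xfun h \- Xfun g) z - (Xfun f \- Xfun g) z) <= d.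
    move=> Kz; have -> : (Xfun h \- Xfun g) z - (Xfun f \- Xfun g) z = Xfun h z -
        Xfun f z.
      by rewrite /=; ring.
    exact: h1.
  by move=> /(_ q); rewrite /d; lra.
pose d := (r - sup_norm V (derive1n l (Xfun f \- Xfun g))) / 2.
have d0 : 0 < d by rewrite divr_gt0// subr_gt0.
exists 0%N, l, d; split => // h [_ h2].
have [M1 HM1] := (bounded_nrm _ _).1 ((XfunP f).2 l Fl).
have [M2 HM2] := (bounded_nrm _ _).1 ((XfunP g).2 l Fl).
have HM z : V z -> nrm (derive1n l (Xfun f \- Xfun g) z) <= M1 + M2.
  move=> Vz; rewrite (derive1n_sub l (@Xhol f) (@Xhol g) (VO Vz)).
  by apply: le_trans (nrmB _ _) _; apply: lerD; [exact: HM1|exact: HM2].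
have := @sup_norm_perturb R V (derive1n l (Xfun h \- Xfun g)) (derive1n l (Xfun f
    \- Xfun g)) (M1 + M2) d HM (ltW d0).
have q z : V z -> nrm (derive1n l (Xfun h \- Xfun g) z - derive1n l (Xfun f \- Xfun
    g) z) <= d.
  move=> Vz; rewrite (derive1n_sub l (@Xhol h) (@Xhol g) (VO Vz)) (derive1n_sub l
      (@Xhol f) (@Xhol g) (VO Vz)).
  have -> : derive1n l (Xfun h) z - derive1n l (Xfun g) z - (derive1n l (Xfun f) z
      - derive1n l (Xfun g) z)
     = derive1n l (Xfun h) z - derive1n l (Xfun f) z by ring.
  exact: h2.
by move=> /(_ q); rewrite /d; lra.
Qed.

Lemma open_basis (O : set X) f : open O -> O f ->
  exists E : seq (set X), [/\ forall A, A \in E -> Xsubbase A,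
    forall A, A \in E -> A f & forall h : X, (forall A, A \in E -> A h) -> O h].
Proof.
move=> [D' sD' <-] [B DB Bf]; have [E sE EB] := sD' B DB.
exists (finmap.enum_fset E); split.
- by move=> A AE; exact: (set_mem (sE A AE)).
- by move=> A AE; move: Bf; rewrite -EB; apply.
- move=> h Eh; exists B; first exact: DB.
  suff : (B : set X) h by [].
  by rewrite -EB => A AE; exact: Eh.
Qed.

Lemma open_close (O : set X) f : open O -> O f ->
  exists m L d, 0 < d /\ forall h : X, close m L d (Xfun h) (Xfun f) -> O h.
Proof.
move=> oA Of; have [E [subE Ef EO]] := open_basis oA Of.
have seqE (s : seq (set X)) : {subset s <= E} ->
    exists m L d, 0 < d /\ forall h : X, close m L d (Xfun h) (Xfun f) ->
        forall A, A \in s -> A h.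
  elim: s => [|A s IH] sub; first by exists 0%N, 0%N, 1; split.
  have [m [L [d [d0 H]]]] := IH (fun A' h => sub A' (mem_behead (s := A :: s) h)).
  have AE : A \in E by apply: sub; rewrite mem_head.
  have [P [g [r [HP EA]]]] := subE A AE.
  have fA : Xball P g r f by rewrite -EA; exact: Ef.
  have [m' [L' [d' [d0' H']]]] := Xball_close HP fA.
  exists (maxn m m'), (maxn L L'), (Num.min d d'); split; first by rewrite lt_min d0.
  move=> h hc A'; rewrite inE => /orP[/eqP ->|A's].
    by rewrite EA; apply: H'; apply: close_le hc; rewrite ?leq_maxr// ge_min lexx orbT.
  by apply: H A's; apply: close_le hc; rewrite ?leq_maxl// ge_min lexx.
have [m [L [d [d0 H]]]] := seqE E (fun A h => h).
by exists m, L, d; split => // h /H Hh; apply: EO.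
Qed.

Lemma compact_sides (c : C R) (s : R) : compact ((fun v : C R =>
    c + toC s * v) @` on_side sw_corner 2).
Proof.
pose line (a d : C R) := (fun t : R => a + toC t * d) @` `[0, 1]%classic.
have cl a d : compact (line a d).
  apply: continuous_compact; last exact: segment_compact.
  by apply: continuous_subspaceT; exact: continuous_line.
have -> : (fun v : C R => c + toC s * v) @` on_side sw_corner 2 =
    line (c + toC s * sw_corner) (toC s * toC 2) `|` line (c +
        toC s * (sw_corner + toC 2)) (toC s * ('i%C * toC 2)) `|`
    line (c + toC s * (sw_corner + 'i%C * toC 2)) (toC s * toC 2) `|` line (c +
        toC s * sw_corner) (toC s * ('i%C * toC 2)).
  have e a d t : c + toC s * (a + toC t * d) = c + toC s * a +
      toC t * (toC s * d) by ring.
  have i01 t : (`[0, 1]%classic : set R) t = (0 <= t <= 1) :> Prop by rewrite /= in_itv.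
  apply/seteqP; split.
    move=> _ [v [t t01 hv] <-]; rewrite -i01 in t01.
    by case: hv => [->|[->|[->|->]]]; rewrite e; [left; left; left|left; left;
        right|left; right|right];
       exists t.
  by move=> w [[[[t t01 <-]|[t t01 <-]]|[t t01 <-]]|[t t01 <-]]; rewrite i01 in t01;
    rewrite -e; eexists; try reflexivity; exists t => //; auto 6.
by apply: compactU (cl _ _); apply: compactU (cl _ _); exact: compactU (cl _ _) (cl _ _).
Qed.

(** The Taylor coefficients of f at c only involve its values on a contour, which is a
compact subset of Omega. *)
Lemma open_coef c s n (rho M : R) : 0 < s -> disc c (3 * s) `<=` Omega -> 0 < rho ->
  open [set f : X | M < nrm (taylor_coef (Xfun f) c s n) * rho ^+ n].
Proof.
move=> s0 sO r0; apply: open_locally => f /= fM.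
have hs u : holomorphic Omega u ->
    holomorphic (disc c (3 * s)) u by move=> ud z /sO; exact: ud.
have subO : (fun v : C R => c + toC s * v) @` on_side sw_corner 2 `<=` Omega.
  move=> _ [v /on_side_sw_corner[_ /nrm_sq v2] <-]; apply: sO.
  by rewrite /disc /= addrC addKr nrmM nrm_toC gtr0_norm//; nra.
have [cK KO _ Kall] := exK; have [m Hm] := Kall _ (@compact_sides c s) subO.
pose q := rho ^+ n / s ^+ n; have q0 : 0 < q by rewrite divr_gt0 ?exprn_gt0.
pose gap := nrm (taylor_coef (Xfun f) c s n) * rho ^+ n - M.
have gap0 : 0 < gap by rewrite subr_gt0.
pose d := gap / (4 * q); have d0 : 0 < d by apply: divr_gt0 => //; exact: mulr_gt0.
have sm : seminorms V F K (sup_norm (K m)) by left; exists m.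
exists (Xball (sup_norm (K m)) f d); first exact: open_Xball sm.
split.
  rewrite /Xball /=; apply: le_lt_trans d0; apply: sup_norm_le => // z _.
  by rewrite /= subrr nrm0.
move=> g; rewrite /Xball /= => gd.
have dgf := holomorphic_sub (@Xhol g) (@Xhol f).
have [A HA] := K_bounded m dgf.
have B (v : C R) : on_side sw_corner 2 v -> nrm (scaled (Xfun g \- Xfun f) c s v) <= d.
  move=> sv; apply: le_trans (ltW gd); apply: (sup_norm_ub HA); apply: Hm.
  by exists v.
have t := nrm_taylor_coef n s0 (hs _ dgf) B.
rewrite (taylor_coef_sub n s0 (hs _ (@Xhol g)) (hs _ (@Xhol f))) -ler_pdivlMr
    ?exprn_gt0// in t.
have t2 : nrm (taylor_coef (Xfun g) c s n - taylor_coef (Xfun f) c s n) * rho ^+ n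
    <= gap / 2.
  have -> : gap / 2 = 2 * d / s ^+ n * rho ^+ n.
    have -> : 2 * d / s ^+ n * rho ^+ n = 2 * d * q by rewrite /q; ring.
    by rewrite /d; field; rewrite gt_eqF.
  by apply: ler_wpM2r t; rewrite exprn_ge0// ltW.
have rn : 0 < rho ^+ n by rewrite exprn_gt0.
have := nrm_le_dist (taylor_coef (Xfun f) c s n) (taylor_coef (Xfun g) c s n);
    rewrite nrmBC.
move: gap0 t2; rewrite /gap; nra.
Qed.

End Space.

(** * Density and the G-delta property *)

Section Main.
Context {R : realType}.
Variables (Omega V : set (C R)) (F : set nat) (K : nat -> set (C R)).
Hypotheses (oO : open Omega) (VO : V `<=` Omega) (exK : exhaustive K Omega).
Hypothesis outside : forall zeta : C R, closure V zeta -> boundary Omega zeta ->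
  forall e : C R, 0 < e -> exists2 z : C R, ~ closure Omega z & `|z - zeta| < e.
Local Notation X := (Xspace Omega V F K).
Local Notation NE := [set f : X | non_extendable Omega (Xfun f)].

Lemma non_extendable_tame u : holomorphic Omega u ->
  non_extendable Omega u <-> forall t : disc_code, valid Omega t -> ~ tame oO t u.
Proof.
move=> ud; rewrite /non_extendable (extendable_tame oO ud); split=> H.
  by move=> t vt tt; apply: H; exists t.
by move=> [t [vt]]; exact: H vt.
Qed.

Lemma open_wild (t : disc_code) : valid Omega t ->
    open [set f : X | ~ tame oO t (Xfun f)].
Proof.
move=> [Oc _]; apply: open_locally => f /= ft.
have [n fn] : exists n,
    code_bound t < nrm (taylor_coef (Xfun f) (code_center t) (inner_radius oO
    (code_center t)) n) * code_dist t ^+ n.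
  apply: contrapT => H; apply: ft => n; rewrite leNgt; apply/negP => h.
  by apply: H; exists n.
exists [set g : X | code_bound t < nrm (taylor_coef (Xfun g) (code_center t)
    (inner_radius oO (code_center t)) n) * code_dist t ^+ n].
  exact: (@open_coef R Omega V F K exK _ _ n _ (code_bound t) (inner_radius_gt0 oO
      (code_center t)) (@inner_radiusP R Omega oO _ Oc) (code_dist_gt0 t)).
by split => // g gn gt; have := gt n; rewrite leNgt gn.
Qed.

Lemma Gdelta_non_extendable : Gdelta NE.
Proof.
pose G i : set X := if unpickle i is Some t then
  [set f : X | valid Omega t -> ~ tame oO (t : disc_code) (Xfun f)] else setT.
exists G.
  move=> i; rewrite /G; case: unpickle => [t|]; last exact: openT.
  have [vt|vt] := pselect (valid Omega t).
    rewrite (_ : [set f : X | _] = [set f : X | ~ tame oO t (Xfun f)]);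
        first exact: open_wild.
    by apply/seteqP; split => f /=; auto.
  rewrite (_ : [set f : X | _] = setT); first exact: openT.
  by apply/seteqP; split => f //= _ /vt.
apply/seteqP; split=> f /=.
  move=> /(non_extendable_tame (@Xhol R Omega V F K f)) fne i _; rewrite /G.
  by case: unpickle => // t; exact: fne.
move=> fG; apply/(non_extendable_tame (@Xhol R Omega V F K f)) => t.
by have := fG (pickle t) I; rewrite /G pickleK.
Qed.

(** Condensation near f, with one pole for each valid code; if there is none,
every function is non-extendable. *)
Lemma dense_non_extendable : dense NE.
Proof.
move=> O [f Of] oA; have [m [L [d [d0 H]]]] := open_close oO VO exK oA Of.
have [[t0 vt0]|none] := pselect (exists t : disc_code, valid Omega t); last first.
  exists f; split => //; apply/(non_extendable_tame (@Xhol R Omega V F K f)) => t vt.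
  by case: none; exists t.
(* An enumeration of the valid codes, with t0 in place of the other codes. *)
pose tt (j : nat) : disc_code := if unpickle j is Some t then if `[< valid Omega t
    >] then t else t0 else t0.
have vtt j : valid Omega (tt j).
  by rewrite /tt; case: unpickle => // t; case: asboolP.
have ttE t : valid Omega t -> tt (pickle t) = t.
  by move=> vt; rewrite /tt pickleK; case: asboolP.
have pole_data j : exists p : C R,
    [/\ disc (code_center (tt j)) (code_dist (tt j)) p, ~ Omega p & ~ closure V p].
  exact: pole_exists (vtt j) VO outside.
pose p j := projT1 (cid (pole_data j)).
have pP j : [/\ disc (code_center (tt j)) (code_dist (tt j)) (p j),
    ~ Omega (p j) & ~ closure V (p j)].
  exact: (projT2 (cid (pole_data j))).
have [cK KO _ _] := exK.
have [] := @condensation R Omega V F (K m) (fun j => code_center (tt j)) p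
  (fun j => inner_radius oO (code_center (tt j))) (fun j =>
      code_dist (tt j)) (fun j => code_bound (tt j)) (Xfun f) d L
  oO VO (cK m) (KO m) _ (XfunP f) d0.
  move=> j; have [h1 h2 h3] := pP j; split => //; first exact: inner_radius_gt0.
  by case: (vtt j) => h _; exact: (@inner_radiusP R Omega oO _ h).
move=> u [Xu wild uK uV]; exists (Xof K Xu); split; first by apply: H; split.
apply/(non_extendable_tame (@Xhol R Omega V F K (Xof K Xu))) => t vt tt_u.
have [n] := wild (pickle t); rewrite ttE// => hn.
by have := tt_u n; rewrite leNgt hn.
Qed.

Lemma zero_bounded : bounded_derivatives Omega V F (fun=> 0).
Proof.
split=> [|l _]; first by split => // z _; exact: derivable_const.
apply/bounded_nrm; exists 0 => z _.
suff -> : derive1n l (fun=> 0) = (fun=> 0) :> (C R -> C R) by rewrite nrm0.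
elim: l => [//|l IH]; rewrite derive1nS IH; apply/funext => w; exact: derive1_cst.
Qed.

End Main.

Theorem corollary5p1 (R : realType) (Omega V : set (C R)) (F : set nat)
    (K : nat -> set (C R)) :
  domain Omega -> open V -> V `<=` Omega -> exhaustive K Omega ->
  (forall zeta : C R, closure V zeta -> boundary Omega zeta ->
     forall e : C R, 0 < e ->
       exists2 z : C R, ~ closure Omega z & `|z - zeta| < e) ->
  domain_of_holomorphy (bounded_derivatives Omega V F) Omega /\
  Gdelta [set f : Xspace Omega V F K | non_extendable Omega (Xfun f)] /\
  dense [set f : Xspace Omega V F K | non_extendable Omega (Xfun f)].
Proof.
move=> [_ oO _] _ VO exK outside.
have dNE := @dense_non_extendable R Omega V F K oO VO exK outside.
split; last by split; [exact: Gdelta_non_extendable|exact: dNE].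
have [|f [_ fne]] := dNE setT _ openT;
    first by exists (Xof K (@zero_bounded R Omega V F)).
by exists (Xfun f); [exact: XfunP|exact: fne].
Qed.
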